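(* Let $M$ be a target manifold with its fixed open cover $\{U_i\}_{i\in J}$. There is a one-to-one correspondence between $U(1)$-bundles with connection on $M$ and smooth, thin invariant, rank-$1$, embedded, $1$-dimensional TQFT's with target $M$. The correspondence is the one sending the bundle with connection $(g_{ij},A_j)_{i,j\in J}$ to the pair $(Z',Z)$ given by $$Z'(y^+,i,j)=g_{ij}(y),\qquad Z'(y^-,i,j)=\overline{g_{ij}(y)},$$ $$Z(p,T)=\exp\Big(\mathrm{i}\int_{x_0}^{x_1}p^*A_{i_1}\Big)\, g_{i_1i_2}(p(x_1))\,\exp\Big(\mathrm{i}\int_{x_1}^{x_2}p^*A_{i_2}\Big)\, g_{i_2i_3}(p(x_2))\cdots\exp\Big(\mathrm{i}\int_{x_{N-1}}^{x_N}p^*A_{i_N}\Big).$$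
   Context: Here $\mathrm{i}$ denotes the imaginary unit. Target: $M$ is a fixed finite-dimensional smooth real manifold with an open cover $\{U_i\}_{i\in J}$ such that every non-empty finite intersection $U_{i_1\ldots i_p}=U_{i_1}\cap\cdots\cap U_{i_p}$ is contractible. Bundles with connection: a $U(1)$-bundle with connection on $M$ is a collection of smooth functions $g_{ij}:U_{ij}\to U(1)$ and smooth real $1$-forms $A_j\in\Lambda^1(U_j)$ ($i,j\in J$) satisfying (B1) $g_{ij}g_{jk}=g_{ik}$ on $U_{ijk}$ and (B2) $\mathrm{i}(A_k-A_j)=d\log g_{jk}$ on $U_{jk}$. Such collections are not identified up to equivalence. Objects: an irreducible subobject is $(y^\pm,i)$ with $y\in U_i$ and a sign. For $y\in U_i\cap U_j$, $(y^\pm,i,j)$ denotes the isomorphism $(y^\pm,i)\to(y^\pm,j)$. An object $(p,T)$ is a smooth path $p:[a,b]\to M$ that is constant on $[a,a+\epsilon[$ and on $]b-\epsilon,b]$ for some $\epsilon>0$, with a labelled partition $T$: points $a=x_0<x_1<\dots<x_N=b$ and labels $i_\alpha\in J$ with $p([x_{\alpha-1},x_\alpha])\subset U_{i_\alpha}$, $\alpha=1,\dots,N$. TQFT: a rank-$1$, embedded, $1$-dimensional TQFT (with target $M$) is a pair of assignments $(y^\pm,i,j)\mapsto Z'(y^\pm,i,j)\in U(1)$, $(p,T)\mapsto Z(p,T)\in U(1)$ such that: (i) $Z'(y^\pm,i,j)Z'(y^\pm,j,k)=Z'(y^\pm,i,k)$ for $y\in U_{ijk}$; (ii) for objects $(p,T)$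 with $p:[a,b]\to M$ and labels $i_1,\dots,i_N$, and $(p',T')$ with $p':[a',b']\to M$ and labels $i'_1,\dots,i'_{N'}$, and any orientation-preserving diffeomorphism $f:[a,b]\to[a',b']$ with $p=p'\circ f$ (no requirement relating $T$ and $T'$), $Z(p',T')=Z'(p(a)^-,i_1,i'_1)\,Z(p,T)\,Z'(p(b)^+,i_N,i'_{N'})$; (iii) for $(p,T)$ on $[a,b]$ and $(p',T')$ on $[b,c]$ with $p(b)=p'(b)$, $Z(p\circ p',T\circ T')=Z(p,T)\,Z'(p(b)^+,i_N,i'_1)\,Z(p',T')$, where $p\circ p':[a,c]\to M$ is $p$ on $[a,b]$ and $p'$ on $[b,c]$, and $T\circ T'$ is the concatenated labelled partition of $[a,c]$. Thin invariance: $Z(p,T)=Z(p',T')$ whenever $p,p'$ are defined on the same interval $[a,b]$, $i_1=i'_1$, $i_N=i'_{N'}$, and there is a relative homotopy $(H,\tilde T)$ from $(p,T)$ to $(p',T')$ with $\operatorname{rank}DH\le 1$ everywhere. Here $H:[a,b]\times[0,1]\to M$ is a smooth homotopy from $p$ to $p'$ fixing endpoints, and $\tilde T$ is a labelled partition of $[a,b]\times[0,1]$ (a finite embedded graph, trivalent at internal vertices, with each face $f$ labelled by some $i\in J$ with $H(f)\subset U_i$) that restricts to $T$ and $T'$ on the two edges $[a,b]\times\{0\}$, $[a,b]\times\{1\}$ and has constant label $i_1$, resp. $i_N$, on the sides $\{a\}\times[0,1]$, resp. $\{b\}\times[0,1]$. Smoothness: for any smooth $k$-dimensional family of objects $(p(u),T(u))$,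 $u\in U\subset\mathbb{R}^k$ open (any $k$), $Z(p(u),T(u))$ depends smoothly on $u$. A smooth family means that the interval endpoints and partition points depend smoothly on $u$, the labels are independent of $u$, and $(u,x)\mapsto p(u)(x)$ is smooth. *)

(* Defs.v *)
From HB Require Import structures.
From mathcomp Require Import all_boot all_order all_algebra complex.
From mathcomp Require Import all_classical all_reals all_analysis.

Set Implicit Arguments.
Unset Strict Implicit.
Unset Printing Implicit Defensive.

Import Order.TTheory GRing.Theory Num.Theory.
Import numFieldNormedType.Exports.

Local Open Scope classical_set_scope.
Local Open Scope ring_scope.

(* Partial functions are encoded by canonical total functions, so that Leibniz
   equality is equality on the domain: a function on a subset of M, or a 1-form
   on such a subset, is extended by 0; a path on [a, b] is extended by its two
   end values. *)

Section Smooth.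
Variables (R : realType) (V : normedModType R).

(* Directions range over all of V, not over a basis: on an open O of a
   finite-dimensional V this is the usual C^k. *)
Fixpoint C_k (W : normedModType R) (k : nat) (O : set V) (f : V -> W) : Prop :=
  (forall x, O x -> {for x, continuous f}) /\
  if k is k'.+1 then
    forall v, (forall x, O x -> derivable f x v) /\
              C_k k' O (fun x => 'D_v f x)
  else True.

Definition smooth (W : normedModType R) (O : set V) (f : V -> W) : Prop :=
  forall k, C_k k O f.

Definition smoothC (O : set V) (f : V -> R[i]) : Prop :=
  smooth O (fun x => complex.Re (f x)) /\ smooth O (fun x => complex.Im (f x)).

Definition local_extension (T : Type) (P : set V -> (V -> T) -> Prop)
    (D : set V) (f : V -> T) (x : V) (O : set V) (g : V -> T) : Prop :=
  [/\ open O, O x, P O g & forall y, O y -> D y -> f y = g y].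

(* Smoothness of the restriction of f to an arbitrary subset D. *)
Definition smooth_within (W : normedModType R) (D : set V) (f : V -> W) : Prop :=
  forall x, D x -> exists O g, local_extension (@smooth W) D f x O g.

End Smooth.

(* Together with hausdorff_space M and second_countable M, a smooth manifold
   structure of dimension n on M. The map param c is the inverse of coord c. *)
Record smooth_atlas (R : realType) (n : nat) (M : topologicalType) := SmoothAtlas {
  chart : Type;
  dom : chart -> set M;
  coord : chart -> M -> 'rV[R]_n;
  param : chart -> 'rV[R]_n -> M;
  dom_open : forall c, open (dom c);
  img_open : forall c, open (coord c @` dom c);
  coordK : forall c y, dom c y -> param c (coord c y) = y;
  coord_continuous : forall c y, dom c y -> {for y, continuous (coord c)};
  param_continuous : forall c y, dom c y ->
    {for coord c y, continuous (param c)};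
  chart_cover : forall y, exists c, dom c y;
  transition_smooth : forall c c',
    smooth (coord c @` (dom c `&` dom c')) (coord c' \o param c) }.

Section Manifold.
Variables (R : realType) (n : nat) (M : topologicalType).
Variable X : smooth_atlas R n M.
Implicit Types c : chart X.

Definition chart_at (y : M) : chart X := sval (cid (chart_cover X y)).

Definition smooth_map (V : normedModType R) (O : set V) (f : V -> M) : Prop :=
  (forall x, O x -> {for x, continuous f}) /\
  forall c, smooth (O `&` f @^-1` dom c) (coord c \o f).

Definition smooth_map_within (V : normedModType R) (D : set V) (f : V -> M) :
    Prop :=
  forall x, D x -> exists O g, local_extension (@smooth_map V) D f x O g.

Definition smooth_functionC (O : set M) (f : M -> R[i]) : Prop :=
  forall c, smoothC (coord c @` (O `&` dom c)) (f \o param c).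

Definition partial (W : normedModType R) c (l : 'I_n) (f : M -> W) (y : M) : W :=
  'D_(delta_mx 0 l) (f \o param c) (coord c y).

(* A field of covectors is given by its components alpha c y in all charts c
   around y. *)
Definition smooth_1form (O : set M) (alpha : chart X -> M -> 'rV[R]_n) : Prop :=
  [/\ forall c y, ~ (O y /\ dom c y) -> alpha c y = 0,
      forall c c' y, O y -> dom c y -> dom c' y -> forall l,
        alpha c y 0 l =
        \sum_(m < n) alpha c' y 0 m * (partial c l (coord c') y) 0 m
    & forall c, smooth (coord c @` (O `&` dom c)) (fun x => alpha c (param c x))].

(* (p^* alpha)(d/dx) at x *)
Definition pullback (alpha : chart X -> M -> 'rV[R]_n) (p : R -> M) (x : R) : R :=
  let c := chart_at (p x) in
  \sum_(l < n) alpha c (p x) 0 l * ('D_1 (coord c \o p) x) 0 l.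

(* l-th component in the chart c of d log f *)
Definition dlog c (l : 'I_n) (f : M -> R[i]) (y : M) : R[i] :=
  (partial c l (fun z => complex.Re (f z)) y +i*
   partial c l (fun z => complex.Im (f z)) y)%C / f y.

Definition rank_le1 (D : set (R * R)) (H : R * R -> M) : Prop :=
  forall z O g c, D z -> local_extension (@smooth_map (R * R)%type) D H z O g ->
    dom c (H z) ->
    (\rank (col_mx ('D_((1%R, 0%R) : R * R) (coord c \o g) z)
                   ('D_((0%R, 1%R) : R * R) (coord c \o g) z)) <= 1)%N.

End Manifold.

Definition contractible (R : realType) (M : topologicalType) (O : set M) : Prop :=
  exists (y0 : M) (h : M * R -> M),
    [/\ O y0, {within O `*` `[0, 1], continuous h},
        forall y t, O y -> 0 <= t <= 1 -> O (h (y, t)),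
        forall y, O y -> h (y, 0) = y
      & forall y, O y -> h (y, 1) = y0].

Definition good_cover (R : realType) (M : topologicalType) (J : Type)
    (U : J -> set M) : Prop :=
  [/\ forall i, open (U i), \bigcup_i U i = setT
    & forall I : set J, finite_set I -> I !=set0 ->
        \bigcap_(i in I) U i !=set0 -> contractible R (\bigcap_(i in I) U i)].

(* The list a, i, [:: (x_1, i_2); ...; (x_(N-1), i_N)], b encodes the labelled
   partition of [a, b] with points a = x_0 < x_1 < ... < x_N = b and labels
   i = i_1, i_2, ..., i_N. *)
Fixpoint all_segments (R : realType) (J : Type) (P : R -> R -> J -> Prop)
    (a : R) (i : J) (s : seq (R * J)) (b : R) : Prop :=
  match s with
  | [::] => P a b i
  | (x, j) :: s' => P a x i /\ all_segments P x j s' b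
  end.

Section TQFT.
Variables (R : realType) (n : nat) (M : topologicalType).
Variable X : smooth_atlas R n M.
Variables (J : Type) (U : J -> set M).

(* As the path is locally constant at both ends, it is smooth on [a, b] iff its
   extension is smooth on the line. *)
Record object := Object {
  path_of :> R -> M;
  start : R;
  stop : R;
  first_label : J;
  breaks : seq (R * J);
  path_smooth : smooth_map X setT path_of;
  path_sitting : exists2 eps, 0 < eps &
    (forall x, x < start + eps -> path_of x = path_of start) /\
    (forall x, stop - eps < x -> path_of x = path_of stop);
  partition_increasing :
    all_segments (fun x y _ => x < y) start first_label breaks stop;
  partition_subordinate :
    all_segments (fun x y i => forall z, x <= z <= y -> U i (path_of z))
      start first_label breaks stop }.

Definition points (O : object) : seq R := [seq q.1 | q <- breaks O].
Definition later_labels (O : object) : seq J := [seq q.2 | q <- breaks O].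
Definition last_label (O : object) : J := last (first_label O) (later_labels O).

Record bundle_data := BundleData {
  transition : J -> J -> M -> R[i];
  connection : J -> chart X -> M -> 'rV[R]_n }.

Definition U1_bundle_with_connection (E : bundle_data) : Prop :=
  let g := transition E in
  let A := connection E in
  [/\ forall i j,
        [/\ forall y, ~ (U i y /\ U j y) -> g i j y = 0,
            forall y, U i y -> U j y -> `|g i j y| = 1
          & smooth_functionC X (U i `&` U j) (g i j)],
      forall j, smooth_1form (U j) (A j),
      forall i j k y, U i y -> U j y -> U k y ->
        g i j y * g j k y = g i k y
    & forall j k c y, U j y -> U k y -> dom c y -> forall l,
        (0 +i* (A k c y 0 l - A j c y 0 l))%C = dlog c l (g j k) y].

(* Z_point true is Z'(y^+, i, j) and Z_point false is Z'(y^-, i, j). *)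
Record tqft_data := TqftData {
  Z_point : bool -> J -> J -> M -> R[i];
  Z_path : object -> R[i] }.

Definition increasing_diffeo (a b a' b' : R) (f : R -> R) : Prop :=
  exists h : R -> R,
    [/\ smooth_within `[a, b] f, smooth_within `[a', b'] h,
        forall x, a <= x <= b -> a' <= f x <= b' /\ h (f x) = x,
        forall x, a' <= x <= b' -> a <= h x <= b /\ f (h x) = x
      & forall x y, a <= x -> x < y -> y <= b -> f x < f y].

Definition concatenation (O O' OO' : object) : Prop :=
  [/\ start O' = stop O, O (stop O) = O' (start O'),
      [/\ start OO' = start O, stop OO' = stop O',
          first_label OO' = first_label O
        & breaks OO' = breaks O ++ (stop O, first_label O') :: breaks O'],
      forall x, start O <= x <= stop O -> OO' x = O x
    & forall x, start O' <= x <= stop O' -> OO' x = O' x].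

Definition rank1_embedded_tqft (t : tqft_data) : Prop :=
  let Z' := Z_point t in
  let Z := Z_path t in
  [/\ [/\ forall e i j y, ~ (U i y /\ U j y) -> Z' e i j y = 0,
          forall e i j y, U i y -> U j y -> `|Z' e i j y| = 1
        & forall O, `|Z O| = 1],
      forall e i j k y, U i y -> U j y -> U k y ->
        Z' e i j y * Z' e j k y = Z' e i k y,
      forall (O O' : object) f,
        increasing_diffeo (start O) (stop O) (start O') (stop O') f ->
        (forall x, start O <= x <= stop O -> O x = O' (f x)) ->
        Z O' = Z' false (first_label O) (first_label O') (O (start O)) * Z O *
               Z' true (last_label O) (last_label O') (O (stop O))
    & forall O O' OO' : object, concatenation O O' OO' ->
        Z OO' = Z O * Z' true (last_label O) (first_label O') (O (stop O)) * Z O'].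

(* A finite graph embedded in [a, b] x [0, 1]: its edges have their interiors in
   the open rectangle; the boundary of the rectangle is not part of the data. *)
Record rect_graph := RectGraph {
  vertices : seq (R * R);
  edge : finType;
  arc : edge -> R -> R * R }.

Definition graph_set (G : rect_graph) : set (R * R) :=
  [set z | z \in vertices G] `|`
  [set z | exists e t, 0 <= t <= 1 /\ arc (e : edge G) t = z].

Definition rect (a b : R) : set (R * R) := `[a, b] `*` `[0, 1].
Definition open_rect (a b : R) : set (R * R) := `]a, b[ `*` `]0, 1[.

Definition embedded_trivalent (a b : R) (G : rect_graph) : Prop :=
  [/\ forall z, z \in vertices G -> rect a b z,
      forall e : edge G, [/\ {within `[0, 1], continuous (arc e)},
        arc e 0 \in vertices G & arc e 1 \in vertices G],
      forall (e : edge G) t, 0 < t < 1 ->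
        open_rect a b (arc e t) /\ arc e t \notin vertices G,
      forall (e e' : edge G) t t', 0 < t < 1 -> 0 < t' < 1 ->
        arc e t = arc e' t' -> e = e' /\ t = t'
    & forall z, z \in vertices G -> open_rect a b z ->
        (#|[set e : edge G | arc e 0 == z]| +
         #|[set e : edge G | arc e 1 == z]| = 3)%N].

(* The faces are the closures of the connected components of the complement of
   the graph. The labelling of the faces is a function on that complement,
   constant on components. *)
Definition labelled_faces (a b : R) (H : R * R -> M) (G : rect_graph)
    (lab : R * R -> J) : Prop :=
  let C := rect a b `\` graph_set G in
  forall z, C z ->
    (forall w, connected_component C z w -> lab w = lab z) /\
    (forall w, closure (connected_component C z) w -> U (lab z) (H w)).

Definition restricts_to (G : rect_graph) (lab : R * R -> J) (tau : R)
    (O : object) : Prop :=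
  all_segments (fun x y i => forall s, x < s < y ->
      ~ graph_set G (s, tau) /\ lab (s, tau) = i)
    (start O) (first_label O) (breaks O) (stop O) /\
  (forall x, x \in points O -> (x, tau) \in vertices G).

Definition smooth_homotopy (a b : R) (p p' : R -> M) (H : R * R -> M) : Prop :=
  [/\ smooth_map_within X (rect a b) H,
      forall x, a <= x <= b -> H (x, 0) = p x /\ H (x, 1) = p' x
    & forall t, 0 <= t <= 1 -> H (a, t) = p a /\ H (b, t) = p b].

Definition thin_homotopic (O O' : object) : Prop :=
  exists (H : R * R -> M) (G : rect_graph) (lab : R * R -> J),
    let a := start O in let b := stop O in
    [/\ smooth_homotopy a b O O' H, rank_le1 X (rect a b) H,
        embedded_trivalent a b G /\ labelled_faces a b H G lab,
        restricts_to G lab 0 O /\ restricts_to G lab 1 O'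
      & forall t, 0 <= t <= 1 ->
          (~ graph_set G (a, t) -> lab (a, t) = first_label O) /\
          (~ graph_set G (b, t) -> lab (b, t) = last_label O)].

Definition thin_invariant (t : tqft_data) : Prop :=
  forall O O' : object, start O = start O' -> stop O = stop O' ->
    first_label O = first_label O' -> last_label O = last_label O' ->
    thin_homotopic O O' -> Z_path t O = Z_path t O'.

Definition smooth_family (k : nat) (W : set 'rV[R]_k) (O : 'rV[R]_k -> object) :
    Prop :=
  [/\ smooth W (fun u => start (O u)) /\ smooth W (fun u => stop (O u)),
      forall u v, W u -> W v -> first_label (O u) = first_label (O v) /\
                                later_labels (O u) = later_labels (O v),
      forall m, smooth W (fun u => nth 0 (points (O u)) m)
    & smooth_map_within X
        [set q : 'rV[R]_k * R | W q.1 /\ start (O q.1) <= q.2 <= stop (O q.1)]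
        (fun q => O q.1 q.2)].

Definition smooth_tqft (t : tqft_data) : Prop :=
  forall (k : nat) (W : set 'rV[R]_k) (O : 'rV[R]_k -> object),
    open W -> smooth_family W O -> smoothC W (fun u => Z_path t (O u)).

Definition smooth_thin_invariant_tqft (t : tqft_data) : Prop :=
  [/\ rank1_embedded_tqft t, thin_invariant t & smooth_tqft t].

Definition expi (theta : R) : R[i] := (cos theta +i* sin theta)%C.

Fixpoint holonomy (E : bundle_data) (p : R -> M)
    (a : R) (i : J) (s : seq (R * J)) (b : R) : R[i] :=
  let phase y :=
    expi (\int[lebesgue_measure]_(x in `[a, y]) pullback (connection E i) p x) in
  match s with
  | [::] => phase b
  | (x, j) :: s' =>
      phase x * transition E i j (p x) * holonomy E p x j s' b
  end.

Definition tqft_of_bundle (E : bundle_data) : tqft_data :=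
  TqftData
    (fun e i j y => if e then transition E i j y else (transition E i j y)^*)
    (fun O => holonomy E O (start O) (first_label O) (breaks O) (stop O)).

End TQFT.

(* Main.v *)
(* A bundle with connection has horizontal lifts along paths; its TQFT compares the two end values
   of a lift, which gives the TQFT axioms. Along a homotopy of rank at most 1 the pulled back
   connection forms are closed, so that lifts exist over the whole rectangle: this is thin
   invariance.

   Conversely, let [Z] be a smooth thin invariant TQFT. The transition functions are [Z'], and the
   form [A_j] at [y] is the derivative of [Z] on short coordinate segments issuing from [y] (with
   label [j]); by Hadamard's lemma the derivative of [Z] along any curve only depends on its
   tangent vector, linearly. By thin invariance [Z] only depends on a path up to
   reparametrisations that may stop, even at points where the path does not sit; so [Z] is
   multiplicative, and satisfies the differential equation solved by the exponential of the
   integral of [A_j]. Differentiating the exponential formula recovers [A_j], whence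
   injectivity. *)

From mathcomp Require Import all_boot all_order all_algebra complex.
From mathcomp Require Import all_classical all_reals all_analysis.
From mathcomp Require Import ring lra.
Require Import Defs.

Set Implicit Arguments.
Unset Strict Implicit.
Unset Printing Implicit Defensive.

Import Order.TTheory GRing.Theory Num.Theory.
Import numFieldNormedType.Exports.

Local Open Scope classical_set_scope.
Local Open Scope ring_scope.

(** * Calculus in normed spaces *)

(** The axioms relate sitting paths, and only through diffeomorphisms, whereas differentiating [Z]
    calls for short segments that start and stop with non-zero velocity. Every segment is therefore
    run through the fixed function [step], and what this spoils is repaired by a single kind of thin
    homotopy: if two paths are [q \o psi0] and [q \o psi1] with the same end parameters,
    interpolating linearly between [psi0] and [psi1] gives a homotopy that factors through the line.
    This one homotopy yields both the product formula for consecutive segments and the possibility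
    of cutting an object at its partition points.

    Derivability here is directional, so the chain rule is obtained by moving one coordinate at a
    time and using the continuity of the derivatives. Maps on closed intervals and rectangles are
    smooth by local extension, hence the comparisons of one-sided derivatives at the boundary. Lifts
    and uniform estimates pass from local to global by one induction principle on intervals. *)

Section DirectionalDerivative.
Variables (R : realType) (V : normedModType R).

Lemma continuous_at_ext (T T' : topologicalType) (O : set T) (f g : T -> T') x :
  open O -> O x -> (forall y, O y -> f y = g y) ->
  {for x, continuous f} -> {for x, continuous g}.
Proof.
move=> oO Ox fg; rewrite /prop_for /continuous_at => cf; rewrite -(fg x Ox).
apply: cvg_trans cf; apply: near_eq_cvg.
by apply: filterS (open_nbhs_nbhs (conj oO Ox)) => y /fg.
Qed.

Lemma is_derive_ext (W : normedModType R) (O : set V) (f g : V -> W) x v l :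
  open O -> O x -> (forall y, O y -> f y = g y) ->
  is_derive x v f l -> is_derive x v g l.
Proof.
move=> oO Ox fg; apply: near_eq_is_derive.
by apply: filterS (open_nbhs_nbhs (conj oO Ox)) => y /fg.
Qed.

(** Reduces directional derivatives to one real variable, where the mean value theorem and the
    fundamental theorem of calculus are available. *)
Lemma is_derive_line (W : normedModType R) (f : V -> W) (z v : V) (s : R) l :
  is_derive (z + s *: v) v f l <-> is_derive s 1 (fun r : R => f (z + r *: v)) l.
Proof.
have E : (fun h : R => h^-1 *: (((fun r : R => f (z + r *: v)) \o shift s) (h *: 1)
              - f (z + s *: v))) =
         (fun h : R => h^-1 *: ((f \o shift (z + s *: v)) (h *: v) - f (z + s *: v))).
  by apply/funext => h /=; rewrite [h *: 1]mulr1 scalerDl addrCA.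
by split=> -[d <-]; (split; [move: d; rewrite /derivable E|rewrite /derive E]).
Qed.

Lemma is_derive_line0 (W : normedModType R) (f : V -> W) (z v : V) l :
  is_derive z v f l <-> is_derive (0 : R) 1 (fun r : R => f (z + r *: v)) l.
Proof. by rewrite -is_derive_line scale0r addr0. Qed.

End DirectionalDerivative.

Section ChainRule.
Variables (R : realType).

Lemma is_derive_continuous (f : R -> R) (x l : R) :
  is_derive x 1 f l -> {for x, continuous f}.
Proof.
by move=> [d _]; apply: differentiable_continuous; apply/derivable1_diffP.
Qed.

Lemma is_derive0P (f : R -> R) l :
  is_derive (0 : R) 1 f l <-> (h^-1 * (f h - f 0)) @[h --> 0^'] --> l.
Proof.
have E : (fun h : R => h^-1 *: ((f \o shift 0) (h *: 1) - f 0)) =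
         (fun h => h^-1 * (f h - f 0)).
  by apply/funext => h /=; rewrite [h *: 1]mulr1 addr0.
split=> [[d <-]|c]; first by move: d; rewrite /derivable /derive E.
split; rewrite ?/derivable ?/derive E; last exact: cvg_lim.
by apply/cvg_ex; exists l.
Qed.

Variable V : normedModType R.

(** Mean value theorem along the segment from [z] to [z + t *: e]. Parametrising it by [[0, 1]]
    treats both signs of [t] at once, and only the points of the segment have to lie in [O]. *)
Lemma segment_increment (g : V -> R) (O : set V) (e z : V) (t D eps : R) :
  (forall s : R, 0 <= s <= 1 -> O (z + (s * t) *: e)) ->
  (forall y, O y -> derivable g y e /\ `|'D_e g y - D| <= eps) ->
  `|g (z + t *: e) - g z - t * D| <= eps * `|t|.
Proof.
move=> seg dg.
have der (s : R) : 0 <= s <= 1 -> is_derive s 1 (fun s : R => g (z + (s * t) *: e))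
    ('D_e g (z + (s * t) *: e) * t).
  move=> /seg /dg [d _].
  have h1 : is_derive (s * t) 1 (fun r : R => g (z + r *: e)) ('D_e g (z + (s * t) *: e)).
    by apply: (is_derive_line g z e (s * t) _).1; exact: derivableP.
  apply: (is_derive1_comp (g := fun s => s * t) h1).
  have -> : (fun s : R => s * t) = t \*: id.
    by apply/funext => r /=; rewrite [LHS]mulrC.
  by apply: is_derive_eq; rewrite [_ *: _]mulr1.
have [c c01 E] : exists2 c, c \in `]0, 1[ & g (z + (1 * t) *: e) - g (z + (0 * t) *: e) =
    'D_e g (z + (c * t) *: e) * t * (1 - 0).
  apply: (MVT (f := fun s => g (z + (s * t) *: e))
     (df := fun s => 'D_e g (z + (s * t) *: e) * t) (ltr01)).
    by move=> x; rewrite in_itv/= => /andP[/ltW x0 /ltW x1]; apply: der; rewrite x0.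
  apply: derivable_within_continuous => x; rewrite in_itv/= => x01.
  by have [] := der _ x01.
move: E; rewrite mul1r mul0r scale0r addr0 subr0 mulr1 => ->.
have [|_ H] := dg (z + (c * t) *: e).
  by apply: seg; move: c01; rewrite in_itv/= => /andP[/ltW -> /ltW].
by rewrite [t * D]mulrC -mulrBl normrM ler_wpM2r.
Qed.

(** One step of the chain rule. The base point [y0 + S h] moves, but only its convergence to [y0]
    matters: by the mean value estimate the increment is [t h] times a number close to ['D_e g y0],
    because the derivative is continuous at [y0]. *)
Lemma increment_derive (g : V -> R) (O : set V) (y0 e : V) (S : R -> V)
    (t : R -> R) (tau : R) :
  open O -> O y0 -> (forall y, O y -> derivable g y e) ->
  {for y0, continuous (fun y => 'D_e g y)} ->
  S h @[h --> (0 : R)] --> (0 : V) -> t 0 = 0 -> S 0 = 0 -> is_derive (0 : R) 1 t tau ->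
  is_derive (0 : R) 1 (fun h => g (y0 + S h + t h *: e) - g (y0 + S h))
    (tau * 'D_e g y0).
Proof.
move=> oO Oy dg cD S0 t0 SS0 dt; set D : R := 'D_e g y0.
pose B h := g (y0 + S h + t h *: e) - g (y0 + S h).
(* Mean slope of [g] over the increment, continued by the limit value where [t h] vanishes. The
   difference quotient then factors as that of [t] times [del] for every [h]. *)
pose del h := if t h == 0 then D else B h / t h.
apply/is_derive0P.
have -> : (fun h => h^-1 * (B h - B 0)) = (fun h => (h^-1 * (t h - t 0)) * del h).
  apply/funext => h; rewrite /B /del t0 SS0 !scale0r !addr0 !subrr !subr0.
  have [->|th] := eqVneq (t h) 0; first by rewrite scale0r addr0 subrr !mulr0 mul0r.
  by rewrite -mulrA [t h * _]mulrC divfK.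
apply: cvgM; first exact/is_derive0P.
have ct : t h @[h --> (0 : R)] --> (0 : R).
  by have := is_derive_continuous dt; rewrite /prop_for /continuous_at t0.
apply/cvgrPdist_le => /= eps eps0.
have [r /= r0 Hr] : exists2 r : R, 0 < r & forall y, ball y0 r y ->
    derivable g y e /\ `|'D_e g y - D| <= eps.
  have : \forall y \near y0, derivable g y e /\ `|'D_e g y - D| <= eps.
    near=> y; split; first by apply: dg; near: y; apply: open_nbhs_nbhs.
    rewrite distrC; near: y.
    by move/cvgrPdist_le: cD; exact.
  by move=> /nbhs_ballP [r r0 Hr]; exists r.
have cte : t h *: e @[h --> (0 : R)] --> (0 : V).
  rewrite -(scale0r e); exact: cvgZr_tmp.
near=> h.
have Sr : `|S h| < r / 2.
  by near: h; apply: nbhs_dnbhs; apply: (cvgr0_norm_lt _ S0); rewrite divr_gt0.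
have tr : `|t h *: e| < r / 2.
  by near: h; apply: nbhs_dnbhs; apply: (cvgr0_norm_lt _ cte); rewrite divr_gt0.
rewrite /del; case: eqVneq => [_|th]; first by rewrite subrr normr0 ltW.
have := @segment_increment g (ball y0 r) e (y0 + S h) (t h) D eps.
move=> /(_ _ Hr) K.
have {}K := K _; rewrite distrC.
have aux (a b d : R) : b != 0 -> a / b - d = (a - b * d) / b by move=> b0; field.
rewrite aux//.
rewrite normrM normfV ler_pdivrMr ?normr_gt0//; apply: K => s /andP[s0 s1].
rewrite -ball_normE /ball_ /= opprD addrA opprD addrA subrr sub0r -opprD normrN.
apply: le_lt_trans (ler_normD _ _) _; rewrite (splitr r) ltrD//.
rewrite -scalerA normrZ (ger0_norm s0); apply: le_lt_trans tr.
by rewrite ler_piMl.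
Unshelve. all: by end_near. Qed.

(** The coordinates are added one at a time; those already added form the moving base point of
    [increment_derive]. *)
Lemma chain_sum (I : Type) (r : seq I) (g : V -> R) (O : set V) (y0 : V)
    (e : I -> V) (t : I -> R -> R) (tau : I -> R) :
  open O -> O y0 -> (forall i y, O y -> derivable g y (e i)) ->
  (forall i, {for y0, continuous (fun y => 'D_(e i) g y)}) ->
  (forall i, t i 0 = 0) -> (forall i, is_derive (0 : R) 1 (t i) (tau i)) ->
  is_derive (0 : R) 1 (fun h => g (y0 + \sum_(i <- r) t i h *: e i))
    (\sum_(i <- r) tau i * 'D_(e i) g y0).
Proof.
move=> oO Oy dg cD t0 dt; elim: r => [|i r IH].
  rewrite big_nil.
  under [X in is_derive _ _ X _]funext do rewrite big_nil addr0.
  exact: is_derive_cst.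
rewrite big_cons.
have -> : (fun h => g (y0 + \sum_(i <- i :: r) t i h *: e i)) =
  (fun h => g (y0 + \sum_(i <- r) t i h *: e i + t i h *: e i)
     - g (y0 + \sum_(i <- r) t i h *: e i)) +
  (fun h => g (y0 + \sum_(i <- r) t i h *: e i)).
  apply/funext => h; rewrite fctE/= subrK big_cons; congr (g _).
  by rewrite -addrA; congr (_ + _); rewrite addrC.
apply: is_deriveD => //.
apply: (increment_derive (S := fun h => \sum_(j <- r) t j h *: e j) oO Oy) => //.
- by move=> y; apply: dg.
- elim: r {IH} => [|j r IHr].
    by under eq_fun do rewrite big_nil; apply: cvg_cst.
  under eq_fun do rewrite big_cons.
  have H : t j h *: e j @[h --> (0 : R)] --> (0 : V).
    rewrite -(scale0r (e j)); apply: cvgZr_tmp.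
    by have := is_derive_continuous (dt j); rewrite /prop_for /continuous_at t0.
  have K := cvgD H IHr; rewrite addr0 in K.
  exact: K.
- by rewrite big1// => j _; rewrite t0 scale0r.
Qed.

End ChainRule.

(** * Functions of class C^k and their algebra *)

Section Ck.
Variables (R : realType) (V : normedModType R).

Lemma C_k_continuous (W : normedModType R) k (O : set V) (f : V -> W) x :
  C_k k O f -> O x -> {for x, continuous f}.
Proof. by case: k => [|k] [c _]; apply: c. Qed.

Lemma C_k_ext (W : normedModType R) k (O : set V) (f g : V -> W) :
  open O -> (forall x, O x -> f x = g x) -> C_k k O f -> C_k k O g.
Proof.
move=> oO; elim: k f g => [|k IH] f g fg [cf df].
  by split=> // x Ox; apply: continuous_at_ext oO Ox fg (cf x Ox).
split=> [x Ox|v]; first exact: continuous_at_ext oO Ox fg (cf x Ox).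
have [d D] := df v.
have H x : O x -> is_derive x v g ('D_v f x).
  by move=> Ox; apply: (is_derive_ext oO Ox fg); apply: derivableP; apply: d.
split=> [x /H []//|]; apply: IH D => x /H E.
by rewrite derive_val.
Qed.

Lemma C_kS_intro (W : normedModType R) k (O : set V) (f : V -> W) :
  open O -> (forall x, O x -> {for x, continuous f}) ->
  (forall v, exists2 f', (forall x, O x -> is_derive x v f (f' x)) & C_k k O f') ->
  C_k k.+1 O f.
Proof.
move=> oO cf H; split=> // v; have [f' d D] := H v; split=> [x /d []//|].
apply: (C_k_ext oO _ D) => x Ox.
by have E := d _ Ox; rewrite derive_val.
Qed.

Lemma C_k_sub (W : normedModType R) k (O N : set V) (f : V -> W) :
  N `<=` O -> C_k k O f -> C_k k N f.
Proof.
move=> sO; elim: k f => [|k IH] f [cf df]; first by split=> // x /sO /cf.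
split=> [x /sO /cf//|v]; have [d D] := df v; split=> [x /sO /d//|].
exact: IH.
Qed.

Lemma C_k_local (W : normedModType R) k (O : set V) (f : V -> W) :
  (forall x, O x -> exists2 N, N x & C_k k N f) -> C_k k O f.
Proof.
elim: k f => [|k IH] f H.
  by split=> // x /H [N Ox [c _]]; apply: c.
split=> [x /H [N Ox [c _]]|v]; first exact: c.
split=> [x /H [N Ox [_ /(_ v) [d _]]]|]; first exact: d.
by apply: IH => x /H [N Ox [_ /(_ v) [_ D]]]; exists N.
Qed.

Lemma C_kS (W : normedModType R) k (O : set V) (f : V -> W) :
  C_k k.+1 O f -> C_k k O f.
Proof.
elim: k f => [|k IH] f [cf df]; first by split.
by split=> // v; have [d D] := df v; split=> //; apply: IH.
Qed.

Lemma C_k_cst (W : normedModType R) k (O : set V) (c : W) : C_k k O (fun=> c).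
Proof.
elim: k c => [|k IH] c; first by split=> // x _; apply: cst_continuous.
split=> [x _|v]; first exact: cst_continuous.
split=> [x _|]; first exact: derivable_cst.
have -> : (fun x : V => 'D_v (fun=> c) x) = fun=> 0.
  by apply/funext => x; apply: derive_cst.
exact: IH.
Qed.

Lemma C_k_linear (W : normedModType R) k (O : set V) (f : {linear V -> W}) :
  open O -> continuous f -> C_k k O f.
Proof.
move=> oO cf; case: k => [|k]; first by split=> // x _; apply: cf.
apply: C_kS_intro => // [x _|v]; first exact: cf.
exists (fun=> f v) => [x _|]; last exact: C_k_cst.
have d : differentiable f x by apply: linear_differentiable; apply: cf.
by apply: DeriveDef; [apply: diff_derivable|rewrite deriveE// diff_lin//; apply: cf].
Qed.

Lemma C_k_id k (O : set V) : open O -> C_k k O (fun x => x).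
Proof.
move=> oO; apply: (@C_k_linear _ _ _ (@idfun V)) => //.
by move=> x; apply: cvg_id.
Qed.

Lemma C_kD (W : normedModType R) k (O : set V) (f g : V -> W) :
  open O -> C_k k O f -> C_k k O g -> C_k k O (fun x => f x + g x).
Proof.
move=> oO; elim: k f g => [|k IH] f g [cf df] [cg dg].
  by split=> // x Ox; apply: cvgD; [apply: cf|apply: cg].
apply: C_kS_intro => // [x Ox|v]; first by apply: cvgD; [apply: cf|apply: cg].
have [d D] := df v; have [d' D'] := dg v.
exists (fun x => 'D_v f x + 'D_v g x) => [x Ox|]; last exact: IH.
by apply: is_deriveD; apply: derivableP; [apply: d|apply: d'].
Qed.

Lemma C_kZ (W : normedModType R) k (O : set V) (f : V -> W) (c : R) :
  open O -> C_k k O f -> C_k k O (fun x => c *: f x).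
Proof.
move=> oO; elim: k f => [|k IH] f [cf df].
  by split=> // x Ox; apply: cvgZr; apply: cf.
apply: C_kS_intro => // [x Ox|v]; first by apply: cvgZr; apply: cf.
have [d D] := df v; exists (fun x => c *: 'D_v f x) => [x Ox|]; last exact: IH.
by apply: is_deriveZ; apply: derivableP; apply: d.
Qed.

Lemma C_kN (W : normedModType R) k (O : set V) (f : V -> W) :
  open O -> C_k k O f -> C_k k O (fun x => - f x).
Proof.
move=> oO /(C_kZ (-1) oO); apply: C_k_ext => // x _.
by rewrite scaleN1r.
Qed.

Lemma C_kB (W : normedModType R) k (O : set V) (f g : V -> W) :
  open O -> C_k k O f -> C_k k O g -> C_k k O (fun x => f x - g x).
Proof. by move=> oO Cf Cg; apply: C_kD => //; apply: C_kN. Qed.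

Lemma C_k_sum (W : normedModType R) (I : Type) (r : seq I) k (O : set V)
    (f : I -> V -> W) :
  open O -> (forall i, C_k k O (f i)) -> C_k k O (fun x => \sum_(i <- r) f i x).
Proof.
move=> oO Cf; elim: r => [|i r IH].
  by apply: C_k_ext (C_k_cst k O 0) => // x _; rewrite big_nil.
apply: C_k_ext (C_kD oO (Cf i) IH) => // x _.
by rewrite big_cons.
Qed.

Lemma C_kM k (O : set V) (f g : V -> R) :
  open O -> C_k k O f -> C_k k O g -> C_k k O (fun x => f x * g x).
Proof.
move=> oO; elim: k f g => [|k IH] f g Cf Cg.
  by split=> // x Ox; apply: cvgM; apply: C_k_continuous; eassumption.
have [cf df] := Cf; have [cg dg] := Cg.
apply: C_kS_intro => // [x Ox|v]; first by apply: cvgM; [apply: cf|apply: cg].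
have [d D] := df v; have [d' D'] := dg v.
exists (fun x => f x * 'D_v g x + g x * 'D_v f x) => [x Ox|].
  by apply: is_deriveM; apply: derivableP; [apply: d|apply: d'].
by apply: C_kD => //; apply: IH => //; apply: C_kS.
Qed.

Lemma continuous_rowP n (f : V -> 'rV[R]_n) x :
  {for x, continuous f} <-> forall j, {for x, continuous (fun y => f y 0 j)}.
Proof.
split=> [cf j|cf].
  by apply: (@continuous_comp _ _ _ f (fun m : 'rV[R]_n => m 0 j) x cf); apply: matrix_normedtype.coord_continuous.
apply/cvgrPdist_lt => /= e e0; near=> y.
rewrite /Num.Def.normr/= mx_normrE (bigmax_lt _ e0)//= => -[i j] _ /=.
rewrite !mxE (ord1 i).
move: (j); near: y; apply: filter_forall => j' /=.
by have /cvgrPdist_lt := cf j'; exact.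
Unshelve. all: by end_near. Qed.

Lemma is_derive_rowP n (f : V -> 'rV[R]_n) x v (l : 'rV[R]_n) :
  is_derive x v f l <-> forall j, is_derive x v (fun y => f y 0 j) (l 0 j).
Proof.
split=> [[d <-] j|H].
  by split; [move/derivable_mxP: d; apply|rewrite derive_mx// mxE].
have d : derivable f x v.
  by apply/derivable_mxP => i j; rewrite (ord1 i); have [] := H j.
split=> //; rewrite derive_mx//; apply/rowP => j; rewrite mxE.
by have [_ <-] := H j.
Qed.

Lemma C_k_rowP n k (O : set V) (f : V -> 'rV[R]_n) :
  open O -> C_k k O f <-> forall j, C_k k O (fun x => f x 0 j).
Proof.
move=> oO; elim: k f => [|k IH] f.
  split=> [[cf _] j|H]; split=> // x Ox; first by apply: (continuous_rowP f x).1; apply: cf.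
  by apply: (continuous_rowP f x).2 => j; have [c _] := H j; apply: c.
split=> [[cf df] j|H].
  apply: C_kS_intro => // [x Ox|v]; first by apply: (continuous_rowP f x).1; apply: cf.
  have [d D] := df v; exists (fun x => 'D_v f x 0 j) => [x Ox|]; last exact: (IH _).1.
  by apply: (is_derive_rowP _ _ _ _).1; apply: derivableP; apply: d.
apply: C_kS_intro => // [x Ox|v].
  by apply: (continuous_rowP f x).2 => j; have [c _] := H j; apply: c.
exists (fun x => \row_j 'D_v (fun y => f y 0 j) x) => [x Ox|].
  apply: (is_derive_rowP _ _ _ _).2 => j; rewrite mxE; apply: derivableP.
  by have [_ /(_ v) [d _]] := H j; apply: d.
apply: (IH _).2 => j; have [_ /(_ v) [_ D]] := H j.
by apply: C_k_ext D => // x _; rewrite mxE.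
Qed.

End Ck.

(** * Chain rule in coordinates and composition of smooth functions *)

Section Composition.
Variable R : realType.

(** A common interface for the line, row vectors and products of these, so that the chain rule is
    proved once for all source spaces in use. *)
Definition coordinate_system (V : normedModType R) (I : finType) (e : I -> V)
    (c : I -> V -> R) : Prop :=
  forall v, v = \sum_i c i v *: e i.

Lemma coordinates_line : coordinate_system (V := R) (fun=> 1 : R) (fun _ : 'I_1 => id).
Proof. by move=> v; rewrite big_ord1 [_ *: _]mulr1. Qed.

Lemma coordinates_row n :
  @coordinate_system 'rV[R]_n 'I_n (fun i => delta_mx 0 i) (fun i v => v 0 i).
Proof. by move=> v; apply: row_sum_delta. Qed.

Lemma coordinates_prod (V V' : normedModType R) (I I' : finType) e e' c c' :
  @coordinate_system V I e c -> @coordinate_system V' I' e' c' ->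
  @coordinate_system (V * V')%type (I + I')%type
    (fun s => match s with inl i => (e i, 0) | inr i => (0, e' i) end)
    (fun s v => match s with inl i => c i v.1 | inr i => c' i v.2 end).
Proof.
move=> H H' v; rewrite big_sumType/=.
have fstS (J : finType) (F : J -> V * V') : (\sum_i F i).1 = \sum_i (F i).1.
  by apply: (big_morph fst).
have sndS (J : finType) (F : J -> V * V') : (\sum_i F i).2 = \sum_i (F i).2.
  by apply: (big_morph snd).
apply: injective_projections; rewrite /= ?fstS ?sndS /=.
  by rewrite [X in _ + X]big1 => [|i _]; rewrite ?scaler0// addr0 -H.
by rewrite big1 => [|i _]; rewrite ?scaler0// add0r -H'.
Qed.

Variables (V V' : normedModType R) (I : finType) (e : I -> V') (c : I -> V' -> R).
Hypothesis ce : coordinate_system e c.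

(** On the line [x + r *: v], the point [f] is [f x] plus the increments of its coordinates, which
    is the form required by [chain_sum]. *)
Lemma is_derive_comp_coord (g : V' -> R) (f : V -> V') (N : set V') x v
    (tau : I -> R) :
  open N -> N (f x) -> C_k 1 N g ->
  (forall i, is_derive x v (fun y => c i (f y)) (tau i)) ->
  is_derive x v (fun y => g (f y)) (\sum_i tau i * 'D_(e i) g (f x)).
Proof.
move=> oN Nx [_ dg] df; apply: (is_derive_line0 _ _ _ _).2.
have -> : (fun r : R => g (f (x + r *: v))) = fun r : R =>
    g (f x + \sum_i (c i (f (x + r *: v)) - c i (f x)) *: e i).
  apply/funext => r; congr g.
  under eq_bigr do rewrite scalerBl.
  by rewrite sumrB -(ce (f (x + r *: v))) -(ce (f x)) [RHS]addrC subrK.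
apply: (@chain_sum _ _ _ _ g N (f x) e
  (fun i r => c i (f (x + r *: v)) - c i (f x)) tau oN Nx) => [i y Ny|i|i|i].
- by have [d _] := dg (e i); apply: d.
- by have [_ [d _]] := dg (e i); apply: d.
- by rewrite scale0r addr0 subrr.
- rewrite -[tau i]subr0; apply: is_deriveB.
  by apply: (is_derive_line0 (fun y => c i (f y)) _ _ _).1.
Qed.

(** Induction on [k]: the chain rule writes the derivative with the functions ['D_(e i) g] composed
    with [f], and these lose exactly one order. Continuity of [f] itself comes from writing it as
    the finite sum of its coordinates. *)
Lemma C_k_comp_coord k (O : set V) (N : set V') (g : V' -> R) (f : V -> V') :
  open O -> open N -> (forall x, O x -> N (f x)) ->
  (forall i, C_k k O (fun x => c i (f x))) -> C_k k N g ->
  C_k k O (fun x => g (f x)).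
Proof.
move=> oO oN ON; have cont (h : V' -> R) : (forall i, C_k 0 O (fun x => c i (f x))) ->
    C_k 0 N h -> forall x, O x -> {for x, continuous (fun x => h (f x))}.
  move=> cf [cg _] x Ox.
  have Cf : C_k 0 O f.
    apply: (C_k_ext (f := fun x => \sum_i c i (f x) *: e i)) => //.
    apply: C_k_sum => //.
    move=> i; split=> // y Oy; apply: cvgZr_tmp.
    by have [d _] := cf i; apply: d.
  by apply: continuous_comp; [apply: C_k_continuous Cf Ox|apply: cg; apply: ON].
have C0 n (W W' : normedModType R) (A : set W) (h : W -> W') : C_k n A h -> C_k 0 A h.
  by move=> Ch; split=> // x Ax; apply: C_k_continuous Ch Ax.
elim: k g => [|k IH] g Cf Cg; first by split=> //; apply: cont.
apply: C_kS_intro => // [|v].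
  by apply: cont; [move=> i; apply: C0 (Cf i)|apply: C0 Cg].
exists (fun x => \sum_i 'D_v (fun y => c i (f y)) x * 'D_(e i) g (f x)) => [x Ox|].
  apply: (is_derive_comp_coord (N := N)) => //; first exact: ON.
    by elim: k Cg {IH Cf} => // k IH Cg; apply: IH; apply: C_kS.
  by move=> i; apply: derivableP; have [_ /(_ v) [d _]] := Cf i; apply: d.
apply: C_k_sum => // i; apply: C_kM => //; first by have [_ /(_ v) [_ d]] := Cf i.
apply: (IH (fun y => 'D_(e i) g y)) => [j|]; first exact: C_kS.
by have [_ /(_ (e i)) [_ d]] := Cg.
Qed.

End Composition.

Section Smooth.
Variables (R : realType) (V : normedModType R).
Implicit Types O : set V.

Lemma smooth_ext (W : normedModType R) O (f g : V -> W) :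
  open O -> (forall x, O x -> f x = g x) -> smooth O f -> smooth O g.
Proof. by move=> oO fg Sf k; apply: C_k_ext (Sf k). Qed.

Lemma smooth_sub (W : normedModType R) O O1 (f : V -> W) :
  O1 `<=` O -> smooth O f -> smooth O1 f.
Proof. by move=> sO Sf k; apply: C_k_sub (Sf k). Qed.

Lemma smooth_local (W : normedModType R) O (f : V -> W) :
  (forall x, O x -> exists2 N, N x & smooth N f) -> smooth O f.
Proof. by move=> H k; apply: C_k_local => x /H [N Nx Sf]; exists N. Qed.

Lemma smooth_continuous (W : normedModType R) O (f : V -> W) x :
  smooth O f -> O x -> {for x, continuous f}.
Proof. by move=> /(_ 0%N) Cf; apply: C_k_continuous Cf. Qed.

Lemma smooth_is_derive (W : normedModType R) O (f : V -> W) x v :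
  smooth O f -> O x -> is_derive x v f ('D_v f x).
Proof.
by move=> /(_ 1%N) [_ /(_ v) [d _]] Ox; apply: derivableP; apply: d.
Qed.

Lemma smooth_derive (W : normedModType R) O (f : V -> W) v :
  smooth O f -> smooth O (fun x => 'D_v f x).
Proof. by move=> Sf k; have [_ /(_ v) [_]] := Sf k.+1. Qed.

Lemma smooth_cst (W : normedModType R) O (a : W) : smooth O (fun=> a).
Proof. by move=> k; apply: C_k_cst. Qed.

Lemma smooth_linear (W : normedModType R) O (f : {linear V -> W}) :
  open O -> continuous f -> smooth O f.
Proof. by move=> oO cf k; apply: C_k_linear. Qed.

Lemma smooth_id O : open O -> smooth O (fun x => x).
Proof. by move=> oO k; apply: C_k_id. Qed.

Lemma smoothD (W : normedModType R) O (f g : V -> W) :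
  open O -> smooth O f -> smooth O g -> smooth O (fun x => f x + g x).
Proof. by move=> oO Sf Sg k; apply: C_kD. Qed.

Lemma smoothB (W : normedModType R) O (f g : V -> W) :
  open O -> smooth O f -> smooth O g -> smooth O (fun x => f x - g x).
Proof. by move=> oO Sf Sg k; apply: C_kB. Qed.

Lemma smooth_sum (W : normedModType R) (I : Type) (r : seq I) O (f : I -> V -> W) :
  open O -> (forall i, smooth O (f i)) -> smooth O (fun x => \sum_(i <- r) f i x).
Proof. by move=> oO Sf k; apply: C_k_sum => // i; apply: Sf. Qed.

Lemma smoothM O (f g : V -> R) :
  open O -> smooth O f -> smooth O g -> smooth O (fun x => f x * g x).
Proof. by move=> oO Sf Sg k; apply: C_kM. Qed.

Lemma smooth_row n O (f : V -> 'rV[R]_n) :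
  open O -> (forall j, smooth O (fun x => f x 0 j)) -> smooth O f.
Proof. by move=> oO Sf k; apply: (C_k_rowP k f oO).2 => j; apply: Sf. Qed.

Lemma smooth_coord n O (f : V -> 'rV[R]_n) j :
  open O -> smooth O f -> smooth O (fun x => f x 0 j).
Proof. by move=> oO Sf k; apply: (C_k_rowP k f oO).1. Qed.

Lemma smooth_comp_coord (V' : normedModType R) (I : finType) (e : I -> V')
    (c : I -> V' -> R) O (N : set V') (g : V' -> R) (f : V -> V') :
  coordinate_system e c -> open O -> open N -> (forall x, O x -> N (f x)) ->
  (forall i, smooth O (fun x => c i (f x))) -> smooth N g ->
  smooth O (fun x => g (f x)).
Proof.
move=> ce oO oN ON Sf Sg k; apply: (C_k_comp_coord ce oO oN ON _ (Sg k)) => i.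
exact: Sf.
Qed.

Lemma smooth_comp O (N : set R) (g : R -> R) (f : V -> R) :
  open O -> open N -> (forall x, O x -> N (f x)) ->
  smooth O f -> smooth N g -> smooth O (fun x => g (f x)).
Proof.
move=> oO oN ON Sf Sg.
by apply: (smooth_comp_coord (@coordinates_line R) oO oN).
Qed.

Lemma smooth_comp_row n O (N : set 'rV[R]_n) (g : 'rV[R]_n -> R) (f : V -> 'rV[R]_n) :
  open O -> open N -> (forall x, O x -> N (f x)) ->
  smooth O f -> smooth N g -> smooth O (fun x => g (f x)).
Proof.
move=> oO oN ON Sf Sg.
apply: (smooth_comp_coord (@coordinates_row R n) oO oN ON _ Sg) => i.
exact: smooth_coord.
Qed.

End Smooth.

(** * Smooth functions of one variable and the smooth step *)

Section OneVariable.
Variable R : realType.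

Lemma is_derive_dir (f : R -> R) (x l v : R) :
  is_derive x 1 f l -> is_derive x v f (v * l).
Proof.
move=> d; apply: (is_derive_line0 _ _ _ _).2.
have d' : is_derive (x + 0 * v) 1 f l by rewrite mul0r addr0.
rewrite [v * l]mulrC.
apply: (is_derive1_comp (g := fun r => x + r * v) d').
have -> : (fun r : R => x + r * v) = cst x + v \*: id.
  by apply/funext => r; rewrite [r * v]mulrC.
by apply: is_derive_eq; rewrite add0r [_ *: _]mulr1.
Qed.

Lemma C_kS_line k (O : set R) (f f' : R -> R) :
  open O -> (forall x, O x -> is_derive x 1 f (f' x)) -> C_k k O f' -> C_k k.+1 O f.
Proof.
move=> oO df Cf'; apply: C_kS_intro => // [x /df|v].
  exact: is_derive_continuous.
exists (fun x => v * f' x) => [x /df|]; first exact: is_derive_dir.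
by apply: C_kM => //; apply: C_k_cst.
Qed.

Lemma smooth_inv : smooth [set x : R | x != 0] (fun x => x^-1).
Proof.
have oN : open [set x : R | x != 0] by exact: open_neq.
have d (x : R) : x != 0 -> is_derive x 1 (fun x : R => x^-1) (- (x^-1 * x^-1)).
  move=> x0; have := @is_deriveV R id x 1 1 x0 (is_derive_id x 1).
  by rewrite /= [_ *: _]mulr1 expr2 invfM.
elim=> [|k IH]; first by split=> // x /d /is_derive_continuous.
by apply: (C_kS_line oN d); apply: C_kN => //; apply: C_kM.
Qed.

Lemma C_k_trig k : C_k k setT (@sin R) /\ C_k k setT (@cos R).
Proof.
elim: k => [|k [IHs IHc]].
  by split; split=> // x _; [apply: continuous_sin|apply: continuous_cos].
split; first by apply: (C_kS_line openT (fun x _ => is_derive_sin x)).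
apply: (C_kS_line openT (fun x _ => is_derive_cos x)).
by apply: C_kN => //; apply: openT.
Qed.

Lemma smooth_sin : smooth setT (@sin R).
Proof. by move=> k; have [] := C_k_trig k. Qed.

Lemma smooth_cos : smooth setT (@cos R).
Proof. by move=> k; have [] := C_k_trig k. Qed.

(* The family is closed under differentiation up to linear combinations, which
   is why the power of 1/x is part of the definition. *)
Definition flat (m : nat) (x : R) : R :=
  if 0 < x then (x^-1) ^+ m * expR (- x^-1) else 0.

(** With [y = x^-1], the inequality [1 + u <= expR u] at [u = y / (m + 1)], raised to the power
    [m + 1], bounds [y ^+ m.+1] by a constant times [expR y]. One factor [y] is left over and gives
    the factor [x]. *)
Lemma flat_bound m x : `|flat m x| <= m.+1%:R ^+ m.+1 * `|x|.
Proof.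
rewrite /flat; case: ltP => x0; last by rewrite normr0 mulr_ge0// exprn_ge0.
have y0 : 0 < x^-1 by rewrite invr_gt0.
rewrite ger0_norm; last by rewrite mulr_ge0 ?exprn_ge0 ?expR_ge0 ?ltW.
rewrite (gtr0_norm x0) expRN ler_pdivrMr ?expR_gt0//.
have : (x^-1 / m.+1%:R) ^+ m.+1 <= expR (x^-1).
  rewrite {2}(_ : x^-1 = m.+1%:R * (x^-1 / m.+1%:R)); last first.
    by rewrite mulrC divfK.
  rewrite expRM_natl; apply: lerXn2r; rewrite ?nnegrE ?expR_ge0//.
    by rewrite divr_ge0// ltW.
  by apply: le_trans (expR_ge1Dx _); rewrite lerDr.
rewrite expr_div_n ler_pdivrMr ?exprn_gt0 ?ltr0n// exprS => H.
rewrite -mulrA -(ler_pM2l y0); apply: le_trans H _.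
by move: (_ ^+ _) (expR _) => K E; rewrite [K * _]mulrC -mulrA mulKf// gt_eqF.
Qed.

Lemma flat_continuous0 m : flat m x @[x --> (0 : R)] --> (0 : R).
Proof.
have H : m.+1%:R ^+ m.+1 * `|x| @[x --> (0 : R)] --> (0 : R).
  rewrite [X in _ --> X](_ : 0 = m.+1%:R ^+ m.+1 * `|(0 : R)|); last first.
    by rewrite normr0 mulr0.
  by apply: cvgM; [apply: cvg_cst|apply: norm_continuous].
have H' : - (m.+1%:R ^+ m.+1 * `|x|) @[x --> (0 : R)] --> (0 : R).
  by rewrite -[X in _ --> X]oppr0; apply: cvgN.
apply: (squeeze_cvgr _ H' H).
by near=> x; rewrite -ler_norml flat_bound.
Unshelve. all: by end_near. Qed.

(** A computation away from 0. At 0 the difference quotient of [flat m] is exactly [flat m.+1],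
    which tends to 0. *)
Lemma is_derive_flat m (x : R) : is_derive x 1 (flat m) (flat m.+2 x - m%:R * flat m.+1 x).
Proof.
have [x0|x0|->] := ltgtP x 0.
- have oN : open [set y : R | y < 0] by exact: open_lt.
  apply: (@is_derive_ext _ _ _ _ (fun=> 0) _ _ _ _ oN x0).
    by move=> y y0; rewrite /flat lt_gtF.
  rewrite /flat lt_gtF// mulr0 subr0; exact: is_derive_cst.
- have oN : open [set y : R | 0 < y] by exact: open_gt.
  apply: (@is_derive_ext _ _ _ _ ((fun y => y^-1 ^+ m) * (fun y => expR (- y^-1))) _ _ _ _ oN x0).
    by move=> y y0; rewrite /flat y0.
  have xn0 : x != 0 by rewrite gt_eqF.
  have dV : is_derive x 1 (fun x : R => x^-1) (- (x^-1 * x^-1)).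
    have := @is_deriveV R id x 1 1 xn0 (is_derive_id x 1).
    by rewrite /= [_ *: _]mulr1 expr2 invfM.
  have dE : is_derive x 1 (fun y => expR (- y^-1)) (expR (- x^-1) * (x^-1 * x^-1)).
    apply: (is_derive1_comp (g := fun y => - y^-1) (is_derive_expR _)).
    by rewrite -[x^-1 * x^-1]opprK; apply: is_deriveN.
  have dX : is_derive x 1 (fun y => y^-1 ^+ m) (- m%:R * x^-1 ^+ m.+1).
    have -> : (fun y : R => y^-1 ^+ m) = (fun y : R => y^-1) ^+ m.
      by apply/funext => y; rewrite fctE.
    apply: is_derive_eq; rewrite -[_ *: _]/(_ * _) /=.
    case: (m) => [|k]; first by rewrite !mul0r oppr0 mul0r.
    by rewrite /= !exprS; move: (x^-1) (k.+1%:R) => a b; ring.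
  apply: is_derive_eq.
  rewrite -[_ *: _]/(_ * _) -[X in _ + X]/(_ * _) /flat x0 !exprS.
  by move: (x^-1) (expR _) => a b; ring.
- have f0 j : flat j 0 = 0 by rewrite /flat ltxx.
  rewrite !f0 mulr0 subr0; apply/is_derive0P; rewrite f0.
  have -> : (fun h : R => h^-1 * (flat m h - 0)) = flat m.+1.
    apply/funext => h; rewrite /flat subr0; case: ltP => h0; last by rewrite mulr0.
    by rewrite exprS mulrA.
  by apply: cvg_trans (@flat_continuous0 m.+1); apply: cvg_app; apply: cvg_within.
Qed.

Lemma smooth_flat m : smooth setT (flat m).
Proof.
move=> k; elim: k m => [|k IH] m.
  by split=> // x _; apply: is_derive_continuous; apply: is_derive_flat.
apply: (C_kS_line openT (fun x _ => is_derive_flat m x)).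
by apply: C_kB; [apply: openT|apply: IH|apply: C_kM; [apply: openT|apply: C_k_cst|apply: IH]].
Qed.

(** Goes from 0 to 1 and is constant below 1/3 and above 2/3. These margins inside [[0, 1]] make a
    segment reparametrised by it sit at both ends, so that consecutive ones can be joined
    smoothly. *)
Definition step (x : R) : R :=
  flat 0 (x - 3^-1) / (flat 0 (x - 3^-1) + flat 0 (2 / 3 - x)).

Lemma flat_ge0 x : 0 <= flat 0 x.
Proof. by rewrite /flat; case: ltP => // _; rewrite mul1r expR_ge0. Qed.

Lemma flat_gt0 x : 0 < x -> 0 < flat 0 x.
Proof. by rewrite /flat => ->; rewrite mul1r expR_gt0. Qed.

Lemma step_denominator x : 0 < flat 0 (x - 3^-1) + flat 0 (2 / 3 - x).
Proof.
have [xs|xs] := ltP 3^-1 x.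
  by rewrite ltr_wpDr ?flat_ge0// flat_gt0// subr_gt0.
by rewrite ltr_wpDl ?flat_ge0// flat_gt0// subr_gt0; lra.
Qed.

Lemma step0 x : x <= 3^-1 -> step x = 0.
Proof. by move=> xs; rewrite /step {1}/flat ltNge subr_le0 xs mul0r. Qed.

Lemma step1 x : 2 / 3 <= x -> step x = 1.
Proof.
move=> xs; rewrite /step {3}/flat ltNge subr_le0 xs/= addr0 divff// gt_eqF//.
by apply: flat_gt0; rewrite subr_gt0; lra.
Qed.

Lemma step_ge0 x : 0 <= step x.
Proof. by rewrite divr_ge0 ?flat_ge0// ltW ?step_denominator. Qed.

Lemma step_le1 x : step x <= 1.
Proof. by rewrite ler_pdivrMr ?step_denominator// mul1r lerDl flat_ge0. Qed.

Lemma smooth_step : smooth setT step.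
Proof.
have S1 : smooth setT (fun x : R => flat 0 (x - 3^-1)).
  apply: (smooth_comp (N := setT)) => //; [exact: openT|exact: openT| |exact: smooth_flat].
  by apply: smoothB; [exact: openT|apply: smooth_id; exact: openT|exact: smooth_cst].
have S2 : smooth setT (fun x : R => flat 0 (2 / 3 - x)).
  apply: (smooth_comp (N := setT)) => //; [exact: openT|exact: openT| |exact: smooth_flat].
  by apply: smoothB; [exact: openT|exact: smooth_cst|apply: smooth_id; exact: openT].
apply: smoothM => //; first exact: openT.
apply: (smooth_comp (N := [set x : R | x != 0])) _ smooth_inv => //; first exact: openT.
- by move=> x _ /=; rewrite gt_eqF// step_denominator.
- by apply: smoothD => //; exact: openT.
Qed.

End OneVariable.

(** * Primitives and parameter integrals *)

Section IntervalInduction.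
Variable R : realType.

(** Compactness of [[a, b]] as an induction principle: a property of subintervals that can be glued
    and that holds for all small intervals around each point holds for [[a, b]]. It replaces
    subdivisions and Lebesgue numbers. Degenerate intervals are included, which starts the argument
    at [a]. *)
Lemma interval_induction (P : R -> R -> Prop) (a b : R) : a <= b ->
  (forall x y z, a <= x -> x <= y -> y <= z -> z <= b -> P x y -> P y z -> P x z) ->
  (forall x : R, a <= x <= b -> exists2 d : R, 0 < d & forall y z, a <= y -> y <= z -> z <= b ->
      `|y - x| < d -> `|z - x| < d -> P y z) ->
  P a b.
Proof.
move=> ab glue loc; pose S := [set z | a <= z <= b /\ P a z].
have Sa : S a.
  split; first by rewrite lexx ab.
  have [|d d0 H] := loc a; first by rewrite lexx ab.
  by apply: H; rewrite ?lexx// subrr normr0.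
have ubS : has_ubound S by exists b => z [/andP[]].
have supS : has_sup S by split=> //; exists a.
set s := sup S.
have as_ : a <= s by apply: ub_le_sup.
have sb : s <= b by apply: ge_sup => [|z [/andP[]]]; first by exists a.
have [|d d0 H] := loc s; first by rewrite as_ sb.
have [z [/andP[az zb] Paz] zs] := sup_adherent d0 supS; rewrite -/s in zs.
have zles : z <= s by apply: ub_le_sup => //; split=> //; rewrite az zb.
have nz : `|z - s| < d by rewrite distrC ger0_norm ?subr_ge0//; lra.
(* Unless [s] is already [b], this point lies beyond the supremum [s], and gluing would put it in
   [S]. *)
pose t := Num.min b (s + d / 2).
have st : s <= t by rewrite le_min sb/=; lra.
have tb : t <= b by rewrite ge_min lexx.
have nt : `|t - s| < d.
  rewrite ger0_norm ?subr_ge0//.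
  have : t <= s + d / 2 by rewrite ge_min lexx orbT.
  by lra.
have Pat : P a t.
  by apply: (glue a z t) => //; [apply: le_trans st|apply: H => //; apply: le_trans st].
have St : S t by split=> //; rewrite tb andbT; apply: le_trans st.
have ts : t <= s by apply: ub_le_sup.
suff <- : t = b by [].
move: ts; rewrite ge_min; case/orP => [bs|]; last by lra.
by apply/eqP; rewrite eq_le tb/=; apply: le_trans st.
Qed.

End IntervalInduction.

Section Primitive.
Variable R : realType.

Definition seg_continuous (a b : R) (f : R -> R) :=
  forall x : R, a <= x <= b -> forall e : R, 0 < e -> exists2 d : R, 0 < d &
    forall y : R, a <= y <= b -> `|y - x| < d -> `|f y - f x| < e.

Lemma seg_continuousP a b f : seg_continuous a b f <-> {within `[a, b], continuous f}.
Proof.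
split=> [cf|/subspace_continuousP cf].
  apply/subspace_continuousP => x; rewrite /= in_itv/= => xab.
  apply/cvgrPdist_lt => e e0; have [d d0 H] := cf x xab e e0.
  rewrite near_withinE; near=> y => /=; rewrite in_itv/= => yab.
  by rewrite distrC; apply: H.
move=> x xab e e0; have := cf x; rewrite /= in_itv/= => /(_ xab).
move=> /cvgrPdist_lt /(_ e e0); rewrite near_withinE => /nbhs_ballP [d /= d0 H].
exists d => // y yab yx; rewrite distrC; apply: H => //=.
by rewrite -ball_normE /ball_/= distrC.
Unshelve. all: by end_near. Qed.

Lemma seg_continuous_at a b f : (forall x : R, a <= x <= b -> {for x, continuous f}) ->
  seg_continuous a b f.
Proof.
move=> cf; apply/seg_continuousP; apply: continuous_in_subspaceT => x.
by rewrite inE/= in_itv/=; apply: cf.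
Qed.

(** The derivative is prescribed only in the open interval. Pullbacks along two paths that agree
    just on [[a, b]] may differ at the end points, and still have the same primitives. *)
Definition primitive (f : R -> R) (a b : R) (theta : R -> R) : Prop :=
  seg_continuous a b theta /\ forall x : R, a < x -> x < b -> is_derive x 1 theta (f x).

Lemma primitive_sub f a b a' b' theta : a <= a' -> b' <= b ->
  primitive f a b theta -> primitive f a' b' theta.
Proof.
move=> aa bb [c d]; split=> [x /andP[ax xb] e e0|x ax xb]; last first.
  by apply: d; [apply: le_lt_trans ax|apply: lt_le_trans bb].
have [|dl dl0 H] := c x _ e e0; first by rewrite (le_trans aa ax) (le_trans xb bb).
exists dl => // y /andP[ay yb]; apply: H.
by rewrite (le_trans aa ay) (le_trans yb bb).
Qed.

Lemma primitive_ext f g a b theta : (forall x : R, a < x -> x < b -> f x = g x) ->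
  primitive f a b theta -> primitive g a b theta.
Proof. by move=> fg [c d]; split=> // x ax xb; rewrite -fg//; apply: d. Qed.

Lemma primitive_exists f a b : a <= b -> seg_continuous a b f ->
  exists2 theta, primitive f a b theta & forall x, a <= x <= b ->
    \int[lebesgue_measure]_(t in `[a, x]) f t = theta x - theta a.
Proof.
move=> ab cf; have cf' := (seg_continuousP _ _ _).1 cf.
have intf : lebesgue_measure.-integrable `[a, b] (EFin \o f).
  by apply: continuous_compact_integrable => //; apply: segment_compact.
pose F x := \int[lebesgue_measure]_(t in `[a, x]) f t.
exists F; last by move=> x _; rewrite /F set_itv1 Rintegral_set1 subr0.
split; first by apply/seg_continuousP; exact: (parameterized_integral_continuous ab intf).
move=> x ax xb.
have cfx : {for x, continuous f}.
  have := continuous_subspaceW (@subset_itv_oo_cc _ _ a b) cf'.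
  rewrite continuous_open_subspace; last exact: interval_open.
  by apply; rewrite inE/= in_itv/= ax.
have [d E] := continuous_FTC1_closed xb intf ax cfx.
by apply: DeriveDef; [exact: d|rewrite -derive1E; exact: E].
Qed.

Lemma primitive_unique f a b th th' : a <= b -> primitive f a b th ->
  primitive f a b th' -> th b - th a = th' b - th' a.
Proof.
move=> ab [c d] [c' d'].
have cD : {within `[a, b], continuous (fun x => th x - th' x)}.
  by move=> x; apply: cvgB; [apply: (seg_continuousP _ _ _).1 c x|
                           apply: (seg_continuousP _ _ _).1 c' x].
have [x|_ _] := MVT_segment (f := fun x => th x - th' x) (df := fun=> 0) ab _ cD.
  rewrite in_itv/= => /andP[ax xb]; rewrite -(subrr (f x)).
  by apply: is_deriveB; [apply: d|apply: d'].
by rewrite mul0r => E; lra.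
Qed.

Lemma integral_primitive f a b th : a <= b -> seg_continuous a b f -> primitive f a b th ->
  \int[lebesgue_measure]_(t in `[a, b]) f t = th b - th a.
Proof.
move=> ab cf pf; have [th' pf' ->] := primitive_exists ab cf; last by rewrite lexx ab.
exact: primitive_unique pf' pf.
Qed.

Lemma primitive_increment_le f a b th M : a <= b -> primitive f a b th ->
  (forall x : R, a <= x <= b -> `|f x| <= M) -> `|th b - th a| <= M * (b - a).
Proof.
move=> ab [c d] fM; have ct := (seg_continuousP _ _ _).1 c.
have [x|x] := MVT_segment (f := th) (df := f) ab _ ct.
  by rewrite in_itv/= => /andP[]; apply: d.
rewrite in_itv/= => xab ->; rewrite normrM (ger0_norm (_ : 0 <= b - a)) ?subr_ge0//.
by rewrite ler_wpM2r ?subr_ge0// fM.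
Qed.

Lemma primitiveD f g a b th th' : primitive f a b th -> primitive g a b th' ->
  primitive (fun x => f x + g x) a b (fun x => th x + th' x).
Proof.
move=> [c d] [c' d']; split; last first.
  by move=> x ax xb; apply: is_deriveD; [apply: d|apply: d'].
apply/seg_continuousP => x; apply: cvgD;
  [apply: (seg_continuousP _ _ _).1 c x|apply: (seg_continuousP _ _ _).1 c' x].
Qed.

Lemma primitiveZ f a b th k : primitive f a b th ->
  primitive (fun x => k * f x) a b (fun x => k * th x).
Proof.
move=> [c d]; split; last by move=> x ax xb; apply: is_deriveZ; apply: d.
apply/seg_continuousP => x; apply: cvgM; first exact: cvg_cst.
exact: (seg_continuousP _ _ _).1 c x.
Qed.

Lemma seg_continuous_affine a b f (k m : R) (c d : R) :
  (forall s : R, c <= s <= d -> a <= m + s * k <= b) -> seg_continuous a b f ->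
  seg_continuous c d (fun s => f (m + s * k)).
Proof.
move=> H cf s sab e e0; have [dl dl0 K] := cf _ (H _ sab) e e0.
exists (dl / (`|k| + 1)) => [|t tab ts].
  by rewrite divr_gt0// ltr_wpDl.
apply: K; first exact: H.
rewrite opprD addrACA subrr add0r -mulrBl normrM.
have k1 : 0 < `|k| + 1 by rewrite ltr_wpDl.
move: ts; rewrite ltr_pdivlMr// => ts; apply: le_lt_trans ts.
by rewrite ler_wpM2l// lerDl.
Qed.

Lemma primitive_affine f a b th (k m : R) (c d : R) :
  (forall s : R, c <= s <= d -> a <= m + s * k <= b) ->
  (forall s : R, c < s -> s < d -> a < m + s * k < b) ->
  primitive f a b th ->
  primitive (fun s => k * f (m + s * k)) c d (fun s => th (m + s * k)).
Proof.
move=> H Ho [ct dt]; split; first exact: seg_continuous_affine ct.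
move=> s cs sd; have /andP[h1 h2] := Ho s cs sd.
rewrite mulrC; apply: (is_derive1_comp (g := fun s => m + s * k) (dt _ h1 h2)).
have -> : (fun r : R => m + r * k) = cst m + k \*: id.
  by apply/funext => r; rewrite [r * k]mulrC.
by apply: is_derive_eq; rewrite add0r [_ *: _]mulr1.
Qed.

(** A fixed domain of integration lets integrals with moving end points be differentiated in a
    parameter. The case [a = b] is separate because the rescaled points then never lie in the open
    interval. *)
Lemma integral_rescale f a b : a <= b -> seg_continuous a b f ->
  \int[lebesgue_measure]_(t in `[a, b]) f t =
  \int[lebesgue_measure]_(t in `[0, 1]) ((b - a) * f (a + t * (b - a))).
Proof.
move=> ab cf; have [th pt ->] := primitive_exists ab cf; last by rewrite ab lexx.
have H s : 0 <= s <= 1 -> a <= a + s * (b - a) <= b.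
  move=> /andP[s0 s1]; have ba : 0 <= b - a by rewrite subr_ge0.
  by rewrite lerDl mulr_ge0//= -lerBrDl ler_piMl.
move: ab; rewrite le_eqVlt => /orP[/eqP ab|ab].
  subst b; rewrite !subrr; under eq_Rintegral do rewrite mul0r.
  rewrite (@integral_primitive _ 0 1 (fun=> 0)) ?subrr//.
    by apply: seg_continuous_at => x _; apply: cst_continuous.
  split; first by apply: seg_continuous_at => x _; apply: cst_continuous.
  by move=> x _ _; apply: is_derive_cst.
have ba : 0 < b - a by rewrite subr_gt0.
rewrite (@integral_primitive _ 0 1 (fun s => th (a + s * (b - a)))) //.
- by rewrite mul1r mul0r addr0 subrKC.
- apply/seg_continuousP => x; apply: cvgM; first exact: cvg_cst.
  by apply: (seg_continuousP _ _ _).1 x; apply: seg_continuous_affine cf.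
- apply: primitive_affine pt => // s s0 s1.
  by rewrite ltrDl mulr_gt0//= -ltrBrDl gtr_pMl.
Qed.

End Primitive.

(** * Integrals depending on a parameter *)

Section ParameterIntegral.
Variables (R : realType) (V : normedModType R).

Lemma is_derive_eps (f : V -> R) x v l :
  (forall e : R, 0 < e -> exists2 d : R, 0 < d & forall h : R, `|h| < d ->
     `|f (x + h *: v) - f x - h * l| <= e * `|h|) -> is_derive x v f l.
Proof.
move=> H; apply: (is_derive_line0 _ _ _ _).2; apply/is_derive0P.
apply/cvgrPdist_le => /= e e0; have [d d0 K] := H e e0.
near=> h.
have h0 : h != 0 by near: h; exact: nbhs_dnbhs_neq.
have hd : `|h| < d by near: h; exact: dnbhs0_lt.
have := K h hd; rewrite scale0r addr0 => {}K.
have -> : l - h^-1 * (f (x + h *: v) - f x) = h^-1 * - (f (x + h *: v) - f x - h * l).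
  by move: (f _) (f _) => A B; field.
by rewrite normrM normrN normfV mulrC ler_pdivrMr ?normr_gt0.
Unshelve. all: by end_near. Qed.

(** At [tau = 0] and [tau = 1] the integrand is controlled on one side only, so regularity is that
    of a local extension [F] agreeing with [f] just for parameters in [[0, 1]]. *)
Definition locally_C_k k (O : set V) (f : V -> R -> R) : Prop :=
  forall (u : V) (tau : R), O u -> 0 <= tau <= 1 ->
  exists (N : set (V * R)%type) (F : V * R -> R),
    [/\ open N, N (u, tau), C_k k N F &
        forall w : V * R, N w -> 0 <= w.2 <= 1 -> f w.1 w.2 = F w].

(** Continuity at each [(u0, tau)] gives a radius depending on [tau]; [interval_induction] produces
    one radius for all of [[0, 1]]. *)
Lemma locally_C_k_uniform (O : set V) f u0 : locally_C_k 0 O f -> O u0 ->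
  forall e : R, 0 < e -> exists2 d : R, 0 < d & forall u, `|u - u0| < d ->
    forall tau : R, 0 <= tau <= 1 -> `|f u tau - f u0 tau| <= e.
Proof.
move=> Lf Ou e e0.
pose P (a b : R) := exists2 d, 0 < d & forall u, `|u - u0| < d ->
    forall tau, a <= tau <= b -> `|f u tau - f u0 tau| <= e.
apply: (interval_induction (P := P) ler01) => [x y z x0 xy yz z1 [d d0 H] [d' d0' H']|x x01].
  exists (Num.min d d'); rewrite ?lt_min ?d0// => u; rewrite lt_min => /andP[ud ud'] t /andP[xt tz].
  by have [ty|/ltW ty] := leP t y; [apply: H|apply: H'] => //; apply/andP.
have [N [F [oN Nu CF NF]]] := Lf u0 x Ou x01.
have cF := C_k_continuous CF Nu.
have e20 : 0 < e / 2 by rewrite divr_gt0.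
have /cvgrPdist_lt /(_ _ e20) cF' := cF.
have : \forall w \near (u0, x), N w /\ `|F (u0, x) - F w| < e / 2.
  near=> w; split; near: w => //.
  by apply: open_nbhs_nbhs.
move=> /nbhs_ballP [d /= d0 H].
have HF u t : `|u - u0| < d -> `|t - x| < d -> 0 <= t <= 1 -> `|F (u0, x) - f u t| < e / 2.
  move=> ud td t01; have [|N1 F1] := H (u, t).
    by split; rewrite /= -ball_normE /ball_/= distrC.
  by rewrite (NF (u, t)).
exists d => // y z y0 yz z1 yx zx.
exists d => // u uu t /andP[yt tz].
have t01 : 0 <= t <= 1 by rewrite (le_trans y0 yt) (le_trans tz z1).
have tx : `|t - x| < d.
  by move: yx zx; rewrite !ltr_norml => /andP[yx _] /andP[_ zx]; apply/andP; split; lra.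
have H1 := HF u t uu tx t01.
have H2 : `|F (u0, x) - f u0 t| < e / 2 by apply: HF => //; rewrite subrr normr0.
rewrite distrC in H1; rewrite -(subrKA (F (u0, x))) (splitr e).
by apply: le_trans (ler_normD _ _) _; rewrite lerD ?ltW.
Unshelve. all: by end_near. Qed.

Lemma locally_C_k_seg (O : set V) f u : locally_C_k 0 O f -> O u ->
  seg_continuous 0 1 (f u).
Proof.
move=> Lf Ou x x01 e e0; have [N [F [oN Nu CF NF]]] := Lf u x Ou x01.
have /cvgrPdist_lt /(_ _ e0) cF := C_k_continuous CF Nu.
have : \forall w \near (u, x), N w /\ `|F (u, x) - F w| < e.
  by near=> w; split; near: w => //; apply: open_nbhs_nbhs.
move=> /nbhs_ballP [d /= d0 H]; exists d => // y y01 yx.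
have [|N1 F1] := H (u, y).
  by split; [exact: ballxx|rewrite /= -ball_normE /ball_/= distrC].
by rewrite (NF (u, y))// (NF (u, x))// distrC.
Unshelve. all: by end_near. Qed.

Lemma integral01_le (f g h : R -> R) (t M : R) :
  seg_continuous 0 1 f -> seg_continuous 0 1 g -> seg_continuous 0 1 h ->
  (forall x, 0 <= x <= 1 -> `|f x - g x - t * h x| <= M) ->
  `|\int[lebesgue_measure]_(x in `[0, 1]) f x - \int[lebesgue_measure]_(x in `[0, 1]) g x -
    t * \int[lebesgue_measure]_(x in `[0, 1]) h x| <= M.
Proof.
move=> cf cg ch H.
have [a pa _] := primitive_exists ler01 cf.
have [b pb _] := primitive_exists ler01 cg.
have [c pc _] := primitive_exists ler01 ch.
rewrite (integral_primitive ler01 cf pa) (integral_primitive ler01 cg pb).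
rewrite (integral_primitive ler01 ch pc).
have p := primitiveD (primitiveD pa (primitiveZ (-1) pb)) (primitiveZ (- t) pc).
have := @primitive_increment_le _ _ _ _ _ M ler01 p.
rewrite subr0 mulr1 => K; apply: le_trans (K _) => [|x x01].
  by rewrite le_eqVlt; apply/orP; left; apply/eqP; congr `|_|; ring.
by rewrite mulN1r mulNr; apply: H.
Qed.

Lemma locally_C_kS k (O : set V) f : locally_C_k k.+1 O f -> locally_C_k k O f.
Proof.
move=> Lf u t Ou t01; have [N [F [oN Nu CF NF]]] := Lf u t Ou t01.
by exists N, F; split=> //; apply: C_kS.
Qed.

Lemma locally_C_k0 k (O : set V) f : locally_C_k k O f -> locally_C_k 0 O f.
Proof. by elim: k f => // k IH f /locally_C_kS; apply: IH. Qed.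

Lemma is_derive_slice (N : set (V * R)%type) (F : V * R -> R) (f : V -> R -> R)
    (u v : V) (t l : R) :
  open N -> N (u, t) -> (forall y, N (y, t) -> f y t = F (y, t)) ->
  is_derive (u, t) (v, 0) F l -> is_derive u v (fun y => f y t) l.
Proof.
move=> oN Nu fF dF.
have oN1 : open [set y | N (y, t)].
  apply: (open_comp (f := fun y : V => (y, t))) oN => y _.
  apply: (@cvg_pair _ _ _ (nbhs y) (nbhs y) (nbhs t) _ _ _ (fun z => z) (fun=> t)).
    exact: cvg_id.
  exact: cvg_cst.
apply: (is_derive_ext (f := fun y => F (y, t)) oN1 Nu) => [y Ny|]; first by rewrite fF.
apply: (is_derive_line0 _ _ _ _).2; have := (is_derive_line0 _ _ _ _).1 dF.
rewrite (_ : (fun r : R => F ((u, t) + r *: (v, 0))) = fun r => F (u + r *: v, t))//.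
apply/funext => r; congr F; apply: injective_projections => //=.
by rewrite scaler0 addr0.
Qed.

Lemma locally_C_k_derive k (O : set V) f v : locally_C_k k.+1 O f ->
  (forall u (t : R), O u -> 0 <= t <= 1 -> derivable (fun y => f y t) u v) /\
  locally_C_k k O (fun u t => 'D_v (fun y => f y t) u).
Proof.
move=> Lf.
have H u t : O u -> 0 <= t <= 1 -> exists (N : set (V * R)%type) (F : V * R -> R),
    [/\ open N, N (u, t), C_k k N F & forall w : V * R, N w -> 0 <= w.2 <= 1 ->
    is_derive w.1 v (fun y => f y w.2) (F w)].
  move=> Ou t01; have [N [F [oN Nu [_ /(_ (v, 0)) [d D]] NF]]] := Lf u t Ou t01.
  exists N, (fun w => 'D_(v, 0) F w); split=> // -[y s] Ny s01.
  apply: (is_derive_slice oN) => //; last by apply: derivableP; apply: d.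
  by move=> z Nz; apply: (NF (z, s)).
split=> [u t Ou t01|u t Ou t01].
  by have [N [F [oN Nu CF NF]]] := H u t Ou t01; have [] := NF (u, t) Nu t01.
have [N [F [oN Nu CF NF]]] := H u t Ou t01; exists N, F; split=> // w Nw w01.
by have E := NF w Nw w01; rewrite derive_val.
Qed.

(** By uniformity of the derivative in [t], the error of the first order expansion in [u] is at most
    [e * |h|] for all [t] simultaneously, and this bound survives integration. *)
Lemma is_derive_integral01 (O : set V) f u v : open O -> O u -> locally_C_k 1 O f ->
  is_derive u v (fun u => \int[lebesgue_measure]_(t in `[0, 1]) f u t)
    (\int[lebesgue_measure]_(t in `[0, 1]) 'D_v (fun y => f y t) u).
Proof.
move=> oO Ou Lf; have [df Lf'] := locally_C_k_derive v Lf.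
apply: is_derive_eps => e e0.
have [d d0 H] := locally_C_k_uniform (locally_C_k0 Lf') Ou e0.
have /nbhs_ballP [d' /= d'0 Od'] : nbhs u O by apply: open_nbhs_nbhs.
have v1 : 0 < `|v| + 1 by rewrite ltr_wpDl.
pose m := Num.min d d'.
have m0 : 0 < m by rewrite lt_min d0.
exists (m / (`|v| + 1)) => [|h hm]; first by rewrite divr_gt0.
have near_u s : 0 <= s <= 1 -> `|u - (u + (s * h) *: v)| < m.
  move=> /andP[s0 s1]; rewrite opprD addrA subrr sub0r normrN normrZ.
  move: hm; rewrite ltr_pdivlMr// => hm; apply: le_lt_trans hm.
  rewrite normrM (ger0_norm s0); apply: ler_pM => //.
    by rewrite mulr_ge0.
    by rewrite ler_piMl.
  by rewrite lerDl.
have Oh : O (u + h *: v).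
  apply: Od'; rewrite -ball_normE /ball_/=.
  have := near_u 1; rewrite mul1r ler01 lexx => /(_ isT) /lt_le_trans; apply.
  by rewrite ge_min lexx orbT.
apply: integral01_le; try exact: locally_C_k_seg (locally_C_k0 _) _.
- exact: locally_C_k_seg (locally_C_k0 Lf) Oh.
- exact: locally_C_k_seg (locally_C_k0 Lf) Ou.
- exact: locally_C_k_seg (locally_C_k0 Lf') Ou.
move=> x x01.
apply: (@segment_increment _ _ (fun y => f y x) (ball u m) v u h _ e) => [s s01|y].
  by rewrite -ball_normE /ball_/=; apply: near_u.
rewrite -ball_normE /ball_/= => yu; split.
  apply: df => //; apply: Od'; rewrite -ball_normE /ball_/=; apply: lt_le_trans yu _.
  by rewrite ge_min lexx orbT.
apply: H => //; rewrite distrC; apply: lt_le_trans yu _.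
by rewrite ge_min lexx.
Qed.

Lemma C_k_integral01 k (O : set V) f : open O -> locally_C_k k O f ->
  C_k k O (fun u => \int[lebesgue_measure]_(t in `[0, 1]) f u t).
Proof.
move=> oO; have cont g : locally_C_k 0 O g ->
    forall u, O u -> {for u, continuous (fun u => \int[lebesgue_measure]_(t in `[0, 1]) g u t)}.
  move=> Lg u Ou; apply/cvgrPdist_le => /= e e0.
  have [d d0 H] := locally_C_k_uniform Lg Ou e0; near=> y.
  have yu : `|y - u| < d by rewrite distrC; near: y; apply: cvgr_dist_lt.
  have Oy : O y by near: y; apply: open_nbhs_nbhs.
  have := @integral01_le (g y) (g u) (g u) 0 e (locally_C_k_seg Lg Oy)
    (locally_C_k_seg Lg Ou) (locally_C_k_seg Lg Ou).
  rewrite mul0r subr0 distrC; apply=> x x01; rewrite mul0r subr0.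
  exact: H.
elim: k f => [|k IH] f Lf; first by split=> //; apply: cont.
apply: C_kS_intro => // [|v]; first by apply: cont; apply: locally_C_k0 Lf.
have [df Lf'] := locally_C_k_derive v Lf.
exists (fun u => \int[lebesgue_measure]_(t in `[0, 1]) 'D_v (fun y => f y t) u); last exact: IH.
by move=> u Ou; apply: (is_derive_integral01 _ oO Ou); elim: k Lf {IH df Lf'} => // k IH /locally_C_kS.
Unshelve. all: by end_near. Qed.

End ParameterIntegral.

Section MoreSmooth.
Variables (R : realType) (V : normedModType R).

Lemma smooth_integral01 (O : set V) (f : V -> R -> R) : open O ->
  (forall (u : V) (t : R), O u -> 0 <= t <= 1 ->
    exists (N : set (V * R)%type) (F : V * R -> R), [/\ open N, N (u, t), smooth N F &
        forall w : V * R, N w -> 0 <= w.2 <= 1 -> f w.1 w.2 = F w]) ->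
  smooth O (fun u => \int[lebesgue_measure]_(t in `[0, 1]) f u t).
Proof.
move=> oO H k; apply: C_k_integral01 => // u t Ou t01.
by have [N [F [oN Nu SF NF]]] := H u t Ou t01; exists N, F.
Qed.

Lemma derive_line (W : normedModType R) (f : V -> W) (z v : V) (s : R) :
  'D_1 (fun r : R => f (z + r *: v)) s = 'D_v f (z + s *: v).
Proof.
have E : (fun h : R => h^-1 *: (((fun r : R => f (z + r *: v)) \o shift s) (h *: 1)
              - f (z + s *: v))) =
         (fun h : R => h^-1 *: ((f \o shift (z + s *: v)) (h *: v) - f (z + s *: v))).
  by apply/funext => h /=; rewrite [h *: 1]mulr1 scalerDl addrCA.
by rewrite /derive E.
Qed.

Lemma coordinates_continuous (V' : normedModType R) (I : finType) (e : I -> V')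
    (c : I -> V' -> R) (f : V -> V') x :
  coordinate_system e c -> (forall i, {for x, continuous (fun y => c i (f y))}) ->
  {for x, continuous f}.
Proof.
move=> ce cf.
have G (r : seq I) : \sum_(i <- r) c i (f y) *: e i @[y --> x] -->
    \sum_(i <- r) c i (f x) *: e i.
  elim: r => [|i r IH].
    by rewrite big_nil; under eq_fun do rewrite big_nil; apply: cvg_cst.
  rewrite big_cons; under eq_fun do rewrite big_cons.
  have H : c i (f y) *: e i @[y --> x] --> c i (f x) *: e i by apply: cvgZr_tmp; apply: cf.
  have K := cvgD H IH; exact: K.
rewrite /prop_for /continuous_at.
have := G (index_enum I); rewrite -ce.
by under eq_fun do rewrite -ce.
Qed.

Lemma is_derive_right_zero (f : R -> R) (l d : R) : 0 < d -> is_derive (0 : R) 1 f l ->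
  (forall r : R, 0 <= r < d -> f r = 0) -> l = 0.
Proof.
move=> d0 /is_derive0P df fz.
have H : h^-1 * (f h - f 0) @[h --> (0 : R)^'+] --> l.
  apply: cvg_trans df; apply: cvg_app => A /=.
  move=> HA; have {}HA : \forall z \near (0 : R)^', A z by [].
  change (\forall z \near (0 : R)^'+, A z); move: HA; rewrite !near_withinE.
  by apply: filterS => z H z0; apply: H; rewrite gt_eqF.
have H0 : h^-1 * (f h - f 0) @[h --> (0 : R)^'+] --> (0 : R).
  apply/cvgrPdist_le => /= eps eps0; near=> h.
  have h0 : 0 < h by near: h; exact: nbhs_right_gt.
  have hd : h < d by near: h; exact: nbhs_right_lt.
  by rewrite !fz ?lexx ?d0// ?(ltW h0)//= subrr mulr0 subrr normr0 ltW.
exact: (cvg_unique _ H H0).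
Unshelve. all: by end_near. Qed.

(** Two existing derivatives are determined by one side. The sign of [k] chooses the side, which
    serves at the boundary of intervals and rectangles, where a map and its extension agree only
    inwards. *)
Lemma derive_eq_side (f g : V -> R) (x v : V) l m (k d : R) : k != 0 -> 0 < d ->
  is_derive x v f l -> is_derive x v g m ->
  (forall r : R, 0 <= r < d -> f (x + (k * r) *: v) = g (x + (k * r) *: v)) -> l = m.
Proof.
move=> k0 d0 df dg fg.
have dF : is_derive (0 : R) 1 (fun r : R => f (x + r *: v) - g (x + r *: v)) (l - m).
  by apply: is_deriveB; apply: (is_derive_line0 _ _ _ _).1.
have dF' : is_derive (k * 0) 1 (fun r : R => f (x + r *: v) - g (x + r *: v)) (l - m).
  by rewrite mulr0.
have dk : is_derive (0 : R) 1 (fun r : R => k * r) k.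
  by apply: is_derive_eq; rewrite [_ *: _]mulr1.
have := is_derive1_comp dF' dk => dG.
have : (l - m) * k = 0.
  by apply: (is_derive_right_zero d0 dG) => r rd /=; rewrite fg// subrr.
by move/eqP; rewrite mulf_eq0 (negPf k0) orbF subr_eq0 => /eqP.
Qed.

End MoreSmooth.

(** * Smooth maps and 1-forms on a manifold *)

Section Charts.
Variables (R : realType) (n : nat) (M : topologicalType).
Variable X : smooth_atlas R n M.
Implicit Types c : chart X.

Definition chart_image c (O : set M) : set 'rV[R]_n := coord c @` (O `&` dom c).

Lemma chart_imageP c O x : chart_image c O x ->
  [/\ O (param c x), dom c (param c x) & coord c (param c x) = x].
Proof. by move=> [y [Oy cy] <-]; rewrite coordK. Qed.

Lemma chart_image_coord c (O : set M) y : O y -> dom c y -> chart_image c O (coord c y).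
Proof. by move=> Oy cy; exists y. Qed.

Lemma chart_image_open c (O : set M) : open O -> open (chart_image c O).
Proof.
move=> oO; rewrite openE => x [y [Oy cy] <-].
have H1 : \forall z \near coord c y, (coord c @` dom c) z.
  by apply: open_nbhs_nbhs; split; [exact: img_open|exists y].
have H2 : \forall z \near coord c y, O (param c z).
  have /(_ O) := param_continuous cy; apply; rewrite coordK//.
  exact: open_nbhs_nbhs.
rewrite /interior /=; near=> z.
have [w cw wz] : (coord c @` dom c) z by near: z.
exists w => //; split=> //; rewrite -(coordK cw) wz.
by near: z.
Unshelve. all: by end_near. Qed.

Lemma chart_atP y : dom (chart_at X y) y.
Proof. by rewrite /chart_at; case: cid. Qed.

Section Maps.
Variable V : normedModType R.
Implicit Types (O : set V) (h : V -> M).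

Lemma smooth_map_sub O O' h : O' `<=` O -> smooth_map X O h -> smooth_map X O' h.
Proof.
move=> sO [ch Sh]; split=> [x /sO|c]; first exact: ch.
by apply: smooth_sub (Sh c) => x [/sO Ox hx].
Qed.

Lemma smooth_map_open O h (D : set M) : open O -> smooth_map X O h -> open D ->
  open (O `&` h @^-1` D).
Proof.
move=> oO [ch _] oD; rewrite openE => x [Ox Dx]; rewrite /interior/=.
apply: filterI; first exact: open_nbhs_nbhs.
by apply: (ch x Ox); apply: open_nbhs_nbhs.
Qed.

Lemma smooth_map_cst O (y : M) : smooth_map X O (fun=> y).
Proof.
by split=> [x _|c]; [apply: cst_continuous|apply: smooth_cst].
Qed.

Lemma smooth_map_param O c (f : V -> 'rV[R]_n) : open O -> smooth O f ->
  (forall x, O x -> chart_image c setT (f x)) -> smooth_map X O (fun x => param c (f x)).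
Proof.
move=> oO Sf Of.
have cf x : O x -> {for x, continuous (fun x => param c (f x))}.
  move=> Ox; apply: continuous_comp; first exact: smooth_continuous Sf Ox.
  by have [y [_ cy] <-] := Of x Ox; apply: param_continuous.
split=> // c'; have oD : open (O `&` (fun x => param c (f x)) @^-1` dom c').
  rewrite openE => x [Ox Dx]; rewrite /interior/=.
  apply: filterI; first exact: open_nbhs_nbhs.
  by apply: (cf x Ox); apply: open_nbhs_nbhs; split=> //; exact: dom_open.
apply: smooth_row => // j.
apply: (@smooth_comp_row _ _ n _ (chart_image c (dom c'))
   (fun x => (coord c' \o param c) x 0 j)) => //.
- by apply: chart_image_open; apply: dom_open.
- by move=> x [/Of /chart_imageP [_ cx E] c'x]; rewrite -E; apply: chart_image_coord.
- by apply: smooth_sub Sf => x [].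
- apply: smooth_coord; first by apply: chart_image_open; apply: dom_open.
  by rewrite /chart_image setIC; apply: transition_smooth.
Qed.

Lemma smooth_map_coord O h c : open O -> smooth_map X O h -> (forall x, O x -> dom c (h x)) ->
  smooth O (fun x => coord c (h x)).
Proof. by move=> oO [_ /(_ c) Sh] H; apply: smooth_sub Sh => x Ox; split=> //=; apply: H. Qed.

End Maps.

Lemma smooth_map_comp (V V' : normedModType R) (I : finType) (e : I -> V')
    (k : I -> V' -> R) (O : set V) (N : set V') (g : V' -> M) (f : V -> V') :
  coordinate_system e k -> open O -> open N -> (forall x, O x -> N (f x)) ->
  (forall i, smooth O (fun x => k i (f x))) -> smooth_map X N g ->
  smooth_map X O (fun x => g (f x)).
Proof.
move=> ek oO oN ON Sf Sg; have [cg _] := Sg.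
have cf x : O x -> {for x, continuous f}.
  move=> Ox; apply: (coordinates_continuous ek) => i.
  exact: smooth_continuous (Sf i) Ox.
have cgf x : O x -> {for x, continuous (fun x => g (f x))}.
  by move=> Ox; apply: continuous_comp; [apply: cf|apply: cg; apply: ON].
split=> // c; have oD : open (O `&` (fun x => g (f x)) @^-1` dom c).
  rewrite openE => x [Ox Dx]; rewrite /interior/=.
  apply: filterI; first exact: open_nbhs_nbhs.
  by apply: (cgf x Ox); apply: open_nbhs_nbhs; split=> //; exact: dom_open.
apply: smooth_row => // j.
have oN' : open (N `&` g @^-1` dom c) by apply: smooth_map_open Sg _ => //; exact: dom_open.
apply: (@smooth_comp_coord _ _ _ _ _ _ _ (N `&` g @^-1` dom c) (fun x => (coord c \o g) x 0 j) _ ek) => //.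
- by move=> x [Ox Dx]; split=> //; apply: ON.
- by move=> i; apply: smooth_sub (Sf i) => x [].
- by apply: smooth_coord => //; have [_] := Sg.
Qed.

Section Functions.
Variable V : normedModType R.
Implicit Types (O : set V) (h : V -> M).

Definition smooth_function (D : set M) (f : M -> R) : Prop :=
  forall c, smooth (chart_image c D) (fun x => f (param c x)).

Lemma smooth_function_comp O h D f : open O -> open D -> smooth_map X O h ->
  (forall x, O x -> D (h x)) -> smooth_function D f -> smooth O (fun x => f (h x)).
Proof.
move=> oO oD Sh OD Sf; apply: smooth_local => x Ox.
set c := chart_at X (h x); have oN : open (O `&` h @^-1` dom c).
  by apply: smooth_map_open Sh _ => //; exact: dom_open.
exists (O `&` h @^-1` dom c); first by split=> //; exact: chart_atP.
apply: (smooth_ext (f := fun x => f (param c (coord c (h x))))) => //.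
  by move=> y [_ cy]; rewrite coordK.
apply: (@smooth_comp_row _ _ n _ (chart_image c D) (fun x => f (param c x))) => //.
- exact: chart_image_open.
- by move=> y [Oy cy]; apply: chart_image_coord => //; apply: OD.
- by have [_] := Sh.
Qed.

Lemma is_derive_map_coord O h c x v : open O -> smooth_map X O h -> O x -> dom c (h x) ->
  is_derive x v (coord c \o h) ('D_v (coord c \o h) x).
Proof.
by move=> oO [_ /(_ c) Sh] Ox cx; apply: (smooth_is_derive _ Sh); split.
Qed.

Lemma is_derive_function O h c (D : set M) f x v : open O -> open D -> smooth_map X O h -> O x ->
  dom c (h x) -> D (h x) -> smooth_function D f ->
  is_derive x v (fun y => f (h y))
    (\sum_l ('D_v (coord c \o h) x) 0 l * partial c l f (h x)).
Proof.
move=> oO oD Sh Ox cx Dx Sf.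
have oN : open (O `&` h @^-1` dom c) by apply: smooth_map_open Sh _ => //; exact: dom_open.
apply: (is_derive_ext (f := fun y => f (param c (coord c (h y)))) oN) => //.
  by move=> y [_ cy]; rewrite coordK.
apply: (is_derive_comp_coord (g := fun z => f (param c z)) (f := fun y => coord c (h y))
  (tau := fun l => ('D_v (coord c \o h) x) 0 l)
  (@coordinates_row R n) (chart_image_open (c := c) oD)) => //.
- exact: chart_image_coord.
- by have /(_ 1%N) := Sf c.
- by apply: (is_derive_rowP _ _ _ _).1; apply: is_derive_map_coord Sh Ox cx.
Qed.

End Functions.

End Charts.

Section DeriveExt.
Variables (R : realType) (V W : normedModType R).

Lemma derive_ext (O : set V) (f g : V -> W) x v :
  open O -> O x -> (forall y, O y -> f y = g y) -> 'D_v f x = 'D_v g x.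
Proof.
move=> oO Ox fg; apply: near_eq_derive.
by apply: filterS (open_nbhs_nbhs (conj oO Ox)) => y /fg.
Qed.

End DeriveExt.

(** * Symmetry of second derivatives and vanishing of minors *)

Section Schwarz.
Variables (R : realType) (V : normedModType R).

(** The mean value estimate is used twice: along [v] for the increment of [f] by [h *: w], then
    along [w] for ['D_v f]. *)
Lemma second_difference (f : V -> R) (N : set V) (z v w : V) (e : R) :
  open N -> N z -> smooth N f -> 0 < e ->
  exists2 d : R, 0 < d & forall h : R, 0 < h -> h < d ->
    `|f (z + h *: v + h *: w) - f (z + h *: v) - (f (z + h *: w) - f z) -
      h * (h * 'D_w (fun y => 'D_v f y) z)| <= e * h * h.
Proof.
move=> oN Nz Sf e0; set D : R := 'D_w _ z.
have SD : smooth N (fun y => 'D_w (fun y => 'D_v f y) y).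
  by apply: smooth_derive; apply: smooth_derive.
have /cvgrPdist_le /(_ _ e0) cD := smooth_continuous SD Nz.
have : \forall y \near z, N y /\ `|D - 'D_w (fun y => 'D_v f y) y| <= e.
  by near=> y; split; near: y => //; apply: open_nbhs_nbhs.
move=> /nbhs_ballP [r /= r0 Hr].
have k0 : 0 < `|v| + `|w| + 1 by rewrite ltr_wpDl// addr_ge0.
exists (r / (`|v| + `|w| + 1)) => [|h h0 hr]; first by rewrite divr_gt0.
have in_ball (s t : R) : 0 <= s <= 1 -> 0 <= t <= 1 ->
    ball z r (z + (s * h) *: v + (t * h) *: w).
  move=> /andP[s0 s1] /andP[t0 t1]; rewrite -ball_normE /ball_/=.
  rewrite -addrA opprD addrA subrr sub0r normrN.
  apply: (le_lt_trans (ler_normD _ _)); rewrite !normrZ.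
  rewrite (ger0_norm s0) (ger0_norm t0) (gtr0_norm h0).
  move: hr; rewrite ltr_pdivlMr// => hr; apply: le_lt_trans hr.
  rewrite -addrA mulrDr; apply: lerD.
    by rewrite ler_wpM2r// ler_piMl// ltW.
  apply: (@le_trans _ _ (h * `|w|)); first by rewrite ler_wpM2r// ler_piMl// ltW.
  by rewrite ler_wpM2l ?lerDl// ltW.
have one : 0 <= (1 : R) <= 1 by rewrite ler01 lexx.
pose S := [set y | exists2 s : R, 0 <= s <= 1 & y = z + (s * h) *: v].
pose g y := f (y + h *: w) - f y.
have := @segment_increment _ _ g S v z h (h * D) (e * h).
rewrite (gtr0_norm h0) /g; apply => [s s01|y [s s01 ->]]; first by exists s.
set y0 := z + (s * h) *: v.
have By (t : R) : 0 <= t <= 1 -> ball z r (y0 + (t * h) *: w) by apply: in_ball.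
have [Nyw _] : N (y0 + h *: w) /\ True.
  by have := By 1 one; rewrite mul1r => /Hr [].
have Ny : N y0.
  by have := By 0; rewrite lexx ler01 mul0r scale0r addr0 => /(_ isT) /Hr [].
have d1 : is_derive y0 v (fun y => f (y + h *: w)) ('D_v f (y0 + h *: w)).
  apply: (is_derive_line0 _ _ _ _).2.
  have := (is_derive_line0 _ _ _ _).1 (smooth_is_derive v Sf Nyw).
  by under eq_fun do rewrite addrAC.
have d2 := is_deriveB d1 (smooth_is_derive v Sf Ny).
split; first by have [] := d2.
have -> : 'D_v (fun y => f (y + h *: w) - f y) y0 = 'D_v f (y0 + h *: w) - 'D_v f y0.
  by have [_] := d2.
rewrite -[h in e * h](gtr0_norm h0).
have K := @segment_increment _ _ (fun y => 'D_v f y) (ball z r) w y0 h D e By.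
apply: K => y' /Hr [Ny' HD]; split; last by rewrite distrC.
by have [] := smooth_is_derive w (smooth_derive v Sf) Ny'.
Unshelve. all: by end_near. Qed.

(** The second difference of [f] is symmetric in [v] and [w]; after division by [h * h] both mixed
    derivatives are within [e] of it. *)
Lemma derive_swap (f : V -> R) (N : set V) (z v w : V) : open N -> N z -> smooth N f ->
  'D_w (fun y => 'D_v f y) z = 'D_v (fun y => 'D_w f y) z.
Proof.
move=> oN Nz Sf; set D : R := 'D_w _ z; set D' : R := 'D_v _ z.
have H (e : R) : 0 < e -> `|D - D'| <= e + e.
  move=> e0.
  have [d d0 Hd] := second_difference v w oN Nz Sf e0.
  have [d' d'0 Hd'] := second_difference w v oN Nz Sf e0.
  pose h : R := Num.min d d' / 2.
  have m0 : 0 < Num.min d d' by rewrite lt_min d0.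
  have h0 : 0 < h by rewrite divr_gt0.
  have hm : h < Num.min d d' by rewrite /h; lra.
  have := Hd h h0; have := Hd' h h0; move: hm; rewrite lt_min => /andP[-> ->].
  rewrite -/D -/D' => /(_ isT) K' /(_ isT) K.
  rewrite (addrAC z (h *: w)) in K'.
  set A := f (z + h *: v + h *: w) in K K'; set B := f (z + h *: v) in K K'.
  set C := f (z + h *: w) in K K'.
  have : `|h * (h * (D - D'))| <= (e + e) * h * h.
    have -> : h * (h * (D - D')) = (A - C - (B - f z) - h * (h * D')) -
      (A - B - (C - f z) - h * (h * D)) by ring.
    apply: le_trans (ler_normB _ _) _; apply: le_trans (lerD K' K) _.
    by rewrite !mulrDl.
  have -> : `|h * (h * (D - D'))| = `|D - D'| * (h * h).
    by rewrite mulrA normrM mulrC (gtr0_norm (mulr_gt0 h0 h0)).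
  by rewrite -[X in _ <= X]mulrA ler_pM2r// mulr_gt0.
apply/eqP; rewrite -subr_eq0 -normr_le0; apply/ler_addgt0Pl => e e0.
by rewrite addr0; have := H (e / 2); rewrite divr_gt0// -splitr => /(_ isT).
Qed.

End Schwarz.

Section RankOne.
Variable K : fieldType.

Lemma rank_le1_minor n (u w : 'rV[K]_n) l m : (\rank (col_mx u w) <= 1)%N ->
  u 0 l * w 0 m = u 0 m * w 0 l.
Proof.
rewrite -addsmxE => r1; have [->|u0] := eqVneq u 0; first by rewrite !mxE !mul0r.
have ru : \rank u = 1%N by rewrite rank_rV u0.
have : (u + w <= u)%MS by rewrite -(geq_leqif (mxrank_leqif_sup (addsmxSl u w))) ru.
rewrite addsmx_sub => /andP[_ /sub_rVP [a ->]].
by rewrite !mxE; ring.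
Qed.

(** Algebraic core of closedness: [S] and [S'] will be the mixed second derivatives of the
    coordinates of a map, [a] and [b] its first derivatives, and [B] the partial derivatives of the
    components of the form. Vanishing minors allow [a] and [b] to be exchanged. *)
Lemma minor_sum n (A S S' a b : 'I_n -> K) (B : 'I_n -> 'I_n -> K) :
  (forall l, S l = S' l) -> (forall l m, a l * b m = a m * b l) ->
  \sum_l (A l * S l + a l * \sum_m b m * B l m) =
  \sum_l (A l * S' l + b l * \sum_m a m * B l m).
Proof.
move=> SS ab; apply: eq_bigr => l _; rewrite SS; congr (_ + _).
by rewrite !mulr_sumr; apply: eq_bigr => m _; rewrite !mulrA ab [a m * _]mulrC.
Qed.

End RankOne.

(** * Pulling back 1-forms *)

Section Forms.
Variables (R : realType) (n : nat) (M : topologicalType).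
Variable X : smooth_atlas R n M.
Implicit Types c : chart X.

Definition pull (V : normedModType R) (alpha : chart X -> M -> 'rV[R]_n) (h : V -> M)
    (v x : V) : R :=
  let c := chart_at X (h x) in
  \sum_(l < n) alpha c (h x) 0 l * ('D_v (coord c \o h) x) 0 l.

Lemma smooth_coord_function c (l : 'I_n) :
  smooth_function X (dom c) (fun y => coord c y 0 l).
Proof.
move=> c'; apply: smooth_coord; first by apply: chart_image_open; apply: dom_open.
by rewrite /chart_image setIC; apply: transition_smooth.
Qed.

Section Pull.
Variables (V : normedModType R) (alpha : chart X -> M -> 'rV[R]_n) (D : set M).
Hypothesis oD : open D.
Hypothesis Falpha : smooth_1form D alpha.
Implicit Types (O : set V) (h : V -> M).

Lemma derive_map_coord O h c x v l : open O -> smooth_map X O h -> O x -> dom c (h x) ->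
  ('D_v (coord c \o h) x) 0 l = 'D_v (fun y => coord c (h y) 0 l) x.
Proof.
move=> oO Sh Ox cx; have d := is_derive_map_coord v oO Sh Ox cx.
by have [_ ->] := (is_derive_rowP _ _ _ _).1 d l.
Qed.

(** [pull] uses a chart that depends on the point, so it can be differentiated only after passing to
    one fixed chart. The change of components of [alpha] cancels against the chain rule for the
    change of coordinates. *)
Lemma pull_chart O h c x v : open O -> smooth_map X O h -> O x -> D (h x) -> dom c (h x) ->
  pull alpha h v x = \sum_(l < n) alpha c (h x) 0 l * ('D_v (coord c \o h) x) 0 l.
Proof.
move=> oO Sh Ox Dx cx; rewrite /pull; set c' := chart_at X (h x).
have c'x : dom c' (h x) by exact: chart_atP.
have [_ cov _] := Falpha; rewrite [RHS](eq_bigr (fun l => \sum_(m < n) alpha c' (h x) 0 m *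
   ((partial c l (coord c') (h x)) 0 m * ('D_v (coord c \o h) x) 0 l))); last first.
  move=> l _; rewrite (cov c c' _ Dx cx c'x) mulr_suml.
  by apply: eq_bigr => m _; rewrite mulrA.
rewrite exchange_big; apply: eq_bigr => m _; rewrite -mulr_sumr; congr (_ * _).
rewrite (derive_map_coord _ _ oO Sh Ox c'x).
have [_ ->] := is_derive_function v oO (dom_open c') Sh Ox cx c'x (smooth_coord_function c' m).
apply: eq_bigr => l _; rewrite mulrC; congr (_ * _).
have cc' : (coord c @` (dom c `&` dom c')) (coord c (h x)) by exists (h x).
have d := smooth_is_derive (delta_mx 0 l) (transition_smooth c c') cc'.
by rewrite /partial; have [_ ->] := (is_derive_rowP _ _ _ _).1 d m.
Qed.

Lemma smooth_pull O h v : open O -> smooth_map X O h -> (forall x, O x -> D (h x)) ->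
  smooth O (pull alpha h v).
Proof.
move=> oO Sh OD; apply: smooth_local => x Ox; set c := chart_at X (h x).
have cx : dom c (h x) by exact: chart_atP.
have oN : open (O `&` h @^-1` dom c).
  by apply: smooth_map_open Sh _ => //; exact: dom_open.
have SN : smooth (O `&` h @^-1` dom c) (coord c \o h) by have [_] := Sh.
exists (O `&` h @^-1` dom c) => //.
apply: (smooth_ext (f := fun x => \sum_(l < n) alpha c (param c (coord c (h x))) 0 l *
   ('D_v (coord c \o h) x) 0 l) oN).
  move=> y [Oy cy]; rewrite (coordK cy); apply/esym.
  exact: pull_chart oO Sh Oy (OD _ Oy) cy.
apply: (smooth_sum _ oN) => l; apply: (smoothM oN); last first.
  by apply: (smooth_coord _ oN); apply: smooth_derive.
have [_ _ Sa] := Falpha.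
apply: (@smooth_comp_row _ _ n _ (chart_image c D) (fun z => alpha c (param c z) 0 l)) => //.
- exact: chart_image_open.
- by move=> y [Oy cy]; apply: chart_image_coord => //; apply: OD.
- by apply: smooth_coord; [apply: chart_image_open|apply: Sa].
Qed.

Lemma pull_ext O h g v x : open O -> O x -> (forall y, O y -> h y = g y) ->
  pull alpha h v x = pull alpha g v x.
Proof.
move=> oO Ox hg.
have E c : 'D_v (coord c \o h) x = 'D_v (coord c \o g) x.
  by apply: (derive_ext _ oO Ox) => y Oy; rewrite /= hg.
by rewrite /pull (hg x Ox); apply: eq_bigr => l _; rewrite E.
Qed.

(* The components of [d(h^* alpha)] are 2 x 2 minors of the Jacobian matrix of
   [h], contracted with the derivatives of [alpha]; the second derivatives of
   [h] cancel. *)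
Lemma pull_closed O h c x v w : open O -> smooth_map X O h -> O x -> (forall x, O x -> D (h x)) ->
  dom c (h x) ->
  (\rank (col_mx ('D_v (coord c \o h) x) ('D_w (coord c \o h) x)) <= 1)%N ->
  'D_w (pull alpha h v) x = 'D_v (pull alpha h w) x.
Proof.
move=> oO Sh Ox OD cx rk.
have oN : open (O `&` h @^-1` dom c).
  by apply: smooth_map_open Sh _ => //; exact: dom_open.
set N := O `&` _ in oN; have Nx : N x by [].
have SN l : smooth N (fun y => coord c (h y) 0 l).
  by apply: (smooth_coord (f := fun y => coord c (h y)) l oN); have [_ /(_ c)] := Sh.
have dE y u l : N y -> ('D_u (coord c \o h) y) 0 l = 'D_u (fun y => coord c (h y) 0 l) y.
  by move=> [Oy cy]; apply: derive_map_coord oO Sh Oy cy.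
have [_ _ Sa] := Falpha.
have Sal l : smooth_function X (D `&` dom c) (fun y => alpha c y 0 l).
  move=> c'; apply: smooth_local => _ [y [[Dy cy] c'y] <-].
  have Iy : chart_image c' (D `&` dom c) (coord c' y) by exists y.
  have oI : open (chart_image c' (D `&` dom c)).
    by apply: chart_image_open; apply: openI => //; exact: dom_open.
  exists (chart_image c' (D `&` dom c)) => //.
  apply: (smooth_ext (f := fun z => alpha c (param c (coord c (param c' z))) 0 l)) => //.
    by move=> z /chart_imageP [[_ cz] _ _]; rewrite coordK.
  apply: (@smooth_comp_row _ _ n _ (chart_image c D) (fun z => alpha c (param c z) 0 l)
     (fun z => coord c (param c' z))) => //.
  - exact: chart_image_open.
  - by move=> z /chart_imageP [[Dz cz] _ _]; apply: chart_image_coord.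
  - apply: smooth_sub (transition_smooth c' c) => z [t [[Dt ct] c't] <-].
    by exists t.
  - by apply: smooth_coord; [apply: chart_image_open|apply: Sa].
have oDc : open (D `&` dom c) by apply: openI => //; exact: dom_open.
have d u u' : is_derive x u' (pull alpha h u) (\sum_(l < n) (alpha c (h x) 0 l *
    'D_u' (fun y => 'D_u (fun y => coord c (h y) 0 l) y) x +
    'D_u (fun y => coord c (h y) 0 l) x *
    \sum_(m < n) 'D_u' (fun y => coord c (h y) 0 m) x * partial c m (fun y => alpha c y 0 l) (h x))).
  apply: (is_derive_ext (f := fun y => \sum_(l < n) alpha c (h y) 0 l *
     'D_u (fun y => coord c (h y) 0 l) y) oN Nx) => [y [Oy cy]|].
    rewrite (pull_chart _ oO Sh Oy (OD _ Oy) cy).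
    by apply: eq_bigr => l _; rewrite dE.
  have -> : (fun y => \sum_(l < n) alpha c (h y) 0 l * 'D_u (fun y => coord c (h y) 0 l) y) =
      \sum_(l < n) ((fun y => alpha c (h y) 0 l) * (fun y => 'D_u (fun y => coord c (h y) 0 l) y)).
    by apply/funext => y; rewrite fct_sumE.
  apply: is_derive_sum => l; apply: is_deriveM.
    have := is_derive_function u' oO oDc Sh Ox cx (conj (OD _ Ox) cx) (Sal l).
    by under eq_bigr do rewrite dE//.
  exact: smooth_is_derive (smooth_derive u (SN l)) Nx.
have [_ ->] := d v w; have [_ ->] := d w v.
apply: minor_sum => [l|l m]; first exact: derive_swap oN Nx (SN l).
by rewrite -!(dE _ _ _ Nx); apply: rank_le1_minor.
Qed.

End Pull.

Lemma pullback_line (V : normedModType R) alpha (h : V -> M) (z v : V) (s : R) :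
  pullback alpha (fun r : R => h (z + r *: v)) s = pull alpha h v (z + s *: v).
Proof.
have E c : 'D_1 (coord c \o (fun r : R => h (z + r *: v))) s = 'D_v (coord c \o h) (z + s *: v).
  exact: (derive_line (coord c \o h)).
by rewrite /pullback /pull; apply: eq_bigr => l _; rewrite E.
Qed.

Lemma pullback_comp (N : set R) (alpha : chart X -> M -> 'rV[R]_n) (p : R -> M) (f : R -> R) (s l : R) :
  open N -> smooth_map X N p -> N (f s) -> is_derive s 1 f l ->
  pullback alpha (p \o f) s = l * pullback alpha p (f s).
Proof.
move=> oN Sp Nf df; rewrite /pullback mulr_sumr /=; apply: eq_bigr => m _.
set c := chart_at X _; have cx : dom c (p (f s)) by exact: chart_atP.
rewrite mulrCA; congr (_ * _).
have d := (is_derive_rowP _ _ _ _).1 (is_derive_map_coord (1 : R) oN Sp Nf cx).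
have d' : is_derive s 1 (coord c \o (p \o f)) (l *: 'D_1 (coord c \o p) (f s)).
  apply: (is_derive_rowP _ _ _ _).2 => j; rewrite mxE mulrC.
  exact: (is_derive1_comp (d j) df).
by have [_ ->] := d'; rewrite mxE.
Qed.

End Forms.

(** * Horizontal lifts and the TQFT of a bundle *)

Section Phase.
Variable R : realType.
Implicit Types (u v : R[i]) (x y : R).

Lemma complex_ext u v : complex.Re u = complex.Re v -> complex.Im u = complex.Im v -> u = v.
Proof. by case: u v => [a b] [c d] /= -> ->. Qed.

Lemma Re_mulc u v : complex.Re (u * v) =
  complex.Re u * complex.Re v - complex.Im u * complex.Im v.
Proof. by case: u v => [a b] [c d]. Qed.

Lemma Im_mulc u v : complex.Im (u * v) =
  complex.Re u * complex.Im v + complex.Im u * complex.Re v.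
Proof. by case: u v => [a b] [c d]. Qed.

Lemma expiD x y : expi (x + y) = expi x * expi y.
Proof.
apply: complex_ext; rewrite ?Re_mulc ?Im_mulc /= ?cosD ?sinD; first by [].
by rewrite addrC.
Qed.

Lemma expi0 : expi (0 : R) = 1.
Proof. by apply: complex_ext; rewrite /= ?cos0 ?sin0. Qed.

Lemma norm_expi x : `|expi x| = 1.
Proof. by rewrite normc_def /= cos2Dsin2 sqrtr1. Qed.

Lemma norm1_sqr u : `|u| = 1 -> complex.Re u ^+ 2 + complex.Im u ^+ 2 = 1.
Proof.
move=> u1; have := add_Re2_Im2 u; rewrite u1 expr1n => E.
by have := congr1 (@complex.Re R) E.
Qed.

Lemma norm1_conj u : `|u| = 1 -> u^* * u = 1.
Proof. by move=> u1; rewrite -normCKC u1 expr1n. Qed.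

Lemma norm1_neq0 u : `|u| = 1 -> u != 0.
Proof. by move=> u1; rewrite -normr_eq0 u1 oner_eq0. Qed.

Lemma expi_neq0 x : expi x != 0.
Proof. by apply: norm1_neq0; rewrite norm_expi. Qed.

Lemma seg_continuous_comp (a b : R) (f g : R -> R) : continuous f ->
  seg_continuous a b g -> seg_continuous a b (f \o g).
Proof.
move=> cf cg x xab e e0.
have /cvgrPdist_lt /(_ _ e0) /nbhs_ballP [r /= r0 H] := cf (g x).
have [d d0 K] := cg x xab r r0; exists d => // y yab yx.
rewrite distrC; apply: H; rewrite -ball_normE /ball_/= distrC.
exact: K.
Qed.

Lemma seg_continuousM (a b : R) (f g : R -> R) :
  seg_continuous a b f -> seg_continuous a b g -> seg_continuous a b (f * g).
Proof.
move=> cf cg; apply/seg_continuousP => x.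
by apply: cvgM; [apply: (seg_continuousP _ _ _).1 cf x|apply: (seg_continuousP _ _ _).1 cg x].
Qed.

Lemma seg_continuousD (a b : R) (f g : R -> R) :
  seg_continuous a b f -> seg_continuous a b g -> seg_continuous a b (f + g).
Proof.
move=> cf cg; apply/seg_continuousP => x.
by apply: cvgD; [apply: (seg_continuousP _ _ _).1 cf x|apply: (seg_continuousP _ _ _).1 cg x].
Qed.

Lemma seg_continuousN (a b : R) (f : R -> R) :
  seg_continuous a b f -> seg_continuous a b (- f).
Proof.
move=> cf; apply/seg_continuousP => x.
by apply: cvgN; apply: (seg_continuousP _ _ _).1 cf x.
Qed.

(* The function [expi (- k) * u] has zero derivative. *)
Lemma phase_ode (c s beta k : R -> R) (x y : R) : x <= y ->
  primitive (fun r => - beta r * s r) x y c -> primitive (fun r => beta r * c r) x y s ->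
  primitive beta x y k ->
  (c y +i* s y)%C = (c x +i* s x)%C * expi (k y - k x).
Proof.
move=> xy [cc dc] [cs ds] [ck dk].
have cck : seg_continuous x y (cos \o k).
  by apply: seg_continuous_comp => //; apply: continuous_cos.
have csk : seg_continuous x y (sin \o k).
  by apply: seg_continuous_comp => //; apply: continuous_sin.
have dck r : x < r -> r < y -> is_derive r 1 (cos \o k) (- sin (k r) * beta r).
  by move=> xr ry; apply: is_derive1_comp; apply: dk.
have dsk r : x < r -> r < y -> is_derive r 1 (sin \o k) (cos (k r) * beta r).
  by move=> xr ry; apply: is_derive1_comp; apply: dk.
have smE (a b : R) : a *: (b : R) = a * b by [].
have p0 m : primitive (fun=> 0) x y (fun=> m).
  split; first by apply: seg_continuous_at => z _; apply: cst_continuous.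
  by move=> z _ _; apply: is_derive_cst.
have pP : primitive (fun=> 0) x y (c * (cos \o k) + s * (sin \o k)).
  split; first by apply: seg_continuousD; apply: seg_continuousM.
  move=> r xr ry; apply: (is_derive_eq (is_deriveD
    (is_deriveM (dc r xr ry) (dck r xr ry)) (is_deriveM (ds r xr ry) (dsk r xr ry)))).
  rewrite !smE /=; ring.
have pQ : primitive (fun=> 0) x y (s * (cos \o k) - c * (sin \o k)).
  split; first by apply: seg_continuousD; [|apply: seg_continuousN]; apply: seg_continuousM.
  move=> r xr ry; apply: (is_derive_eq (is_deriveB
    (is_deriveM (ds r xr ry) (dck r xr ry)) (is_deriveM (dc r xr ry) (dsk r xr ry)))).
  rewrite !smE /=; ring.
have := primitive_unique xy pP (p0 0); have := primitive_unique xy pQ (p0 0).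
rewrite subrr => /eqP; rewrite subr_eq0 => /eqP EQ /eqP; rewrite subr_eq0 => /eqP EP.
move: EQ EP; rewrite /= => EQ EP.
have {}EQ : s y * cos (k y) - c y * sin (k y) = s x * cos (k x) - c x * sin (k x) by [].
have {}EP : c y * cos (k y) + s y * sin (k y) = c x * cos (k x) + s x * sin (k x) by [].
have one := cos2Dsin2 (k y).
apply: complex_ext; rewrite ?Re_mulc ?Im_mulc /= cosB sinB.
  transitivity ((c y * cos (k y) + s y * sin (k y)) * cos (k y) -
     (s y * cos (k y) - c y * sin (k y)) * sin (k y)); last by rewrite EP EQ; ring.
  by rewrite -[LHS]mulr1 -one; ring.
transitivity ((s y * cos (k y) - c y * sin (k y)) * cos (k y) +
   (c y * cos (k y) + s y * sin (k y)) * sin (k y)); last by rewrite EP EQ; ring.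
by rewrite -[LHS]mulr1 -one; ring.
Qed.

End Phase.

(** * Existence and uniqueness of horizontal lifts along a path *)

Section Lifts.
Variables (R : realType) (n : nat) (M : topologicalType).
Variable X : smooth_atlas R n M.
Variables (J : Type) (U : J -> set M).
Hypothesis oU : forall i, open (U i).
Hypothesis coverU : forall y, exists i, U i y.
Variable E : bundle_data X J.
Hypothesis HE : U1_bundle_with_connection U E.

Local Notation g := (transition E).
Local Notation A := (connection E).

(* A horizontal section along [p], given by its local representatives.
   Quantifying over all primitives makes the notion insensitive to the values
   of the integrand at the end points, and lets sections be glued. *)
Definition lift (p : R -> M) (a b : R) (sg : J -> R -> R[i]) : Prop :=
  [/\ forall i j x, a <= x <= b -> U i (p x) -> U j (p x) -> sg j x = sg i x * g i j (p x),
      forall i x, a <= x <= b -> U i (p x) -> `|sg i x| = 1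
    & forall i x y th, a <= x -> x <= y -> y <= b ->
        (forall s, x <= s <= y -> U i (p s)) -> primitive (pullback (A i) p) x y th ->
        sg i y = sg i x * expi (th y - th x)].

Lemma cocycle_id i y : U i y -> g i i y = 1.
Proof.
move=> Uy; have [Hg _ co _] := HE; have [_ n1 _] := Hg i i.
have := co i i i y Uy Uy Uy; rewrite -[RHS]mulr1; apply: mulfI.
by apply: norm1_neq0; apply: n1.
Qed.

Lemma pullback_ext (alpha : chart X -> M -> 'rV[R]_n) (p q : R -> M) (a b x : R) :
  a < x -> x < b -> (forall y, a < y -> y < b -> p y = q y) ->
  pullback alpha p x = pullback alpha q x.
Proof.
move=> ax xb pq; apply: (@pull_ext _ _ _ _ _ alpha [set y | a < y < b] p q (1 : R) x).
- rewrite (_ : [set y | a < y < b] = `]a, b[%classic); first exact: interval_open.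
  by apply/seteqP; split=> y; rewrite /= in_itv.
- by rewrite /= ax xb.
- by move=> y /= /andP[]; apply: pq.
Qed.

(** The derivative of [p] itself at an end of [[a, b]] is uncontrolled. The local extension [q]
    gives an integrand that is continuous there and agrees with that of [p] inside. *)
Lemma local_path p (a b x : R) i : smooth_map_within X `[a, b] p -> a <= x <= b ->
  U i (p x) -> exists2 d : R, 0 < d & exists q,
    [/\ smooth_map X (ball x d) q, forall y, ball x d y -> U i (q y),
        forall y, ball x d y -> a <= y <= b -> p y = q y &
        forall y, ball x d y -> {for y, continuous (pullback (A i) q)}].
Proof.
move=> Sp xab Ux; have [|N [q [oN Nx Sq Nq]]] := Sp x; first by rewrite /= in_itv.
have oN' := smooth_map_open oN Sq (oU i).
have N'x : (N `&` q @^-1` U i) x.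
  by split=> //=; rewrite -Nq//= in_itv.
have /nbhs_ballP [d /= d0 H] := open_nbhs_nbhs (conj oN' N'x).
exists d => //; exists q; split.
- by apply: smooth_map_sub Sq => y /H [].
- by move=> y /H [].
- by move=> y /H [Ny _] yab; apply: Nq => //; rewrite /= in_itv.
- move=> y yd; have [_ FA _ _] := HE.
  have SN : smooth_map X (N `&` q @^-1` U i) q by apply: smooth_map_sub Sq => z [].
  have := smooth_pull (oU i) (FA i) (1 : R) oN' SN (fun z Nz => proj2 Nz).
  by move=> /smooth_continuous; apply; apply: H.
Qed.

Lemma local_primitive p (a b x : R) i : smooth_map_within X `[a, b] p -> a <= x <= b ->
  U i (p x) -> exists2 d : R, 0 < d & forall y z, a <= y -> y <= z -> z <= b ->
    `|y - x| < d -> `|z - x| < d ->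
    (forall s, y <= s <= z -> U i (p s)) /\
    exists th, primitive (pullback (A i) p) y z th.
Proof.
move=> Sp xab Ux; have [d d0 [q [Sq Uq pq cq]]] := local_path Sp xab Ux.
exists d => // y z ay yz zb yx zx.
have B s : y <= s <= z -> ball x d s.
  move=> /andP[ys sz]; rewrite -ball_normE /ball_/= distrC.
  by move: yx zx; rewrite !ltr_norml => /andP[yx _] /andP[_ zx]; apply/andP; split; lra.
have ab s : y <= s <= z -> a <= s <= b.
  by move=> /andP[ys sz]; rewrite (le_trans ay ys) (le_trans sz zb).
split=> [s syz|]; first by rewrite pq ?ab//; [apply: Uq|]; apply: B.
have [|th pth _] := @primitive_exists _ (pullback (A i) q) y z yz.
  by apply: seg_continuous_at => s syz; apply: cq; apply: B.
exists th; apply: primitive_ext pth => s ys sz.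
apply: (pullback_ext _ ys sz) => t yt tz.
have tyz : y <= t <= z by rewrite !ltW.
by rewrite pq ?ab//; apply: B.
Qed.

(** The real and imaginary parts of the equation [g' = i beta g], which is (B2) multiplied by [g]
    and evaluated on the velocity of [q]. *)
Lemma is_derive_transition i j (N : set R) (q : R -> M) (s : R) :
  open N -> smooth_map X N q -> N s -> U i (q s) -> U j (q s) ->
  let beta := pullback (A j) q s - pullback (A i) q s in
  is_derive s 1 (fun r => complex.Re (g i j (q r))) (- beta * complex.Im (g i j (q s))) /\
  is_derive s 1 (fun r => complex.Im (g i j (q r))) (beta * complex.Re (g i j (q s))).
Proof.
move=> oN Sq Ns Us Vs beta; have [Hg FA _ B2] := HE.
have [_ n1 Sg] := Hg i j.
set c := chart_at X (q s); have cs : dom c (q s) by exact: chart_atP.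
have oD : open (U i `&` U j) by exact: openI.
have SR : smooth_function X (U i `&` U j) (fun y => complex.Re (g i j y)).
  by move=> c'; have [] := Sg c'.
have SI : smooth_function X (U i `&` U j) (fun y => complex.Im (g i j y)).
  by move=> c'; have [] := Sg c'.
have dR := is_derive_function (1 : R) oN oD Sq Ns cs (conj Us Vs) SR.
have dI := is_derive_function (1 : R) oN oD Sq Ns cs (conj Us Vs) SI.
have g0 : g i j (q s) != 0 by apply: norm1_neq0; apply: n1.
have K l : partial c l (fun y => complex.Re (g i j y)) (q s) =
    - (A j c (q s) 0 l - A i c (q s) 0 l) * complex.Im (g i j (q s)) /\
  partial c l (fun y => complex.Im (g i j y)) (q s) =
    (A j c (q s) 0 l - A i c (q s) 0 l) * complex.Re (g i j (q s)).
  have := B2 i j c (q s) Us Vs cs l; rewrite /dlog => H.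
  have {}H := congr1 (fun z => z * g i j (q s)) H; rewrite divfK in H => //.
  have HR := congr1 (@complex.Re R) H; have HI := congr1 (@complex.Im R) H.
  move: HR HI; rewrite Re_mulc Im_mulc /= => <- <-.
  by rewrite !mul0r sub0r add0r mulNr.
have Eb : beta = \sum_(l < n) (A j c (q s) 0 l - A i c (q s) 0 l) * ('D_1 (coord c \o q) s) 0 l.
  rewrite /beta (_ : pullback (A j) q s = \sum_(l < n) A j c (q s) 0 l * ('D_1 (coord c \o q) s) 0 l)//.
  rewrite (_ : pullback (A i) q s = \sum_(l < n) A i c (q s) 0 l * ('D_1 (coord c \o q) s) 0 l)//.
  by rewrite -sumrB; apply: eq_bigr => l _; rewrite mulrBl.
split; [apply: is_derive_eq dR _|apply: is_derive_eq dI _]; rewrite Eb.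
  rewrite -sumrN mulr_suml; apply: eq_bigr => l _; have [-> _] := K l; ring.
rewrite mulr_suml; apply: eq_bigr => l _; have [_ ->] := K l; ring.
Qed.

(** [phase_ode] solves the equation of [is_derive_transition]. The extension [q] is differentiated
    instead of [p] so that the equation also makes sense at the ends of the segment. *)
Lemma transition_transport i j (N : set R) (p q : R -> M) (x y : R) th th' : x <= y ->
  open N -> smooth_map X N q -> (forall s, x <= s <= y -> [/\ N s, p s = q s, U i (p s) & U j (p s)]) ->
  primitive (pullback (A i) p) x y th -> primitive (pullback (A j) p) x y th' ->
  g i j (p y) = g i j (p x) * expi ((th' y - th' x) - (th y - th x)).
Proof.
move=> xy oN Sq H pi_ pj.
have pb k s : x < s -> s < y -> pullback (A k) p s = pullback (A k) q s.
  move=> xs sy; apply: (pullback_ext _ xs sy) => t xt ty.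
  by have [|_ ->] := H t; rewrite ?ltW.
have pk := primitiveD pj (primitiveZ (-1) pi_).
have pk' : primitive (fun s => pullback (A j) q s - pullback (A i) q s) x y
    (fun s => th' s + -1 * th s).
  by apply: primitive_ext pk => s xs sy; rewrite mulN1r !pb.
have D s : x <= s <= y -> _ := fun sxy => match H s sxy with
  And4 Ns _ _ _ => @is_derive_transition i j N q s oN Sq Ns end.
have {}D s : x <= s <= y ->
  let beta := pullback (A j) q s - pullback (A i) q s in
  is_derive s 1 (fun r => complex.Re (g i j (q r))) (- beta * complex.Im (g i j (q s))) /\
  is_derive s 1 (fun r => complex.Im (g i j (q r))) (beta * complex.Re (g i j (q s))).
  by move=> sxy; apply: D => //; have [Ns <-] := H s sxy.
have xx : x <= x <= y by rewrite lexx.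
have yy : x <= y <= y by rewrite lexx andbT.
have [_ -> _ _] := H y yy; have [_ -> _ _] := H x xx.
have := @phase_ode R (fun s => complex.Re (g i j (q s))) (fun s => complex.Im (g i j (q s)))
   _ _ x y xy _ _ pk'.
have eta (z : R[i]) : (complex.Re z +i* complex.Im z)%C = z by case: z.
rewrite !eta => ->.
- by congr (_ * expi _); ring.
- split; last by move=> s xs sy; have [|] := D s; rewrite ?ltW.
  by apply: seg_continuous_at => s /D [d _]; apply: is_derive_continuous d.
- split; last by move=> s xs sy; have [|] := D s; rewrite ?ltW.
  by apply: seg_continuous_at => s /D [_ d]; apply: is_derive_continuous d.
Qed.

(** Local existence: inside one [U i] the phase [expi (th s)] is a lift in the label [i], and
    multiplication by [g i j] transfers it to the other labels. *)
Lemma line_lift i (N : set R) (p q : R -> M) (a b : R) th :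
  open N -> smooth_map X N q -> (forall s, a <= s <= b -> [/\ N s, p s = q s & U i (p s)]) ->
  primitive (pullback (A i) p) a b th ->
  lift p a b (fun j s => expi (th s) * g i j (p s)).
Proof.
move=> oN Sq H pth; have [Hg _ co _] := HE.
have Ui s : a <= s <= b -> U i (p s) by move=> /H [].
split=> [j k x xab Uj Uk|j x xab Uj|j x y th' ax xy yb Uj pth'].
- by rewrite -mulrA co//; apply: Ui.
- by have [_ n1 _] := Hg i j; rewrite normrM norm_expi n1 ?mul1r//; apply: Ui.
- have pth2 := primitive_sub ax yb pth.
  rewrite (@transition_transport i j N p q x y th th' xy oN Sq) => // [|s sxy].
    have -> : expi (th y) = expi (th x) * expi (th y - th x) by rewrite -expiD subrKC.
    rewrite mulrACA -expiD.
    by congr (_ * expi _); ring.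
  have sab : a <= s <= b.
    by move: sxy => /andP[xs sy]; rewrite (le_trans ax xs) (le_trans sy yb).
  by have [Ns pq Us] := H s sab; split=> //; apply: Uj.
Qed.

Lemma lift_ext p q (a b : R) sg : (forall x, a <= x <= b -> p x = q x) ->
  lift p a b sg -> lift q a b sg.
Proof.
move=> pq [L1 L2 L3]; split=> [i j x xab|i x xab|i x y th ax xy yb Uq pth].
- by rewrite -pq//; apply: L1.
- by rewrite -pq//; apply: L2.
have ab s : x <= s <= y -> a <= s <= b.
  by move=> /andP[xs sy]; rewrite (le_trans ax xs) (le_trans sy yb).
apply: (L3 i x y th ax xy yb) => [s sxy|]; first by rewrite pq ?ab//; apply: Uq.
apply: primitive_ext pth => s xs sy; apply: (pullback_ext _ xs sy) => t xt ty.
by rewrite pq// ab// !ltW.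
Qed.

Lemma lift_sub p (a b a' b' : R) sg : a <= a' -> b' <= b -> lift p a b sg -> lift p a' b' sg.
Proof.
move=> aa bb [L1 L2 L3].
have ab s : a' <= s <= b' -> a <= s <= b.
  by move=> /andP[xs sy]; rewrite (le_trans aa xs) (le_trans sy bb).
split=> [i j x /ab|i x /ab|i x y th ax xy yb]; [exact: L1|exact: L2|].
by apply: L3 => //; [apply: le_trans ax|apply: le_trans bb].
Qed.

Lemma lift_scale p (a b : R) sg k : `|k| = 1 -> lift p a b sg ->
  lift p a b (fun i s => k * sg i s).
Proof.
move=> k1 [L1 L2 L3]; split=> [i j x xab Ui Uj|i x xab Ui|i x y th ax xy yb Ui pth].
- by rewrite (L1 i j)// mulrA.
- by rewrite normrM k1 L2// mul1r.
- by rewrite (L3 i x y th)// mulrA.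
Qed.

Lemma lift_glue p (a m b : R) sg sg' : a <= m -> m <= b -> lift p a m sg -> lift p m b sg' ->
  (forall i, U i (p m) -> sg i m = sg' i m) ->
  lift p a b (fun i s => if s <= m then sg i s else sg' i s).
Proof.
move=> am mb [L1 L2 L3] [K1 K2 K3] sm.
split=> [i j x /andP[ax xb] Ui Uj|i x /andP[ax xb] Ui|i x y th ax xy yb Ui pth].
- case: leP => xm; first by apply: L1 => //; rewrite ax.
  by apply: K1 => //; rewrite (ltW xm).
- by case: leP => xm; [apply: L2; rewrite ?ax|apply: K2; rewrite ?(ltW xm)].
have [ym|my] := leP y m; first by rewrite (le_trans xy ym); apply: L3.
have [xm|mx] := leP x m; last by apply: K3 => //; apply: ltW.
have mxy : x <= m <= y by rewrite xm ltW.
have pmy : primitive (pullback (A i) p) m y th by apply: primitive_sub pth.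
have pxm : primitive (pullback (A i) p) x m th by apply: primitive_sub (ltW my) pth.
have Umy s : m <= s <= y -> U i (p s).
  by move=> /andP[ms sy]; apply: Ui; rewrite sy (le_trans xm ms).
have Uxm s : x <= s <= m -> U i (p s).
  by move=> /andP[xs sm']; apply: Ui; rewrite xs (le_trans sm' (ltW my)).
rewrite (K3 i m y th (lexx m) (ltW my) yb Umy pmy) -sm; last exact: Ui.
rewrite (L3 i x m th ax xm (lexx m) Uxm pxm).
by rewrite -mulrA -expiD; congr (_ * expi _); ring.
Qed.

(** The ratio of two lifts does not depend on the label, since the transition functions cancel, and
    it is locally constant, since both lifts acquire the same phase. *)
Lemma lift_unique p (a b : R) sg sg' : a <= b -> smooth_map_within X `[a, b] p ->
  lift p a b sg -> lift p a b sg' ->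
  exists2 k, `|k| = 1 & forall i x, a <= x <= b -> U i (p x) -> sg' i x = k * sg i x.
Proof.
move=> ab Sp L L'; have [L1 L2 L3] := L; have [K1 K2 K3] := L'.
have lab i j x : a <= x <= b -> U i (p x) -> U j (p x) -> sg' i x / sg i x = sg' j x / sg j x.
  move=> xab Ui Uj; rewrite (L1 i j x)// (K1 i j x)// mulrC invfM mulrACA.
  by rewrite divff ?mulr1 1?mulrC// norm1_neq0//; have [Hg _ _ _] := HE; have [_ n1 _] := Hg i j; apply: n1.
(* The predicate covers every [s] of the interval and not only its right end, so that [P a b] fixes
   the ratio along the whole path. *)
pose P (x y : R) := forall i j s, x <= s <= y -> U i (p x) -> U j (p s) ->
   sg' i x / sg i x = sg' j s / sg j s.
have Pab : P a b.
  apply: interval_induction => // [x y z ax xy yz zb Pxy Pyz i j s /andP[xs sz] Ui Uj|x xab].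
    have [sy|/ltW ys] := leP s y; first by apply: Pxy; rewrite ?xs.
    have [m Um] := coverU (p y).
    rewrite (Pxy i m y) ?xy ?lexx//; apply: Pyz => //.
    by rewrite ys sz.
  have [m Um] := coverU (p x); have [d d0 H] := local_primitive Sp xab Um.
  exists d => // y z ay yz zb yx zx i j s /andP[ys sz] Ui Uj.
  have [UU [th pth]] := H y z ay yz zb yx zx.
  have yab : a <= y <= b by rewrite ay (le_trans yz zb).
  have sab : a <= s <= b by rewrite (le_trans ay ys) (le_trans sz zb).
  have Uy : U m (p y) by apply: UU; rewrite lexx yz.
  have Us : U m (p s) by apply: UU; rewrite ys sz.
  rewrite (lab i m y)// (lab j m s)//.
  have Uys t : y <= t <= s -> U m (p t) by move=> /andP[yt ts]; apply: UU; rewrite yt (le_trans ts sz).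
  have pys : primitive (pullback (A m) p) y s th by apply: primitive_sub pth.
  have sb := le_trans sz zb.
  rewrite (L3 m y s th)// (K3 m y s th)// invfM mulrACA divff ?mulr1//.
  exact: expi_neq0.
have aab : a <= a <= b by rewrite lexx.
have [m Um] := coverU (p a).
exists (sg' m a / sg m a) => [|i x xab Ui].
  by rewrite normrM normfV L2 ?K2// invr1 mulr1.
by rewrite (Pab m i x)// divfK// norm1_neq0// L2.
Qed.

(** Two adjacent lifts are glued after the second is multiplied by their ratio at the junction;
    matching in one label there forces matching in all labels. *)
Lemma lift_exists p (a b : R) : a <= b -> smooth_map_within X `[a, b] p ->
  exists sg, lift p a b sg.
Proof.
move=> ab Sp; pose P x y := exists sg, lift p x y sg.
apply: (interval_induction (P := P) ab) => [x y z ax xy yz zb [sg L] [sg' L']|x xab].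
  have [m Um] := coverU (p y); have [L1 L2 L3] := L; have [K1 K2 K3] := L'.
  have yxy : x <= y <= y by rewrite lexx xy.
  have yyz : y <= y <= z by rewrite lexx yz.
  have k1 : `|sg m y / sg' m y| = 1 by rewrite normrM normfV L2 ?K2// invr1 mulr1.
  eexists; apply: (lift_glue xy yz L (lift_scale k1 L')) => i Ui.
  rewrite (L1 m i)// (K1 m i)// mulrA divfK// norm1_neq0//.
  exact: K2.
have [m Um] := coverU (p x); have [d d0 H] := local_primitive Sp xab Um.
have [d' d'0 [q [Sq Uq pq cq]]] := local_path Sp xab Um.
exists (Num.min d d'); first by rewrite lt_min d0.
move=> y z ay yz zb; rewrite !lt_min => /andP[yd yd'] /andP[zd zd'].
have [UU [th pth]] := H y z ay yz zb yd zd.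
eexists; apply: (@line_lift m (ball x d') p q y z th) => //; first exact: ball_open.
move=> s syz; have Bs : ball x d' s.
  move: syz => /andP[ys sz]; rewrite -ball_normE /ball_/= distrC.
  by move: yd' zd'; rewrite !ltr_norml => /andP[yx _] /andP[_ zx]; apply/andP; split; lra.
split=> //; last exact: UU.
by apply: pq => //; move: syz => /andP[ys sz]; rewrite (le_trans ay ys) (le_trans sz zb).
Qed.

End Lifts.

Section Segments.
Variables (R : realType) (J : Type).

Lemma all_segments_lt (a b : R) (i : J) s :
  all_segments (fun x y _ => x < y) a i s b -> a < b.
Proof.
elim: s a i => [|[x j] s IH] a i //= [ax /IH xb].
exact: lt_trans xb.
Qed.

Lemma all_segments_first (U : R -> J -> Prop) (a b : R) (i : J) s :
  all_segments (fun x y _ => x < y) a i s b ->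
  all_segments (fun x y i => forall z, x <= z <= y -> U z i) a i s b -> U a i.
Proof.
case: s => [|[x j] s] /=; first by move=> ab; apply; rewrite lexx ltW.
by move=> [ax _] [H _]; apply: H; rewrite lexx ltW.
Qed.

Lemma all_segments_last (U : R -> J -> Prop) (a b : R) (i : J) s :
  all_segments (fun x y _ => x < y) a i s b ->
  all_segments (fun x y i => forall z, x <= z <= y -> U z i) a i s b ->
  U b (last i [seq q.2 | q <- s]).
Proof.
elim: s a i => [|[x j] s IH] a i /=; first by move=> ab; apply; rewrite lexx ltW.
by move=> [ax xs] [_ H]; apply: IH H.
Qed.

End Segments.

(** * Holonomy of labelled paths and the TQFT axioms *)

Section Holonomy.
Variables (R : realType) (n : nat) (M : topologicalType).
Variable X : smooth_atlas R n M.
Variables (J : Type) (U : J -> set M).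
Hypothesis oU : forall i, open (U i).
Hypothesis coverU : forall y, exists i, U i y.
Variable E : bundle_data X J.
Hypothesis HE : U1_bundle_with_connection U E.

Local Notation g := (transition E).
Local Notation A := (connection E).

Lemma smooth_path_within (p : R -> M) (D : set R) : smooth_map X setT p ->
  smooth_map_within X D p.
Proof. by move=> Sp x Dx; exists setT, p; split=> //; exact: openT. Qed.

Lemma pullback_continuous (p : R -> M) i (x : R) : smooth_map X setT p -> U i (p x) ->
  {for x, continuous (pullback (A i) p)}.
Proof.
move=> Sp Ux; have oN := smooth_map_open openT Sp (oU i); have [_ FA _ _] := HE.
have SN : smooth_map X (setT `&` p @^-1` U i) p by apply: smooth_map_sub Sp.
have := smooth_pull (oU i) (FA i) (1 : R) oN SN (fun z Nz => proj2 Nz).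
by move=> /smooth_continuous; apply.
Qed.

(** Each exponential transports the lift across a segment in a fixed label, and each transition
    factor changes the label at a partition point. The lift does not see the partition, so
    identities between holonomies become identities between end values. *)
Lemma holonomy_lift (p : R -> M) (a b : R) i s sg : smooth_map X setT p ->
  all_segments (fun x y _ => x < y) a i s b ->
  all_segments (fun x y i => forall z, x <= z <= y -> U i (p z)) a i s b ->
  lift U E p a b sg ->
  sg (last i [seq q.2 | q <- s]) b = sg i a * holonomy E p a i s b.
Proof.
move=> Sp.
have phase x y k sg' : x < y -> (forall z, x <= z <= y -> U k (p z)) -> lift U E p x y sg' ->
    sg' k y = sg' k x * expi (\int[lebesgue_measure]_(t in `[x, y]) pullback (A k) p t).
  move=> xy Uk [_ _ L3].
  have [|th pth ->] := @primitive_exists _ (pullback (A k) p) x y (ltW xy).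
    by apply: seg_continuous_at => z xzy; apply: pullback_continuous => //; apply: Uk.
    by apply: (L3 k x y th _ _ _ Uk pth); rewrite ?lexx// ltW.
  by rewrite lexx ltW.
elim: s a i sg => [|[x j] s IH] a i sg /=; first exact: phase.
move=> [ax xs] [Ui Us] L; have xb := all_segments_lt xs.
rewrite (IH x j sg xs Us); last exact: lift_sub (ltW ax) (lexx b) L.
have Lx := lift_sub (lexx a) (ltW xb) L.
have Ujx := all_segments_first (U := fun z k => U k (p z)) xs Us.
have [L1 _ _] := L; rewrite (L1 i j x)//; last 2 first.
- by rewrite !ltW.
- by apply: Ui; rewrite lexx ltW.
by rewrite (phase _ _ _ _ ax Ui Lx) !mulrA.
Qed.

Lemma object_lt (O : object X U) : start O < stop O.
Proof. exact: all_segments_lt (partition_increasing O). Qed.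

Lemma object_first (O : object X U) : U (first_label O) (O (start O)).
Proof.
exact: (all_segments_first (U := fun z k => U k (O z)) (partition_increasing O)
  (partition_subordinate O)).
Qed.

Lemma object_last (O : object X U) : U (last_label O) (O (stop O)).
Proof.
exact: (all_segments_last (U := fun z k => U k (O z)) (partition_increasing O)
  (partition_subordinate O)).
Qed.

Definition hol (O : object X U) : R[i] :=
  holonomy E O (start O) (first_label O) (breaks O) (stop O).

Lemma object_holonomy (O : object X U) sg : lift U E O (start O) (stop O) sg ->
  sg (last_label O) (stop O) = sg (first_label O) (start O) * hol O.
Proof.
apply: holonomy_lift; [exact: path_smooth|exact: partition_increasing|].
exact: partition_subordinate.
Qed.

Lemma object_lift (O : object X U) : exists sg, lift U E O (start O) (stop O) sg.
Proof.
apply: lift_exists => //; first exact/ltW/object_lt.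
by apply: smooth_path_within; apply: path_smooth.
Qed.

Lemma norm_hol (O : object X U) : `|hol O| = 1.
Proof.
have [sg L] := object_lift O; have := object_holonomy L; have [_ L2 _] := L.
have ab := ltW (object_lt O).
move=> /(congr1 (@Num.norm _ _)).
rewrite normrM !L2 ?lexx ?ab ?mul1r//; [exact: object_first|exact: object_last].
Qed.

Lemma transition_conj i j y : U i y -> U j y -> (g i j y)^* = g j i y.
Proof.
move=> Ui Uj; have [Hg _ co _] := HE; have [_ n1 _] := Hg i j.
have n1y := n1 y Ui Uj.
have : g j i y * g i j y = 1 by rewrite co// (cocycle_id HE).
rewrite -(norm1_conj n1y) => /(mulIf (norm1_neq0 n1y)) H.
exact/esym.
Qed.

Lemma smooth_within_interior (f : R -> R) (a b x : R) : smooth_within `[a, b] f ->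
  a < x -> x < b -> is_derive x 1 f ('D_1 f x).
Proof.
move=> Sf ax xb; have [|N [k [oN Nx Sk Nk]]] := Sf x.
  by rewrite /= in_itv/= !ltW.
have o : open (N `&` `]a, b[%classic) by apply: openI => //; exact: interval_open.
have Ox : (N `&` `]a, b[%classic) x by split=> //=; rewrite in_itv/= ax.
have d : is_derive x 1 f ('D_1 k x).
  apply: (is_derive_ext (f := k) o Ox); last exact: (smooth_is_derive (1 : R) Sk Nx).
  move=> y [Ny].
  by rewrite /= in_itv/= => /andP[ay yb]; rewrite Nk//= in_itv/= !ltW.
by have [d1 _] := d; apply: derivableP.
Qed.

Lemma smooth_within_seg_continuous (f : R -> R) (a b : R) : smooth_within `[a, b] f ->
  seg_continuous a b f.
Proof.
move=> Sf x xab e e0; have [|N [k [oN Nx Sk Nk]]] := Sf x; first by rewrite /= in_itv.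
have /cvgrPdist_lt /(_ _ e0) ck := smooth_continuous Sk Nx.
have : \forall y \near x, N y /\ `|k x - k y| < e.
  by near=> y; split; near: y => //; apply: open_nbhs_nbhs.
move=> /nbhs_ballP [d /= d0 H]; exists d => // y yab yx.
have [|Ny ky] := H y; first by rewrite -ball_normE /ball_/= distrC.
by rewrite !Nk ?in_itv//= distrC.
Unshelve. all: by end_near. Qed.

(** If [th] is a primitive along [p], then [th \o h] is one along [q], where [h] inverts [f]: the
    two factors brought in by the chain rule satisfy [f' * h' = 1], from [f \o h = id]. *)
Lemma lift_reparam (p q : R -> M) (a b a' b' : R) f sg : smooth_map X setT q ->
  increasing_diffeo a b a' b' f ->
  (forall x, a <= x <= b -> p x = q (f x)) -> lift U E q a' b' sg ->
  lift U E p a b (fun i s => sg i (f s)).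
Proof.
move=> Sq [h [Sf Sh fP hP mono]] pq [L1 L2 L3].
split=> [i j x xab|i x xab|i x y th ax xy yb Ui pth].
- by have [fab _] := fP x xab; rewrite pq//; apply: L1.
- by have [fab _] := fP x xab; rewrite pq//; apply: L2.
have [<-|xy'] := eqVneq x y; first by rewrite !subrr expi0 mulr1.
have {xy'}xy1 : x < y by rewrite lt_neqAle xy'.
have xb := le_trans xy yb; have ay := le_trans ax xy.
have xab : a <= x <= b by rewrite ax.
have yab : a <= y <= b by rewrite ay.
have [/andP[afx fxb] hfx] := fP x xab; have [/andP[afy fyb] hfy] := fP y yab.
have mle s t : a <= s -> s <= t -> t <= b -> f s <= f t.
  move=> as_ st tb; have [->//|ne] := eqVneq s t.
  by apply/ltW/mono => //; rewrite lt_neqAle ne.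
have hin u : f x <= u <= f y -> x <= h u <= y.
  move=> /andP[xu uy]; have uab : a' <= u <= b' by rewrite (le_trans afx xu) (le_trans uy fyb).
  have [/andP[ahu hub] fhu] := hP u uab.
  apply/andP; split; rewrite leNgt; apply/negP => lt.
    by have := mono _ _ ahu lt xb; rewrite fhu ltNge xu.
  by have := mono _ _ ay lt hub; rewrite fhu ltNge uy.
have hino u : f x < u -> u < f y -> x < h u < y.
  move=> xu uy; have /hin/andP[h1 h2] : f x <= u <= f y by rewrite !ltW.
  have uab : a' <= u <= b' by rewrite (le_trans afx (ltW xu)) (le_trans (ltW uy) fyb).
  have [_ fhu] := hP u uab.
  rewrite !lt_neqAle h1 h2 !andbT; apply/andP; split; apply/eqP => e.
    by move: xu; rewrite -fhu -e ltxx.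
  by move: uy; rewrite -fhu e ltxx.
rewrite -[X in expi (th X - _)]hfy -[X in expi (_ - th X)]hfx.
apply: (L3 i (f x) (f y) (th \o h)) => //; first exact: mle.
  move=> u uxy; have uab : a' <= u <= b'.
    by move: uxy => /andP[xu uy]; rewrite (le_trans afx xu) (le_trans uy fyb).
  have [huab fhu] := hP u uab; rewrite -fhu -pq//.
  by apply: Ui; apply: hin.
have [cth dth] := pth; split.
  have ch := smooth_within_seg_continuous Sh.
  move=> u uxy e e0; have [d d0 H] := cth (h u) (hin u uxy) e e0.
  have [|d' d'0 H'] := ch u _ d d0.
    by move: uxy => /andP[xu uy]; rewrite (le_trans afx xu) (le_trans uy fyb).
  exists d' => // v vxy vu; apply: H; first exact: hin.
  apply: H' => //.
  by move: vxy => /andP[xv vy]; rewrite (le_trans afx xv) (le_trans vy fyb).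
move=> u xu uy; have /andP[xh hy] := hino u xu uy.
have au := le_lt_trans afx xu; have ub := lt_le_trans uy fyb.
have dh := smooth_within_interior Sh au ub.
have df := smooth_within_interior Sf (le_lt_trans ax xh) (lt_le_trans hy yb).
have [_ fhu] : a <= h u <= b /\ f (h u) = u by apply: hP; rewrite !ltW.
apply: is_derive_eq (is_derive1_comp (dth _ xh hy) dh) _.
rewrite (@pullback_ext _ _ _ _ _ p (q \o f) x y)//; last first.
  by move=> t xt ty; rewrite /= pq// (le_trans ax (ltW xt)) (le_trans (ltW ty) yb).
rewrite (pullback_comp (N := setT) _ openT Sq _ df)// fhu mulrAC.
suff -> : 'D_1 f (h u) * 'D_1 h u = 1 by rewrite mul1r.
have d1 := is_derive1_comp df dh.
have d2 : is_derive u 1 (f \o h) 1.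
  apply: (is_derive_ext (O := `]a', b'[%classic) (f := id)) (is_derive_id u 1).
  - exact: interval_open.
  - by rewrite /= in_itv/= au ub.
  - by move=> v; rewrite /= in_itv/= => /andP[av vb]; have [|_ ->] := hP v; rewrite ?ltW.
by have [_ <-] := d1; have [_ ->] := d2.
Qed.

(** Along [O] there are two lifts: one of its own, and that of [O'] composed with [f]. They differ
    by a constant, which cancels between the two ends and leaves the changes of label there. *)
Lemma hol_reparam (O O' : object X U) f :
  increasing_diffeo (start O) (stop O) (start O') (stop O') f ->
  (forall x, start O <= x <= stop O -> O x = O' (f x)) ->
  hol O' = (g (first_label O) (first_label O') (O (start O)))^* * hol O *
           g (last_label O) (last_label O') (O (stop O)).
Proof.
move=> df Of; have ab := object_lt O; have ab' := object_lt O'.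
have [sg L] := object_lift O; have [sg' L'] := object_lift O'.
have Lf := lift_reparam (path_smooth O') df Of L'.
have SO : smooth_map_within X `[start O, stop O] O.
  by apply: smooth_path_within; apply: path_smooth.
have [k k1 Hk] := lift_unique oU coverU HE (ltW ab) SO L Lf.
have [h [_ _ fP hP mono]] := df.
have aab : start O <= start O <= stop O by rewrite lexx ltW.
have bab : start O <= stop O <= stop O by rewrite lexx ltW.
have aab' : start O' <= start O' <= stop O' by rewrite lexx ltW.
have bab' : start O' <= stop O' <= stop O' by rewrite lexx ltW.
(* An increasing bijection of closed intervals matches their end points; axiom (ii) compares labels
   at these points. *)
have fa : f (start O) = start O'.
  apply/eqP; rewrite eq_le; have [/andP[-> _] _] := fP _ aab; rewrite andbT.
  have [/andP[h1 h2] h3] := hP _ aab'.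
  have [e|ne] := eqVneq (start O) (h (start O')); first by rewrite e h3.
  by rewrite -h3 ltW// mono// ?lexx// lt_neqAle ne.
have fb : f (stop O) = stop O'.
  apply/eqP; rewrite eq_le; have [/andP[_ ->] _] := fP _ bab; rewrite andTb.
  have [/andP[h1 h2] h3] := hP _ bab'.
  have [e|ne] := eqVneq (h (stop O')) (stop O); first by rewrite -e h3.
  by rewrite -h3 ltW// mono// ?lexx// lt_neqAle ne.
have Oa : O (start O) = O' (start O') by rewrite Of// fa.
have Ob : O (stop O) = O' (stop O') by rewrite Of// fb.
have U1 := object_first O; have U1' := object_first O'.
have U2 := object_last O; have U2' := object_last O'.
have [L1 L2 _] := L; have [K1 K2 _] := L'.
have H' := object_holonomy L'; have H := object_holonomy L.
have s0 : sg' (first_label O') (start O') != 0 by apply: norm1_neq0; apply: K2.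
apply: (mulfI s0); rewrite -H' -fb Hk//; last by rewrite Ob.
rewrite (L1 (last_label O))//; last by rewrite Ob.
rewrite H transition_conj//; last by rewrite Oa.
rewrite !mulrA; congr (_ * _ * _).
rewrite -Hk// fa Oa; apply: K1 => //.
by rewrite -Oa.
Qed.

(** One lift along the concatenation restricts to both pieces; the middle factor is its change of
    label at the junction. *)
Lemma hol_concatenation (O O' OO' : object X U) : concatenation O O' OO' ->
  hol OO' = hol O * g (last_label O) (first_label O') (O (stop O)) * hol O'.
Proof.
move=> [ss pp [sa sb fl br] eO eO'].
have [sg L] := object_lift OO'; have H := object_holonomy L.
have ab := object_lt O; have ab' := object_lt O'; rewrite ss in ab'.
have LO : lift U E O (start O) (stop O) sg.
  apply: (lift_ext (p := OO')) => //; apply: lift_sub L; rewrite ?sa//.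
  by rewrite sb ltW.
have LO' : lift U E O' (start O') (stop O') sg.
  apply: (lift_ext (p := OO')) => //; apply: lift_sub L; rewrite ?sb//.
  by rewrite sa ss ltW.
have HO := object_holonomy LO; have HO' := object_holonomy LO'.
have ll : last_label OO' = last_label O'.
  by rewrite /last_label /later_labels br map_cat last_cat.
rewrite ll fl sa sb in H.
have [L1 L2 _] := LO.
have s0 : sg (first_label O) (start O) != 0.
  by apply: norm1_neq0; apply: L2; [rewrite lexx ltW|exact: object_first].
apply: (mulfI s0); rewrite -H HO' ss mulrA mulrA -HO; congr (_ * _).
apply: L1; [by rewrite lexx ltW|exact: object_last|].
by rewrite pp; apply: object_first.
Qed.

Lemma tqft_axioms : rank1_embedded_tqft (@tqft_of_bundle R n M X J U E).
Proof.
have [Hg _ co _] := HE; split=> /=.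
- split=> [e i j y nU|e i j y Ui Uj|O]; last exact: norm_hol.
    by have [z _ _] := Hg i j; case: e; rewrite z// conjC0.
  by have [_ n1 _] := Hg i j; case: e; rewrite ?norm_conjC; apply: n1.
- by move=> [] i j k y Ui Uj Uk; rewrite -?rmorphM co.
- exact: hol_reparam.
- exact: hol_concatenation.
Qed.

End Holonomy.

(** * Thin invariance and smoothness *)

Section PlaneMaps.
Variables (R : realType) (n : nat) (M : topologicalType).
Variable X : smooth_atlas R n M.

Lemma hline (s t : R) : (s, t) = (0, t) + s *: (1, 0) :> R * R.
Proof. by apply: injective_projections; rewrite /= ?add0r ?scaler0 ?addr0// [_ *: _]mulr1. Qed.

Lemma vline (s t : R) : (s, t) = (s, 0) + t *: (0, 1) :> R * R.
Proof. by apply: injective_projections; rewrite /= ?add0r ?scaler0 ?addr0// [_ *: _]mulr1. Qed.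

Lemma smooth_pair_comp (V : normedModType R) (O : set V) (N : set (R * R))
    (f : R * R -> R) (u v : V -> R) : open O -> open N -> (forall x, O x -> N (u x, v x)) ->
  smooth O u -> smooth O v -> smooth N f -> smooth O (fun x => f (u x, v x)).
Proof.
move=> oO oN ON Su Sv Sf.
apply: (smooth_comp_coord (coordinates_prod (@coordinates_line R) (@coordinates_line R))
  oO oN (f := fun x => (u x, v x)) ON _ Sf).
by case.
Qed.

Lemma smooth_map_pair_comp (V : normedModType R) (O : set V) (N : set (R * R))
    (h : R * R -> M) (u v : V -> R) : open O -> open N -> (forall x, O x -> N (u x, v x)) ->
  smooth O u -> smooth O v -> smooth_map X N h -> smooth_map X O (fun x => h (u x, v x)).
Proof.
move=> oO oN ON Su Sv Sf.
apply: (smooth_map_comp (coordinates_prod (@coordinates_line R) (@coordinates_line R))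
  oO oN (f := fun x => (u x, v x)) ON _ Sf).
by case.
Qed.

Lemma continuous_pair (T : topologicalType) (u v : T -> R) x :
  {for x, continuous u} -> {for x, continuous v} -> {for x, continuous (fun y => (u y, v y))}.
Proof.
move=> cu cv.
exact: (@cvg_pair _ _ _ (nbhs x) (nbhs (u x)) (nbhs (v x)) _ _ _ u v).
Qed.

Lemma open_pair (T : topologicalType) (N : set (R * R)) (u v : T -> R) :
  open N -> continuous u -> continuous v -> open [set x | N (u x, v x)].
Proof.
move=> oN cu cv; apply: (open_comp (f := fun x => (u x, v x))) oN => x _.
by apply: continuous_pair; [apply: cu|apply: cv].
Qed.

Definition box (a b c d : R) : set (R * R) := `[a, b] `*` `[c, d].

Lemma boxP a b c d s t : box a b c d (s, t) <-> a <= s <= b /\ c <= t <= d.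
Proof. by rewrite /box /setX /= !in_itv. Qed.

Lemma smooth_within_hline H a b c d (t : R) : smooth_map_within X (box a b c d) H ->
  c <= t <= d -> smooth_map_within X `[a, b] (fun s => H (s, t)).
Proof.
move=> SH tcd s; rewrite /= in_itv/= => sab.
have [|N [h [oN Nz Sh Nh]]] := SH (s, t); first exact/boxP.
have oN1 : open [set s : R | N (s, t)].
  by apply: open_pair => // x; [apply: cvg_id|apply: cst_continuous].
exists [set s | N (s, t)], (fun s => h (s, t)); split=> //.
  apply: smooth_map_pair_comp Sh => //; [exact: smooth_id|exact: smooth_cst].
by move=> y Ny; rewrite /= in_itv/= => yab; apply: Nh => //; apply/boxP.
Qed.

Lemma smooth_within_vline H a b c d (s : R) : smooth_map_within X (box a b c d) H ->
  a <= s <= b -> smooth_map_within X `[c, d] (fun t => H (s, t)).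
Proof.
move=> SH sab t; rewrite /= in_itv/= => tcd.
have [|N [h [oN Nz Sh Nh]]] := SH (s, t); first exact/boxP.
have oN1 : open [set t : R | N (s, t)].
  by apply: open_pair => // x; [apply: cst_continuous|apply: cvg_id].
exists [set t | N (s, t)], (fun t => h (s, t)); split=> //.
  apply: smooth_map_pair_comp Sh => //; [exact: smooth_cst|exact: smooth_id].
by move=> y Ny; rewrite /= in_itv/= => yab; apply: Nh => //; apply/boxP.
Qed.

Lemma primitive_shift (f th th' : R -> R) (a b k : R) :
  (forall x, a <= x <= b -> th' x = k + th x) -> primitive f a b th -> primitive f a b th'.
Proof.
move=> e [c d]; split=> [x xab eps eps0|x ax xb].
  have [dl dl0 H] := c x xab eps eps0; exists dl => // y yab yx.
  by rewrite !e// opprD addrACA subrr add0r; apply: H.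
apply: (is_derive_ext (O := `]a, b[%classic) (f := fun x => k + th x)).
- exact: interval_open.
- by rewrite /= in_itv/= ax.
- by move=> y; rewrite /= in_itv/= => /andP[ay yb]; rewrite e// !ltW.
- by rewrite -[f x]add0r; apply: is_deriveD; apply: d.
Qed.

End PlaneMaps.

(** * Lifts over a rectangle and thin invariance *)

Section Thin.
Variables (R : realType) (n : nat) (M : topologicalType).
Variable X : smooth_atlas R n M.
Variables (J : Type) (U : J -> set M).
Hypothesis oU : forall i, open (U i).
Hypothesis coverU : forall y, exists i, U i y.
Variable E : bundle_data X J.
Hypothesis HE : U1_bundle_with_connection U E.

Local Notation g := (transition E).
Local Notation A := (connection E).

(** Local Poincare lemma: integrate [a1] along the line [t = t0], then [a2] vertically. Closedness
    is known only inside the box, where the rank condition holds, so the horizontal statement is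
    restricted to it. *)
Lemma square_potential (a1 a2 : R * R -> R) (a b c d s0 t0 r : R) :
  smooth (ball (s0, t0) r) a1 -> smooth (ball (s0, t0) r) a2 -> 0 < r ->
  a <= s0 <= b -> c <= t0 <= d ->
  (forall s t : R, ball (s0, t0) r (s, t) -> a <= s <= b -> c <= t <= d ->
     'D_(0, 1) a1 (s, t) = 'D_(1, 0) a2 (s, t)) ->
  exists Th : R -> R -> R,
   (forall s c' d', `|s - s0| < r / 2 -> `|c' - t0| < r / 2 -> `|d' - t0| < r / 2 ->
      primitive (fun t => a2 (s, t)) c' d' (fun t => Th s t)) /\
   (forall t a' b', c <= t <= d -> a <= a' -> b' <= b -> `|t - t0| < r / 2 ->
      `|a' - s0| < r / 2 -> `|b' - s0| < r / 2 ->
      primitive (fun s => a1 (s, t)) a' b' (fun s => Th s t)).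
Proof.
move=> S1 S2 r0 s0ab t0cd closed; have r20 : 0 < r / 2 by rewrite divr_gt0.
set B : set (R * R) := ball (s0, t0) r in S1 S2 closed *.
have oB : open B by exact: ball_open.
have BP s t : `|s - s0| < r -> `|t - t0| < r -> B (s, t).
  by move=> sr tr; split; rewrite /= -ball_normE /ball_/= distrC.
have lt_r x : x < r / 2 -> x < r by move=> xr; lra.
have abs_in (x x0 : R) : x0 - r / 2 <= x <= x0 + r / 2 -> `|x - x0| < r.
  by move=> xr; rewrite ltr_norml; lra.
have slice1 (s t : R) : B (s, t) -> is_derive s 1 (fun s => a2 (s, t)) ('D_(1, 0) a2 (s, t)).
  move=> Bst; have := smooth_is_derive ((1, 0) : R * R) S2 Bst; rewrite {1}hline => /is_derive_line.
  by under eq_fun do rewrite -hline.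
have slice2 (s t : R) : B (s, t) -> is_derive t 1 (fun t => a1 (s, t)) ('D_(0, 1) a1 (s, t)).
  move=> Bst; have := smooth_is_derive ((0, 1) : R * R) S1 Bst; rewrite {1}vline => /is_derive_line.
  by under eq_fun do rewrite -vline.
have cont (f : R * R -> R) (s t : R) : smooth B f -> B (s, t) ->
    {for t, continuous (fun t => f (s, t))}.
  move=> Sf Bst; apply: (continuous_comp (f := fun t => (s, t)) (g := f)).
    by apply: continuous_pair; [apply: cst_continuous|apply: cvg_id].
  exact: smooth_continuous Sf Bst.
have conth (f : R * R -> R) (s t : R) : smooth B f -> B (s, t) ->
    {for s, continuous (fun s => f (s, t))}.
  move=> Sf Bst; apply: (continuous_comp (f := fun s => (s, t)) (g := f)).
    by apply: continuous_pair; [apply: cvg_id|apply: cst_continuous].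
  exact: smooth_continuous Sf Bst.
have lr (x : R) : x - r / 2 <= x + r / 2 by lra.
have [|al pal _] := @primitive_exists _ (fun s => a1 (s, t0)) _ _ (lr s0).
  apply: seg_continuous_at => s sr; apply: conth => //.
  by apply: BP; [apply: abs_in|rewrite subrr normr0].
pose P s t := \int[lebesgue_measure]_(tau in `[0, 1]) ((t - t0) * a2 (s, t0 + tau * (t - t0))).
have mid (t tau : R) : `|t - t0| < r / 2 -> 0 <= tau <= 1 ->
    t0 - r / 2 < t0 + tau * (t - t0) < t0 + r / 2.
  move=> tr /andP[tau0 tau1].
  have : `|tau * (t - t0)| < r / 2.
    by rewrite normrM (ger0_norm tau0); apply: le_lt_trans tr; rewrite ler_piMl.
  by rewrite ltr_norml; lra.
have midr (t tau : R) : `|t - t0| < r / 2 -> 0 <= tau <= 1 -> `|t0 + tau * (t - t0) - t0| < r.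
  by move=> tr t01; have := mid t tau tr t01; rewrite ltr_norml; lra.
have affine (f : R * R -> R) (s t : R) th : smooth B f -> `|s - s0| < r -> `|t - t0| < r / 2 ->
    primitive (fun t => f (s, t)) (t0 - r / 2) (t0 + r / 2) th ->
    \int[lebesgue_measure]_(tau in `[0, 1]) ((t - t0) * f (s, t0 + tau * (t - t0))) =
    th t - th t0.
  move=> Sf sr tr pth.
  have H1 tau : 0 <= tau <= 1 -> t0 - r / 2 <= t0 + tau * (t - t0) <= t0 + r / 2.
    by move=> /(mid t tau tr) /andP[h1 h2]; rewrite !ltW.
  rewrite (@integral_primitive _ _ 0 1 (fun tau => th (t0 + tau * (t - t0))) ler01).
  - by rewrite mul1r mul0r addr0 subrKC.
  - apply: seg_continuousM; first by apply: seg_continuous_at => x _; apply: cst_continuous.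
    apply: (@seg_continuous_affine _ (t0 - r / 2) (t0 + r / 2) (fun t => f (s, t))) => //.
    by apply: seg_continuous_at => y yr; apply: cont => //; apply: BP => //; apply: abs_in.
  - apply: (primitive_affine H1) pth => tau t1 t2.
    by apply: mid => //; rewrite !ltW.
exists (fun s t => al s + P s t); split=> [s c' d' sr cr dr|t a' b' tcd aa bb tr ar br].
  have [|th pth _] := @primitive_exists _ (fun t => a2 (s, t)) _ _ (lr t0).
    apply: seg_continuous_at => t tr; apply: cont => //.
    by apply: BP; [apply: lt_r|apply: abs_in].
  have H x : c' <= x <= d' -> `|x - t0| < r / 2.
    by move: cr dr; rewrite !ltr_norml; lra.
  apply: (primitive_shift (k := al s - th t0) (th := th)) => [x xcd|].
    rewrite /P (affine a2 s x th)//; [ring|exact: lt_r|exact: H].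
  by apply: primitive_sub pth; move: cr dr; rewrite !ltr_norml; lra.
have Hab x : a' <= x <= b' -> `|x - s0| < r / 2.
  by move: ar br; rewrite !ltr_norml; lra.
pose f u tau := (t - t0) * a2 (u, t0 + tau * (t - t0)).
pose O := [set u : R | `|u - s0| < r].
have oO : open O.
  rewrite (_ : O = ball s0 r); first exact: ball_open.
  by apply/seteqP; split=> x; rewrite /O /= -ball_normE /ball_/= distrC.
have Lf : locally_C_k 1 O f.
  move=> u tau Ou t01.
  have oN : open [set w : R * R | B (w.1, t0 + w.2 * (t - t0))].
    apply: open_pair => // w; first exact: cvg_fst.
    apply: cvgD; first exact: cvg_cst.
    by apply: cvgM; [apply: cvg_snd|apply: cvg_cst].
  exists [set w : R * R | B (w.1, t0 + w.2 * (t - t0))], (fun w => f w.1 w.2); split=> //.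
    by apply: BP => //=; apply: midr.
  suff S : smooth [set w : R * R | B (w.1, t0 + w.2 * (t - t0))] (fun w => f w.1 w.2) by apply: S.
  have Sfst : smooth [set w : R * R | B (w.1, t0 + w.2 * (t - t0))] (fun w : R * R => w.1).
    by apply: (@smooth_linear _ (R * R)%type R _ fst) => // x; apply: cvg_fst.
  have Ssnd : smooth [set w : R * R | B (w.1, t0 + w.2 * (t - t0))] (fun w : R * R => w.2).
    by apply: (@smooth_linear _ (R * R)%type R _ snd) => // x; apply: cvg_snd.
  apply: smoothM => //; first exact: smooth_cst.
  apply: (smooth_pair_comp (N := B)) => //.
  apply: smoothD => //; first exact: smooth_cst.
  by apply: smoothM => //; apply: smooth_cst.
have dP (s : R) : a <= s <= b -> `|s - s0| < r / 2 ->
    is_derive s 1 (fun s => P s t) (a1 (s, t) - a1 (s, t0)).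
  move=> sab sr; have sr' := lt_r _ sr.
  have := is_derive_integral01 (1 : R) oO (sr' : O s) Lf.
  rewrite (_ : \int[_]_(_ in _) _ = \int[lebesgue_measure]_(tau in `[0, 1])
     ((t - t0) * 'D_(0, 1) a1 (s, t0 + tau * (t - t0)))); last first.
    apply: eq_Rintegral => tau; rewrite inE/= in_itv/= => t01.
    have Bt : B (s, t0 + tau * (t - t0)) by apply: BP => //; apply: midr.
    (* The points between [t0] and [t] stay in the box by convexity. Closedness turns the
       [s]-derivative of [a2] into the [t]-derivative of [a1], which integrates back to
       [a1 (s, t) - a1 (s, t0)]. *)
    rewrite closed//; last first.
      have := t01; move: tcd t0cd => /andP[ct td] /andP[ct0 t0d] /andP[u0 u1].
      by apply/andP; split; nra.
    have d1 := is_deriveZ (t - t0) (slice1 _ _ Bt).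
    by have [_ E1] := d1; rewrite -[RHS]E1.
  rewrite (affine (fun z => 'D_(0, 1) a1 z) s t (fun t => a1 (s, t)))//.
    exact: smooth_derive.
  split; first by apply: seg_continuous_at => x xr; apply: cont => //; apply: BP => //; apply: abs_in.
  by move=> x x1 x2; apply: slice2; apply: BP => //; apply: abs_in; rewrite !ltW.
have [cal dal] := pal; split.
  apply: seg_continuousD.
    move=> x xab e e0; have [|dl dl0 H] := cal x _ e e0.
      by have := Hab x xab; rewrite ltr_norml; lra.
    exists dl => // y yab; apply: H.
    by have := Hab y yab; rewrite ltr_norml; lra.
  apply: seg_continuous_at => x xab; apply: (@is_derive_continuous _ _ _ (a1 (x, t) - a1 (x, t0))).
  by apply: dP; [move: xab; lra|apply: Hab].
move=> x ax xb; have xab : a' <= x <= b' by rewrite !ltW.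
rewrite -(subrKC (a1 (x, t0)) (a1 (x, t))).
apply: is_deriveD; last by apply: dP; [move: xab; lra|apply: Hab].
by apply: dal; have := Hab x xab; rewrite ltr_norml; lra.
Qed.

(** Horizontal and vertical lines suffice: thin invariance only compares the four sides of the
    rectangle. *)
Definition lift2 (H : R * R -> M) (a b c d : R) (sg : J -> R * R -> R[i]) : Prop :=
  (forall t, c <= t <= d -> lift U E (fun s => H (s, t)) a b (fun i s => sg i (s, t))) /\
  (forall s, a <= s <= b -> lift U E (fun t => H (s, t)) c d (fun i t => sg i (s, t))).

(** Near [(s0, t0)] the extension of [H] stays in one [U i]; the potential of the closed pulled back
    form, exponentiated, is a lift in both directions. *)
Lemma local_lift2 H (a b c d s0 t0 : R) : a <= s0 <= b -> c <= t0 <= d ->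
  smooth_map_within X (box a b c d) H -> rank_le1 X (box a b c d) H ->
  exists2 r : R, 0 < r & forall a' b' c' d', a <= a' -> a' <= b' -> b' <= b ->
    c <= c' -> c' <= d' -> d' <= d ->
    `|a' - s0| < r -> `|b' - s0| < r -> `|c' - t0| < r -> `|d' - t0| < r ->
    exists sg, lift2 H a' b' c' d' sg.
Proof.
move=> s0ab t0cd SH rkH; have z0 : box a b c d (s0, t0) by exact/boxP.
have [N [h [oN Nz Sh Nh]]] := SH _ z0.
have [i Ui] := coverU (h (s0, t0)).
set ch := chart_at X (h (s0, t0)); have cz : dom ch (h (s0, t0)) by exact: chart_atP.
have oD : open (U i `&` dom ch) by apply: openI => //; exact: dom_open.
have oN' := smooth_map_open oN Sh oD.
have /nbhs_ballP [r /= r0 Hr] := open_nbhs_nbhs (conj oN' (conj Nz (conj Ui cz))).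
have ShB : smooth_map X (ball (s0, t0) r) h by apply: smooth_map_sub Sh => z /Hr [].
have oB : open (ball (s0, t0) r) by exact: ball_open.
have UB z : ball (s0, t0) r z -> U i (h z) by move=> /Hr [_ []].
have [_ FA _ _] := HE.
have Sa v : smooth (ball (s0, t0) r) (pull (A i) h v).
  exact: (smooth_pull (oU i) (FA i) v oB ShB UB).
have [s t Bst sab tcd|Th [Tv Thh]] := square_potential (Sa (1, 0)) (Sa (0, 1)) r0 s0ab t0cd.
  have [Nst [_ cst]] := Hr _ Bst.
  have zst : box a b c d (s, t) by exact/boxP.
  apply: (pull_closed (c := ch) (oU i) (FA i) oB ShB Bst UB cst).
  by apply: (rkH (s, t) N h) => //; rewrite Nh.
have r20 : 0 < r / 2 by rewrite divr_gt0.
exists (r / 2) => // a' b' c' d' aa ab bb cc cd dd ar br cr dr.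
have near_s s : a' <= s <= b' -> a <= s <= b /\ `|s - s0| < r / 2.
  by move=> sab; split; move: ar br; rewrite ?ltr_norml; lra.
have near_t t : c' <= t <= d' -> c <= t <= d /\ `|t - t0| < r / 2.
  by move=> tcd; split; move: cr dr; rewrite ?ltr_norml; lra.
have inB s t : a' <= s <= b' -> c' <= t <= d' ->
    [/\ box a b c d (s, t), N (s, t), H (s, t) = h (s, t) & ball (s0, t0) r (s, t)].
  move=> /near_s [sab sr] /near_t [tcd tr].
  have Bst : ball (s0, t0) r (s, t).
    by split; rewrite /= -ball_normE /ball_/= distrC; lra.
  have zst : box a b c d (s, t) by exact/boxP.
  have [Nst _] := Hr _ Bst.
  by split=> //; apply: Nh.
exists (fun j z => expi (Th z.1 z.2) * g i j (H z)).
split=> [t tcd|s sab] /=.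
  have [tcd' tr] := near_t t tcd.
  have oN1 : open [set s : R | ball (s0, t0) r (s, t)].
    by apply: open_pair => // x; [apply: cvg_id|apply: cst_continuous].
  apply: (line_lift oU HE oN1 (q := fun s => h (s, t)) (th := fun s => Th s t)).
  - by apply: smooth_map_pair_comp ShB => //; [exact: smooth_id|exact: smooth_cst].
  - by move=> s sab; have [_ _ -> Bst] := inB s t sab tcd; split=> //; apply: UB.
  - apply: primitive_ext (Thh t a' b' tcd' aa bb tr ar br) => s as_ sb.
    rewrite (@pullback_ext _ _ _ _ _ (fun s => H (s, t)) (fun s => h (s, t)) a' b' s as_ sb); last first.
      by move=> y ay yb; have [|_ _ ->] := inB y t _ tcd; rewrite ?ltW.
    rewrite (hline s t) -(pullback_line (A i) h (0, t) (1, 0) s).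
    by congr (pullback _ _ _); apply/funext => y; rewrite -hline.
have [sab' sr] := near_s s sab.
have oN1 : open [set t : R | ball (s0, t0) r (s, t)].
  by apply: open_pair => // x; [apply: cst_continuous|apply: cvg_id].
apply: (line_lift oU HE oN1 (q := fun t => h (s, t)) (th := fun t => Th s t)).
- by apply: smooth_map_pair_comp ShB => //; [exact: smooth_cst|exact: smooth_id].
- by move=> t tcd; have [_ _ -> Bst] := inB s t sab tcd; split=> //; apply: UB.
- apply: primitive_ext (Tv s c' d' sr cr dr) => t ct td.
  rewrite (@pullback_ext _ _ _ _ _ (fun t => H (s, t)) (fun t => h (s, t)) c' d' t ct td); last first.
    by move=> y ay yb; have [|_ _ ->] := inB s y sab; rewrite ?ltW.
  rewrite (vline s t) -(pullback_line (A i) h (s, 0) (0, 1) t).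
  by congr (pullback _ _ _); apply/funext => y; rewrite -vline.
Qed.

Lemma lift2_glue H (a m b c d : R) sg sg' : a <= m -> m <= b -> c <= d ->
  smooth_map_within X `[c, d] (fun t => H (m, t)) ->
  lift2 H a m c d sg -> lift2 H m b c d sg' -> exists tau, lift2 H a b c d tau.
Proof.
move=> am mb cd Sm [L1 L2] [K1 K2].
have mm : m <= m <= b by rewrite lexx.
have mm' : a <= m <= m by rewrite lexx andbT.
have [k k1 Hk] := lift_unique oU coverU HE cd Sm (K2 m mm) (L2 m mm').
exists (fun i z => if z.1 <= m then sg i z else k * sg' i z); split=> [t tcd|s /andP[as_ sb]] /=.
  apply: (lift_glue am mb (L1 t tcd) (lift_scale k1 (K1 t tcd))) => i Ui.
  exact: Hk.
have [sm|ms] := leP s m; first by apply: L2; rewrite as_.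
by apply: lift_scale => //; apply: K2; rewrite sb ltW.
Qed.

Lemma lift2_swap H (a b c d : R) sg : lift2 H a b c d sg ->
  lift2 (fun z => H (z.2, z.1)) c d a b (fun i z => sg i (z.2, z.1)).
Proof. by move=> [L1 L2]; split. Qed.

(** Interval induction twice: in [s], to fill a thin strip around each height [t0], then in [t], to
    stack the strips. *)
Lemma lift2_exists H (a b c d : R) : a <= b -> c <= d ->
  smooth_map_within X (box a b c d) H -> rank_le1 X (box a b c d) H ->
  exists sg, lift2 H a b c d sg.
Proof.
move=> ab cd SH rkH; pose P x y := exists sg, lift2 H a b x y sg.
apply: (interval_induction (P := P) cd) => [x y z cx xy yz zd [sg L] [sg' L']|t0 t0cd].
  have [|tau T] := @lift2_glue (fun z => H (z.2, z.1)) x y z a b _ _ xy yz ab _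
    (lift2_swap L) (lift2_swap L').
    by apply: smooth_within_hline SH _; rewrite (le_trans cx xy) (le_trans yz zd).
  exists (fun i z => tau i (z.2, z.1)).
  by have := lift2_swap T; congr lift2; apply/funext => -[].
(* The height of the strip is part of the predicate, since gluing two neighbouring strips keeps only
   the smaller height. *)
pose Q x y := exists2 r : R, 0 < r & forall c' d', c <= c' -> c' <= d' -> d' <= d ->
    `|c' - t0| < r -> `|d' - t0| < r -> exists sg, lift2 H x y c' d' sg.
have Qab : Q a b.
  apply: (interval_induction (P := Q) ab) => [x y z ax xy yz zb [r r0 Hr] [r' r'0 Hr']|s0 s0ab].
    exists (Num.min r r'); first by rewrite lt_min r0.
    move=> c' d' cc cd' dd; rewrite !lt_min => /andP[cr cr'] /andP[dr dr'].
    have [sg L] := Hr c' d' cc cd' dd cr dr.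
    have [sg' L'] := Hr' c' d' cc cd' dd cr' dr'.
    apply: (lift2_glue xy yz cd' _ L L').
    have : smooth_map_within X `[c, d] (fun t => H (y, t)).
      by apply: smooth_within_vline SH _; rewrite (le_trans ax xy) (le_trans yz zb).
    move=> Sy t; rewrite /= in_itv/= => tcd; have [|N [h [oN Nt Sh Nh]]] := Sy t.
      by rewrite /= in_itv/=; move: tcd; lra.
    exists N, h; split=> // u Nu; rewrite /= in_itv/= => ucd; apply: Nh => //.
    by rewrite /= in_itv/=; move: ucd; lra.
  have [r r0 Hr] := local_lift2 s0ab t0cd SH rkH.
  exists r => // x y ax xy yb xr yr; exists r => // c' d' cc cd' dd cr dr.
  exact: Hr.
by have [r r0 Hr] := Qab; exists r.
Qed.

(** The homotopy is constant on the two vertical sides, so the pulled back form vanishes there and a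
    lift over the rectangle keeps its value. Bottom and top thus compare the same pair of end
    values. *)
Lemma thin_invariance : thin_invariant (@tqft_of_bundle R n M X J U E).
Proof.
move=> O O' sa sb fl ll [H [G [lab [SH rkH _ _ _]]]].
move: SH rkH; rewrite -/(box _ _ _ _) => -[SH Hp Hs] rkH.
have ab := object_lt O.
have [sg [Lh Lv]] := lift2_exists (ltW ab) ler01 SH rkH.
have i0 : 0 <= (0 : R) <= 1 by rewrite lexx ler01.
have i1 : 0 <= (1 : R) <= 1 by rewrite lexx ler01.
have L0 : lift U E O (start O) (stop O) (fun i s => sg i (s, 0)).
  by apply: lift_ext (Lh 0 i0) => s /Hp [].
have L1 : lift U E O' (start O') (stop O') (fun i s => sg i (s, 1)).
  by rewrite -sa -sb; apply: lift_ext (Lh 1 i1) => s /Hp [].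
have side s y i : start O <= s <= stop O -> (forall t, 0 <= t <= 1 -> H (s, t) = y) ->
    U i y -> sg i (s, 1) = sg i (s, 0).
  move=> sab Hy Uy; have [_ _ L3] := Lv s sab.
  rewrite (L3 i 0 1 (fun=> 0))//; first by rewrite subrr expi0 mulr1.
    by move=> t /Hy ->.
  split; first by apply: seg_continuous_at => x _; apply: cst_continuous.
  move=> t t0 t1; rewrite (@pullback_ext _ _ _ _ _ (fun t => H (s, t)) (fun=> y) 0 1)//; last first.
    by move=> x x0 x1; rewrite Hy// !ltW.
  rewrite /pullback big1; first exact: is_derive_cst.
  by move=> l _; rewrite (_ : _ \o _ = cst (coord (chart_at X y) y))// derive_cst mxE mulr0.
have aab : start O <= start O <= stop O by rewrite lexx ltW.
have bab : start O <= stop O <= stop O by rewrite lexx ltW.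
have h0 := object_holonomy oU HE L0; have h1 := object_holonomy oU HE L1.
rewrite /= -/(hol E O) -/(hol E O').
rewrite -sa -sb -fl -ll in h1.
rewrite (side (start O) (O (start O))) in h1 => //; last 2 first.
- by move=> t /Hs [].
- exact: object_first.
rewrite (side (stop O) (O (stop O))) in h1 => //; last 2 first.
- by move=> t /Hs [].
- exact: object_last.
move: h1; rewrite h0; apply: mulfI; apply: norm1_neq0.
by have [_ L2 _] := L0; apply: L2 => //; exact: object_first.
Qed.

End Thin.

Section RowPair.
Variables (R : realType) (k : nat).

Lemma open_preimage_in (T T' : topologicalType) (O : set T) (N : set T') (f : T -> T') :
  open O -> open N -> (forall x, O x -> {for x, continuous f}) -> open (O `&` f @^-1` N).
Proof.
move=> oO oN cf; rewrite openE => x [Ox Nx]; rewrite /interior/=.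
apply: filterI; first exact: open_nbhs_nbhs.
by apply: (cf x Ox); apply: open_nbhs_nbhs.
Qed.

(** At an end point of [[a, b]] only the inward one-sided derivatives can be compared, and these are
    enough. *)
Lemma derive_eq_within (f g : R -> R) (a b s d l m : R) : a < b -> a <= s <= b -> 0 < d ->
  is_derive s 1 f l -> is_derive s 1 g m ->
  (forall r, a <= r <= b -> `|r - s| < d -> f r = g r) -> l = m.
Proof.
move=> ab /andP[as_ sb] d0 df dg fg.
have [lt|ge] := ltP s b.
  apply: (@derive_eq_side _ _ f g s 1 l m 1 (Num.min d (b - s))) => //.
    by rewrite lt_min d0 subr_gt0.
  move=> r /andP[r0]; rewrite lt_min => /andP[rd rb]; rewrite mul1r [r *: _]mulr1.
  apply: fg; first by apply/andP; split; lra.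
  by rewrite addrAC subrr add0r ger0_norm.
apply: (@derive_eq_side _ _ f g s 1 l m (-1) (Num.min d (s - a))) => //.
- by rewrite lt_min d0 subr_gt0; lra.
- move=> r /andP[r0]; rewrite lt_min => /andP[rd rb]; rewrite mulN1r [- r *: _]mulr1.
  apply: fg; first by apply/andP; split; lra.
  by rewrite addrAC subrr add0r normrN ger0_norm.
Qed.

Lemma smooth_rowpair_comp (V : normedModType R) (O : set V) (N : set ('rV[R]_k * R)%type)
    (f : 'rV[R]_k * R -> R) (u : V -> 'rV[R]_k) (v : V -> R) :
  open O -> open N -> (forall x, O x -> N (u x, v x)) ->
  smooth O u -> smooth O v -> smooth N f -> smooth O (fun x => f (u x, v x)).
Proof.
move=> oO oN ON Su Sv Sf.
apply: (smooth_comp_coord (coordinates_prod (@coordinates_row R k) (@coordinates_line R))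
  oO oN (f := fun x => (u x, v x)) ON _ Sf).
by case=> // i /=; apply: smooth_coord.
Qed.

Lemma smooth_map_rowpair_comp n (M : topologicalType) (X : smooth_atlas R n M)
    (V : normedModType R) (O : set V) (N : set ('rV[R]_k * R)%type)
    (h : 'rV[R]_k * R -> M) (u : V -> 'rV[R]_k) (v : V -> R) :
  open O -> open N -> (forall x, O x -> N (u x, v x)) ->
  smooth O u -> smooth O v -> smooth_map X N h -> smooth_map X O (fun x => h (u x, v x)).
Proof.
move=> oO oN ON Su Sv Sf.
apply: (smooth_map_comp (coordinates_prod (@coordinates_row R k) (@coordinates_line R))
  oO oN (f := fun x => (u x, v x)) ON _ Sf).
by case=> // i /=; apply: smooth_coord.
Qed.

Lemma continuous_rowpair (T : topologicalType) (u : T -> 'rV[R]_k) (v : T -> R) x :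
  {for x, continuous u} -> {for x, continuous v} -> {for x, continuous (fun y => (u y, v y))}.
Proof.
move=> cu cv.
exact: (@cvg_pair _ _ _ (nbhs x) (nbhs (u x)) (nbhs (v x)) _ _ _ u v).
Qed.

End RowPair.

Section SmoothC.
Variables (R : realType) (V : normedModType R) (O : set V).
Hypothesis oO : open O.

Lemma smoothC_ext (f h : V -> R[i]) : (forall x, O x -> f x = h x) ->
  smoothC O f -> smoothC O h.
Proof.
by move=> fh [SR SI]; split; [apply: smooth_ext SR|apply: smooth_ext SI] => // x Ox; rewrite fh.
Qed.

Lemma smoothC_mul (f h : V -> R[i]) : smoothC O f -> smoothC O h ->
  smoothC O (fun x => f x * h x).
Proof.
move=> [fR fI] [hR hI]; split.
  apply: (smooth_ext (f := fun x => complex.Re (f x) * complex.Re (h x) -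
    complex.Im (f x) * complex.Im (h x))) => // [x _|]; first by rewrite Re_mulc.
  by apply: smoothB => //; apply: smoothM.
apply: (smooth_ext (f := fun x => complex.Re (f x) * complex.Im (h x) +
    complex.Im (f x) * complex.Re (h x))) => // [x _|]; first by rewrite Im_mulc.
by apply: smoothD => //; apply: smoothM.
Qed.

Lemma smoothC_expi (th : V -> R) : smooth O th -> smoothC O (fun x => expi (th x)).
Proof.
move=> St; split; apply: (smooth_comp (N := setT)) => //; try exact: openT.
  exact: smooth_cos.
exact: smooth_sin.
Qed.

End SmoothC.

(** * Smooth dependence of the holonomy in families *)

Section SmoothHolonomy.
Variables (R : realType) (n : nat) (M : topologicalType).
Variable X : smooth_atlas R n M.
Variables (J : Type) (U : J -> set M).
Hypothesis oU : forall i, open (U i).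
Variable E : bundle_data X J.
Hypothesis HE : U1_bundle_with_connection U E.

Local Notation g := (transition E).
Local Notation A := (connection E).

Variables (k : nat) (W : set 'rV[R]_k) (F : 'rV[R]_k -> object X U).
Hypothesis oW : open W.
Let D := [set q : 'rV[R]_k * R | W q.1 /\ start (F q.1) <= q.2 <= stop (F q.1)].
Hypothesis SF : smooth_map_within X D (fun q => F q.1 q.2).

Lemma smooth_transition_family i j (x : 'rV[R]_k -> R) : smooth W x ->
  (forall u, W u -> [/\ start (F u) <= x u <= stop (F u), U i (F u (x u)) & U j (F u (x u))]) ->
  smoothC W (fun u => g i j (F u (x u))).
Proof.
move=> Sx H; have [Hg _ _ _] := HE; have [_ _ Sg] := Hg i j.
have oD : open (U i `&` U j) by exact: openI.
have SR : smooth_function X (U i `&` U j) (fun y => complex.Re (g i j y)).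
  by move=> c; have [] := Sg c.
have SI : smooth_function X (U i `&` U j) (fun y => complex.Im (g i j y)).
  by move=> c; have [] := Sg c.
have loc u0 : W u0 -> exists N, [/\ open N, N u0, N `<=` W & exists h : 'rV[R]_k -> M,
    [/\ smooth_map X N h, forall u, N u -> F u (x u) = h u &
        forall u, N u -> (U i `&` U j) (h u)]].
  move=> Wu; have [x0 _ _] := H u0 Wu.
  have [|N [h [oN Nz Sh Nh]]] := SF (x := (u0, x u0)); first by split.
  have cx u : W u -> {for u, continuous (fun u => (u, x u))}.
    move=> Wu'; apply: continuous_rowpair; first exact: cvg_id.
    exact: smooth_continuous Sx Wu'.
  have oN' := open_preimage_in oW oN cx.
  have E1 u : (W `&` (fun u => (u, x u)) @^-1` N) u -> F u (x u) = h (u, x u).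
    by move=> [Wu' Nu]; rewrite -Nh//; split=> //=; have [] := H u Wu'.
  exists (W `&` (fun u => (u, x u)) @^-1` N); split=> //.
  exists (fun u => h (u, x u)); split=> //; last first.
    by move=> u Nu; have [Wu' _] := Nu; rewrite -E1//; have [] := H u Wu'.
  apply: (smooth_map_rowpair_comp (N := N)) => //; first by move=> u [].
    exact: smooth_id.
  by apply: smooth_sub Sx => u [].
split; apply: smooth_local => u /loc [N [oN Nu NW [h [Sh Fh Uh]]]]; exists N => //.
  apply: (smooth_ext (f := fun u => complex.Re (g i j (h u)))) => //.
    by move=> v Nv; rewrite Fh.
  exact: (smooth_function_comp oN oD Sh Uh SR).
apply: (smooth_ext (f := fun u => complex.Im (g i j (h u)))) => //.
  by move=> v Nv; rewrite Fh.
exact: (smooth_function_comp oN oD Sh Uh SI).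
Qed.

(** The path [F u] and the local extension [h] of the family agree only on the interval of [F u].
    Both have derivatives, so agreement on the inner side settles the end points too. *)
Lemma pullback_extension i u (s : R) (N : set ('rV[R]_k * R)%type) h : open N -> N (u, s) ->
  smooth_map X N h -> (forall y, N y -> D y -> F y.1 y.2 = h y) -> W u ->
  start (F u) <= s <= stop (F u) ->
  pullback (A i) (F u) s = pull (A i) h (0, 1) (u, s).
Proof.
move=> oN Nus Sh Nh Wu sab; have e : F u s = h (u, s) by apply: (Nh (u, s)).
rewrite /pullback /pull e; apply: eq_bigr => l _; congr (_ * _).
set c := chart_at X _; have cs : dom c (h (u, s)) by exact: chart_atP.
have cs' : dom c (F u s) by rewrite e.
have oc : open [set r | N (u, r)].
  apply: (open_comp (f := fun r => (u, r))) oN => r _.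
  by apply: continuous_rowpair; [apply: cst_continuous|apply: cvg_id].
have Sh' : smooth_map X [set r | N (u, r)] (fun r => h (u, r)).
  by apply: (smooth_map_rowpair_comp (N := N)) Sh => //; [exact: smooth_cst|exact: smooth_id].
have d1 := (is_derive_rowP _ _ _ _).1 (is_derive_map_coord (1 : R) openT (path_smooth (F u)) I cs') l.
have d2 := (is_derive_rowP _ _ _ _).1 (is_derive_map_coord (1 : R) oc Sh' Nus cs) l.
have e2 : 'D_(0, 1) (coord c \o h) (u, s) = 'D_1 (coord c \o (fun r => h (u, r))) s.
  have vl (r : R) : (u, r) = (u, 0) + r *: (0, 1) :> 'rV[R]_k * R.
    by apply: injective_projections; rewrite /= ?scaler0 ?addr0 ?add0r// [_ *: _]mulr1.
  rewrite vl -(derive_line (coord c \o h)); congr ('D_1 _ s).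
  by apply/funext => r; rewrite /= -vl.
rewrite e2.
have /nbhs_ballP [d /= d0 Hd] := open_nbhs_nbhs (conj oc Nus).
apply: (derive_eq_within (object_lt (F u)) sab d0 d1 d2) => r rab rs.
have Nur : N (u, r) by apply: Hd; rewrite -ball_normE /ball_/= distrC.
by have e3 : F u r = h (u, r) := Nh (u, r) Nur (conj Wu rab); rewrite /= e3.
Qed.

(** Rescaling fixes the domain of integration; the integrand then extends locally, through [h], to a
    smooth function of both the parameter and the integration variable, as [smooth_integral01]
    requires. *)
Lemma smooth_phase_family i (x y : 'rV[R]_k -> R) : smooth W x -> smooth W y ->
  (forall u, W u -> [/\ start (F u) <= x u, x u <= y u, y u <= stop (F u) &
     forall s, x u <= s <= y u -> U i (F u s)]) ->
  smooth W (fun u => \int[lebesgue_measure]_(t in `[x u, y u]) pullback (A i) (F u) t).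
Proof.
move=> Sx Sy H; have [_ FA _ _] := HE.
pose f u t := (y u - x u) * pullback (A i) (F u) (x u + t * (y u - x u)).
apply: (smooth_ext (f := fun u => \int[lebesgue_measure]_(t in `[0, 1]) f u t)) => // [u Wu|].
  have [ax xy yb Ui] := H u Wu; rewrite [RHS]integral_rescale//.
  apply: seg_continuous_at => s sxy; apply: (pullback_continuous oU HE) => //.
    exact: path_smooth.
  exact: Ui.
apply: smooth_integral01 => // u t Wu t01.
have seg v s : W v -> 0 <= s <= 1 -> x v <= x v + s * (y v - x v) <= y v.
  move=> Wv /andP[s0 s1]; have [_ xy _ _] := H v Wv.
  have yx : 0 <= y v - x v by rewrite subr_ge0.
  by rewrite lerDl mulr_ge0//= -lerBrDl ler_piMl.
have segD v s : W v -> 0 <= s <= 1 -> D (v, x v + s * (y v - x v)).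
  move=> Wv s01; split=> //=; have [ax _ yb _] := H v Wv.
  by have /andP[h1 h2] := seg v s Wv s01; rewrite (le_trans ax h1) (le_trans h2 yb).
have [N [h [oN Nz Sh Nh]]] := SF (segD u t Wu t01).
have oN' := smooth_map_open oN Sh (oU i).
pose W1 : set ('rV[R]_k * R)%type := [set w | W w.1].
have oW1 : open W1 by apply: (open_comp (f := fst)) oW => w _; apply: cvg_fst.
have Sfst : smooth W1 (fun w : 'rV[R]_k * R => w.1).
  by apply: (@smooth_linear _ ('rV[R]_k * R)%type 'rV[R]_k _ fst) => // w; apply: cvg_fst.
have Ssnd : smooth W1 (fun w : 'rV[R]_k * R => w.2).
  by apply: (@smooth_linear _ ('rV[R]_k * R)%type R _ snd) => // w; apply: cvg_snd.
have Sx1 : smooth W1 (fun w => x w.1).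
  by apply: (@smooth_comp_row _ _ k _ W x fst) => //.
have Sy1 : smooth W1 (fun w => y w.1).
  by apply: (@smooth_comp_row _ _ k _ W y fst) => //.
have Syx : smooth W1 (fun w => y w.1 - x w.1) by apply: smoothB.
pose psi (w : 'rV[R]_k * R) := x w.1 + w.2 * (y w.1 - x w.1).
have Spsi : smooth W1 psi by apply: smoothD => //; apply: smoothM.
have cpsi w : W1 w -> {for w, continuous (fun w => (w.1, psi w))}.
  move=> Ww; apply: continuous_rowpair; first exact: cvg_fst.
  exact: smooth_continuous Spsi Ww.
have oQ := open_preimage_in oW1 oN' cpsi.
exists (W1 `&` (fun w => (w.1, psi w)) @^-1` (N `&` h @^-1` U i)).
exists (fun w => (y w.1 - x w.1) * pull (A i) h (0, 1) (w.1, psi w)); split.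
- exact: oQ.
- split=> //=; split=> //=; rewrite -Nh//; last exact: segD.
  by have [_ _ _ Ui] := H u Wu; apply: Ui; apply: seg.
- apply: smoothM => //; first by apply: smooth_sub Syx => w [].
  apply: (smooth_rowpair_comp (N := N `&` h @^-1` U i)) => //.
  + by move=> w [].
  + by apply: smooth_sub Sfst => w [].
  + by apply: smooth_sub Spsi => w [].
  + apply: (smooth_pull (oU i) (FA i)) => //; first by apply: smooth_map_sub Sh => w [].
    by move=> w [].
- move=> w [Ww [Nw Uw]] w01; rewrite /f; congr (_ * _).
  have [_ sab] := segD w.1 w.2 Ww w01.
  exact: (pullback_extension i oN Nw Sh Nh Ww sab).
Qed.

(** Induction on the list [L] of labels, which is constant in the family, whereas the breaks move
    with [u]. The first break is read off by [nth] because its default value is never met on [W]. *)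
Lemma smooth_holonomy_family (L : seq J) (bs : 'rV[R]_k -> seq (R * J)) i (a : 'rV[R]_k -> R) :
  smooth W a -> smooth W (fun u => stop (F u)) ->
  (forall m, smooth W (fun u => nth 0 [seq q.1 | q <- bs u] m)) ->
  (forall u, W u -> [/\ [seq q.2 | q <- bs u] = L, start (F u) <= a u,
    all_segments (fun x y _ => x < y) (a u) i (bs u) (stop (F u)) &
    all_segments (fun x y i => forall z, x <= z <= y -> U i (F u z)) (a u) i (bs u) (stop (F u))]) ->
  smoothC W (fun u => holonomy E (F u) (a u) i (bs u) (stop (F u))).
Proof.
elim: L bs i a => [|j L IH] bs i a Sa Sb Sbs H.
  apply: (smoothC_ext oW (f := fun u => expi (\int[lebesgue_measure]_(t in `[a u, stop (F u)])
      pullback (A i) (F u) t))).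
    by move=> u /H [+ _ _ _]; case: (bs u).
  apply: smoothC_expi => //; apply: smooth_phase_family => // u /H.
  by case: (bs u) => [|q s] [HL au ab Ui] //; split=> //; apply: ltW.
pose x u := nth 0 [seq q.1 | q <- bs u] 0.
have bsE u : W u -> bs u = (x u, j) :: behead (bs u).
  by rewrite /x => /H []; case: (bs u) => //= -[y j'] s /= [-> _].
have H' u : W u -> [/\ [seq q.2 | q <- behead (bs u)] = L, start (F u) <= x u, a u < x u &
    [/\ all_segments (fun x y _ => x < y) (x u) j (behead (bs u)) (stop (F u)),
    forall z, a u <= z <= x u -> U i (F u z) &
    all_segments (fun x y i => forall z, x <= z <= y -> U i (F u z)) (x u) j (behead (bs u)) (stop (F u))]].
  move=> Wu; have := H u Wu; rewrite (bsE u Wu) /= => -[[HL] sa [ax xs] [Ui Us]].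
  by split=> //; apply: le_trans sa (ltW ax).
apply: (smoothC_ext oW (f := fun u => expi (\int[lebesgue_measure]_(t in `[a u, x u])
      pullback (A i) (F u) t) * g i j (F u (x u)) *
      holonomy E (F u) (x u) j (behead (bs u)) (stop (F u)))).
  by move=> u Wu; rewrite [in RHS](bsE u Wu).
have Sx : smooth W x by apply: Sbs.
apply: smoothC_mul => //; last first.
  apply: IH => // [m|u /H' [HL sx ax [xs Ui Us]]]; last by split.
  apply: (smooth_ext (f := fun u => nth 0 [seq q.1 | q <- bs u] m.+1)) => // u Wu.
  by rewrite (bsE u Wu).
apply: smoothC_mul => //.
  apply: smoothC_expi => //; apply: smooth_phase_family => // u Wu.
  have [_ sx ax [xs Ui Us]] := H' u Wu; have [_ sa _ _] := H u Wu.
  by split=> //; apply: ltW => //; apply: all_segments_lt xs.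
apply: smooth_transition_family => // u Wu.
have [_ sx ax [xs Ui Us]] := H' u Wu.
split; first by rewrite sx ltW//; apply: all_segments_lt xs.
  by apply: Ui; rewrite lexx ltW.
exact: (all_segments_first (U := fun z k => U k (F u z)) xs Us).
Qed.

End SmoothHolonomy.

Lemma smooth_tqft_of_bundle (R : realType) (n : nat) (M : topologicalType)
    (X : smooth_atlas R n M) (J : Type) (U : J -> set M) (E : bundle_data X J) :
  (forall i, open (U i)) -> U1_bundle_with_connection U E ->
  smooth_tqft (@tqft_of_bundle R n M X J U E).
Proof.
move=> oU HE k W F oW [[Sa Sb] lab pts SF].
have [[u0 Wu0]|W0] := pselect (W !=set0); last first.
  by split; apply: smooth_local => u Wu; case: W0; exists u.
apply: (smoothC_ext oW (f := fun u => holonomy E (F u) (start (F u)) (first_label (F u0))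
  (breaks (F u)) (stop (F u)))).
  by move=> u Wu /=; have [-> _] := lab u u0 Wu Wu0.
apply: (smooth_holonomy_family oU HE oW SF (L := later_labels (F u0))) => // u Wu.
have [e1 e2] := lab u u0 Wu Wu0; split=> //.
- by rewrite -e1; apply: partition_increasing.
- by rewrite -e1; apply: partition_subordinate.
Qed.

(** * Thin homotopies between reparametrisations *)

Section LabelAt.
Variables (R : realType) (J : Type).
Implicit Types (s : seq (R * J)) (P : R -> R -> J -> Prop).

Fixpoint label_at (i : J) s (z : R) : J :=
  match s with
  | [::] => i
  | (x, j) :: s' => if z < x then i else label_at j s' z
  end.

Lemma all_segments_points (a b : R) i s x :
  all_segments (fun x y _ => x < y) a i s b -> x \in [seq q.1 | q <- s] -> a < x < b.
Proof.
elim: s a i => [|[y j] s IH] a i //= [ay ys].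
rewrite inE => /orP[/eqP ->|/(IH _ _ ys)/andP[yx ->]]; last by rewrite (lt_trans ay yx).
by rewrite ay (all_segments_lt ys).
Qed.

Lemma all_segments_uniq (a b : R) i s :
  all_segments (fun x y _ => x < y) a i s b -> uniq [seq q.1 | q <- s].
Proof.
elim: s a i => [|[y j] s IH] a i //= [ay ys]; rewrite (IH _ _ ys) andbT.
by apply/negP => /(all_segments_points ys); rewrite ltxx.
Qed.

Lemma all_segments_impl P Q (a b : R) i s :
  (forall x y k, a <= x -> x < y -> y <= b -> P x y k -> Q x y k) ->
  all_segments (fun x y _ => x < y) a i s b -> all_segments P a i s b -> all_segments Q a i s b.
Proof.
elim: s a i => [|[y j] s IH] a i /= PQ; first by move=> ab; apply: PQ.
move=> [ay ys] [Pa Ps]; have yb := all_segments_lt ys; split.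
  by apply: PQ => //; apply: ltW.
by apply: IH => // x z k yx; apply: PQ; apply: le_trans yx; apply: ltW.
Qed.

Lemma all_segments_label_at (a b : R) i s :
  all_segments (fun x y _ => x < y) a i s b ->
  all_segments (fun x y k => forall z, x < z < y ->
    z \notin [seq q.1 | q <- s] /\ label_at i s z = k) a i s b.
Proof.
elim: s a i => [|[y j] s IH] a i //= [ay ys]; split.
  move=> z /andP[az zy]; rewrite zy inE (lt_eqF zy); split=> //.
  by apply/negP => /(all_segments_points ys) /andP[yz _]; have := lt_trans zy yz; rewrite ltxx.
apply: (all_segments_impl _ ys (IH y j ys)) => x z k yx xz zb H t xtz.
have [tn tk] := H t xtz; have yt : y < t by apply: le_lt_trans yx _; case/andP: xtz.
by rewrite inE (gt_eqF yt) tn ltNge (ltW yt).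
Qed.

Lemma label_at_first (a b : R) i s :
  all_segments (fun x y _ => x < y) a i s b -> label_at i s a = i.
Proof. by case: s => [|[y j] s] //= [-> _]. Qed.

Lemma label_at_last (a b : R) i s :
  all_segments (fun x y _ => x < y) a i s b -> label_at i s b = last i [seq q.2 | q <- s].
Proof.
elim: s a i => [|[y j] s IH] a i //= [ay ys].
by rewrite ltNge (ltW (all_segments_lt ys)) /= (IH _ _ ys).
Qed.

Lemma label_at_same i s (z w : R) :
  (forall x, x \in [seq q.1 | q <- s] -> (z < x) = (w < x)) -> label_at i s z = label_at i s w.
Proof.
elim: s i => [|[y j] s IH] i //= H; rewrite H ?mem_head// IH// => x xs.
by apply: H; rewrite inE xs orbT.
Qed.

(** [w] lies in the closed segment of the partition whose interior contains [z]. The weak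
    inequalities are needed because the labels of faces must fit on the closures of the
    components. *)
Lemma all_segments_closed_cell (Phi : J -> R -> Prop) (a b : R) i s (z w : R) :
  all_segments (fun x y _ => x < y) a i s b ->
  all_segments (fun x y k => forall t, x <= t <= y -> Phi k t) a i s b ->
  z \notin [seq q.1 | q <- s] -> a <= w <= b ->
  (forall x, x \in [seq q.1 | q <- s] -> z < x -> w <= x) ->
  (forall x, x \in [seq q.1 | q <- s] -> x < z -> x <= w) -> Phi (label_at i s z) w.
Proof.
elim: s a i => [|[y j] s IH] a i /=; first by move=> _ H _ wab _ _; apply: H.
move=> [ay ys] [Pa Ps]; rewrite inE negb_or => /andP[zy zs] /andP[aw wb] H1 H2.
have [zlt|yz] := ltP z y.
  by apply: Pa; rewrite aw; apply: H1; rewrite ?mem_head.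
have yz' : y < z by rewrite lt_neqAle eq_sym zy.
apply: (IH y j ys Ps zs) => [|x xs|x xs].
- by rewrite wb andbT; apply: H2; rewrite ?mem_head.
- by apply: H1; rewrite inE xs orbT.
- by apply: H2; rewrite inE xs orbT.
Qed.

End LabelAt.

Lemma closure_le (R : realType) (T : topologicalType) (B : set T) (f : T -> R) (x : R) w :
  continuous f -> (forall v, B v -> f v <= x) -> closure B w -> f w <= x.
Proof.
move=> cf Bx cw; rewrite leNgt; apply/negP => xw.
have [v [/Bx vx /=]] : B `&` [set v | x < f v] !=set0.
  apply: cw; apply: open_nbhs_nbhs; split=> //.
  by apply: (open_comp (f := f)) (@open_gt _ x) => y _; apply: cf.
by rewrite ltNge vx.
Qed.

Section ThinHomotopy.
Variables (R : realType) (n : nat) (M : topologicalType).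
Variable X : smooth_atlas R n M.
Variables (J : Type) (U : J -> set M).
Variables (O O' : object X U) (N : set R) (q : R -> M) (psi0 psi1 : R -> R).
Hypothesis oN : open N.
Hypothesis Sq : smooth_map X N q.
Hypothesis S0 : smooth setT psi0.
Hypothesis S1 : smooth setT psi1.
Hypothesis sa : start O = start O'.
Hypothesis sb : stop O = stop O'.
Hypothesis sl : first_label O = first_label O'.
Hypothesis sbr : breaks O = breaks O'.
Hypothesis pO : forall x, O x = q (psi0 x).
Hypothesis pO' : forall x, O' x = q (psi1 x).
Hypothesis ea : psi0 (start O) = psi1 (start O).
Hypothesis eb : psi0 (stop O) = psi1 (stop O).
Hypothesis subN : forall x t : R, start O <= x <= stop O -> 0 <= t <= 1 ->
  N (psi0 x + t * (psi1 x - psi0 x)).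
Hypothesis sub : all_segments (fun x y i => forall z, x <= z <= y -> forall t, 0 <= t <= 1 ->
  U i (q (psi0 z + t * (psi1 z - psi0 z)))) (start O) (first_label O) (breaks O) (stop O).

(** Interpolation takes place between the parameters, not in [M]. Hence [H] factors through the
    line, and both rows of its Jacobian matrix are multiples of the derivative of [q]. *)
Let chi (z : R * R) : R := psi0 z.1 + z.2 * (psi1 z.1 - psi0 z.1).
Let H (z : R * R) : M := q (chi z).

Let pts := points O.

(* All vertices lie on the boundary of the rectangle, so trivalence is vacuous. *)
Definition vertical_graph : rect_graph R :=
  RectGraph ([seq (x, 0) | x <- pts] ++ [seq (x, 1) | x <- pts])
    (fun (e : 'I_(size pts)) (t : R) => (nth 0 pts e, t)).

Let G := vertical_graph.

Lemma vertical_graphP (z : R * R) : graph_set G z <-> z.1 \in pts /\ 0 <= z.2 <= 1.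
Proof.
split=> [[|[e [t [t01 <-]]]]|[zp z01]].
- rewrite /= mem_cat => /orP[] /mapP[x xp ->] /=; split=> //; rewrite ?lexx ?ler01//.
- by rewrite /=; split=> //; apply: mem_nth.
- right; have ip : (index z.1 pts < size pts)%N by rewrite index_mem.
  by exists (Ordinal ip), z.2; split=> //=; rewrite nth_index//; case: z {zp z01 ip}.
Qed.

Lemma pts_in x : x \in pts -> start O < x < stop O.
Proof. exact: (all_segments_points (partition_increasing O)). Qed.

Lemma vertical_graph_trivalent : embedded_trivalent (start O) (stop O) G.
Proof.
split.
- move=> z zv; have [|/pts_in /andP[az zb] z01] := (vertical_graphP z).1; first by left.
  by rewrite /rect /setX /= !in_itv/= z01 !ltW.
- move=> e; split.
  + apply: continuous_subspaceT => t.
    apply: (continuous_pair (u := fun=> nth 0 pts e) (v := id)); last exact: cvg_id.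
    exact: cst_continuous.
  + by rewrite mem_cat; apply/orP; left; apply/mapP; exists (nth 0 pts e); rewrite ?mem_nth.
  + by rewrite mem_cat; apply/orP; right; apply/mapP; exists (nth 0 pts e); rewrite ?mem_nth.
- move=> e t /andP[t0 t1]; split.
    rewrite /open_rect /setX /= !in_itv/= t0 t1.
    by have /pts_in -> : nth 0 pts e \in pts by apply: mem_nth.
  rewrite mem_cat; apply/negP => /orP[] /mapP[x _ [_ et]].
    by move: t0; rewrite et ltxx.
  by move: t1; rewrite et ltxx.
- move=> e e' t t' _ _ [/eqP]; rewrite nth_uniq//; last first.
    exact: all_segments_uniq (partition_increasing O).
  by move=> /eqP ee' ->; split=> //; apply: val_inj.
- move=> z; rewrite mem_cat => /orP[] /mapP[x _ ->]; rewrite /open_rect /setX /= !in_itv/= ltxx//.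
  all: by move=> [_]; rewrite ?andbF.
Qed.

Let lab (z : R * R) : J := label_at (first_label O) (breaks O) z.1.

(** The first projection of a component of the complement is an interval that avoids the partition
    points, so it stays within one segment of the partition, and its closure within the closed
    segment. *)
Lemma vertical_graph_labels : labelled_faces U (start O) (stop O) H G lab.
Proof.
move=> z; set C := _ `\` _ => Cz; have [zr zg] := Cz.
move: (zr); rewrite /rect /setX /= !in_itv/= => -[zab z01].
have zn : z.1 \notin pts by apply/negP => zp; apply: zg; apply/vertical_graphP.
have comp w : connected_component C z w -> rect (start O) (stop O) w /\
    forall x, x \in pts -> (z.1 < x -> w.1 < x) /\ (x < z.1 -> x < w.1).
  move=> [B [Bz BC cB] Bw]; have [wr _] := BC w Bw; split=> // x xp.
  have int : is_interval (fst @` B).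
    apply/connected_intervalP; apply: connected_continuous_connected => //.
    by apply: continuous_subspaceT => v; apply: cvg_fst.
  have no : ~ (fst @` B) x.
    move=> [v Bv vx]; have [vr vg] := BC v Bv; apply: vg; apply/vertical_graphP.
    by rewrite vx; split=> //; move: vr; rewrite /rect /setX /= !in_itv/= => -[].
  have Iz : (fst @` B) z.1 by exists z.
  have Iw : (fst @` B) w.1 by exists w.
  by split=> lt; rewrite ltNge; apply/negP => le; apply: no;
    [apply: (int z.1 w.1)|apply: (int w.1 z.1)] => //; rewrite ?le ?(ltW lt).
split=> [w /comp [_ cw]|w cw].
  apply/esym/label_at_same => x xp; have [h1 h2] := cw x xp.
  have [zx|xz] := ltP z.1 x; first by rewrite h1.
  have xz' : x < z.1.
    by rewrite lt_neqAle xz andbT; apply: contraNneq zn => <-.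
  by apply/esym/negbTE; rewrite -leNgt ltW// h2.
have cw' (f : R * R -> R) (x : R) : continuous f ->
    (forall v, connected_component C z v -> f v <= x) -> f w <= x.
  by move=> cf fx; apply: closure_le cf fx cw.
have c1 : continuous (fun v : R * R => v.1) by move=> v; apply: cvg_fst.
have c2 : continuous (fun v : R * R => v.2) by move=> v; apply: cvg_snd.
have c1' : continuous (fun v : R * R => - v.1) by move=> v; apply: cvgN; apply: cvg_fst.
have c2' : continuous (fun v : R * R => - v.2) by move=> v; apply: cvgN; apply: cvg_snd.
have R1 v : connected_component C z v -> start O <= v.1 <= stop O /\ 0 <= v.2 <= 1.
  by move=> /comp [+ _]; rewrite /rect /setX /= !in_itv/=.
have w01 : 0 <= w.2 <= 1.
  apply/andP; split; last by apply: (cw' _ _ c2) => v /R1 [_ /andP[]].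
  by rewrite -lerN2 oppr0; apply: (cw' _ _ c2') => v /R1 [_ /andP[v0 _]]; rewrite oppr_le0.
have wab : start O <= w.1 <= stop O.
  apply/andP; split; last by apply: (cw' _ _ c1) => v /R1 [/andP[]].
  by rewrite -lerN2; apply: (cw' _ _ c1') => v /R1 [/andP[v0 _] _]; rewrite lerN2.
apply: (all_segments_closed_cell (Phi := fun k t => U k (H (t, w.2))) (partition_increasing O) _ zn wab).
- apply: all_segments_impl (partition_increasing O) sub => x y k ax xy yb P t xty.
  exact: P.
- move=> x xp zx; apply: (cw' _ _ c1) => v /comp [_ /(_ x xp) [vx _]].
  exact/ltW/vx.
- move=> x xp xz; rewrite -lerN2; apply: (cw' _ _ c1') => v /comp [_ /(_ x xp) [_ xv]].
  by rewrite lerN2; apply/ltW/xv.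
Qed.

Lemma vertical_graph_restricts tau (Q : object X U) : 0 <= tau <= 1 -> tau \in [:: 0; 1] ->
  start Q = start O -> stop Q = stop O -> first_label Q = first_label O -> breaks Q = breaks O ->
  restricts_to G lab tau Q.
Proof.
move=> t01 te a1 b1 l1 br1; rewrite /restricts_to /points a1 b1 l1 br1; split.
  have := all_segments_label_at (partition_increasing O).
  apply: all_segments_impl (partition_increasing O) => x y k _ _ _ P s xsy.
  have [sn sk] := P s xsy; split=> // /vertical_graphP [/= sp _].
  by rewrite sp in sn.
move=> x xp; rewrite mem_cat; move: te; rewrite !inE => /orP[]/eqP ->; apply/orP; [left|right];
  by apply/mapP; exists x.
Qed.

Lemma smooth_chi : smooth setT chi.
Proof.
have oT : open [set: R * R] by exact: openT.
have Sf : smooth setT (fun z : R * R => z.1).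
  by apply: (@smooth_linear _ (R * R)%type R _ fst) => // x; apply: cvg_fst.
have Ss : smooth setT (fun z : R * R => z.2).
  by apply: (@smooth_linear _ (R * R)%type R _ snd) => // x; apply: cvg_snd.
have S0' : smooth setT (fun z : R * R => psi0 z.1).
  by apply: (smooth_comp (N := setT)) => //; exact: openT.
have S1' : smooth setT (fun z : R * R => psi1 z.1).
  by apply: (smooth_comp (N := setT)) => //; exact: openT.
by apply: smoothD => //; apply: smoothM => //; apply: smoothB.
Qed.

Lemma open_chi : open (chi @^-1` N).
Proof. by apply: open_comp oN => z _; apply: smooth_continuous smooth_chi _. Qed.

Lemma smooth_H : smooth_map X (chi @^-1` N) H.
Proof.
apply: (smooth_map_comp (@coordinates_line R) open_chi oN) Sq => // _.
by apply: smooth_sub smooth_chi.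
Qed.

(** The rank condition concerns every local extension [h] of [H], even at boundary points; its
    derivative must first be identified with that of [q \o chi]. *)
Lemma rank_one_H : rank_le1 X (rect (start O) (stop O)) H.
Proof.
move=> z V h c zr [oV Vz Sh Vh] cz.
have ab := object_lt O.
move: (zr); rewrite /rect /setX /= !in_itv/= => -[zab z01].
have hz : H z = h z by apply: Vh.
have Nz : N (chi z) by apply: subN.
have cz' : dom c (h z) by rewrite -hz.
have cq : dom c (q (chi z)) by exact: cz.
have dq := is_derive_map_coord (1 : R) oN Sq Nz cq.
(* [[e1, e2]] is a non-degenerate interval around or touching 0 on which [z + r *: v] stays in the
   rectangle; agreement of [h] with [H] there determines the derivative. *)
have key v (e1 e2 : R) : e1 < e2 -> e1 <= 0 <= e2 ->
    (forall r, e1 <= r <= e2 -> rect (start O) (stop O) (z + r *: v)) ->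
    'D_v (coord c \o h) z = 'D_v chi z *: 'D_1 (coord c \o q) (chi z).
  move=> e12 e0 inr; apply/rowP => l; rewrite mxE.
  have d1 := (is_derive_rowP _ _ _ _).1 (is_derive_map_coord v oV Sh Vz cz') l.
  have dl := (is_derive_rowP _ _ _ _).1 dq l.
  have dchi := smooth_is_derive v smooth_chi (I : setT z).
  have d2 := (is_derive_line0 _ _ _ _).1 dchi.
  have dl' : is_derive (chi (z + 0 *: v)) 1 (fun y => (coord c \o q) y 0 l)
      (('D_1 (coord c \o q) (chi z)) 0 l) by rewrite scale0r addr0.
  have d3 := is_derive1_comp (f := fun y : R => (coord c \o q) y 0 l)
    (g := fun r : R => chi (z + r *: v)) dl' d2.
  have d4 := (is_derive_line0 _ _ _ _).1 d1.
  have o0 : open [set r : R | V (z + r *: v)].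
    apply: (open_comp (f := fun r : R => z + r *: v)) oV => r _.
    by apply: cvgD; [apply: cvg_cst|apply: cvgZr_tmp; apply: cvg_id].
  have V0 : [set r : R | V (z + r *: v)] 0 by rewrite /= scale0r addr0.
  have /nbhs_ballP [d /= d0 Hd] := open_nbhs_nbhs (conj o0 V0).
  rewrite mulrC; apply: (derive_eq_within e12 e0 d0 d4 d3) => r rin rd.
  rewrite /= -Vh//; last exact: inr.
  by apply: Hd; rewrite -ball_normE /ball_/= distrC.
rewrite (key (1, 0) (start O - z.1) (stop O - z.1)); first last.
- move=> r rin; rewrite /rect /setX /= !in_itv/= scaler0 addr0 [r *: _]mulr1; split=> //.
  by move: rin; lra.
- by move: zab; lra.
- by lra.
rewrite (key (0, 1) (- z.2) (1 - z.2)); first last.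
- move=> r rin; rewrite /rect /setX /= !in_itv/= scaler0 addr0 [r *: _]mulr1; split=> //.
  by move: rin; lra.
- by move: z01; lra.
- by lra.
set u : 'rV_n := 'D_1 (coord c \o q) (chi z); move: u ('D_(1, 0) chi z) ('D_(0, 1) chi z) => u k l.
rewrite -addsmxE; apply: leq_trans (mxrankS _) (rank_leq_row u).
by rewrite addsmx_sub !scalemx_sub.
Qed.

Lemma thin_homotopy_lines : thin_homotopic O O'.
Proof.
exists H, G, lab; split.
- split.
  + move=> z; rewrite /rect /setX /= !in_itv/= => -[zab z01]; exists (chi @^-1` N), H.
    by split=> //; [exact: open_chi|exact: subN|exact: smooth_H].
  + by move=> x _; rewrite /H /chi /= mul0r mul1r addr0 subrKC pO pO'.
  + by move=> t _; rewrite /H /chi /= ea eb !subrr !mulr0 !addr0 -ea -eb !pO.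
- exact: rank_one_H.
- by split; [exact: vertical_graph_trivalent|exact: vertical_graph_labels].
- by split; apply: vertical_graph_restricts; rewrite ?lexx ?ler01 ?inE ?eqxx ?orbT.
- move=> t _; rewrite /lab /=; split=> _.
    exact: label_at_first (partition_increasing O).
  exact: label_at_last (partition_increasing O).
Qed.

End ThinHomotopy.

Lemma smooth_eq_cst (R : realType) (V W : normedModType R) (O : set V) (f : V -> W) a :
  open O -> (forall x, O x -> f x = a) -> smooth O f.
Proof. by move=> oO e; apply: smooth_ext (smooth_cst O a) => // x /e ->. Qed.

(** * Transport along segments inside one member of the cover *)

Section Segments.
Variables (R : realType) (n : nat) (M : topologicalType).
Variable X : smooth_atlas R n M.
Variables (J : Type) (U : J -> set M).
Hypothesis oU : forall i, open (U i).
Variable t : tqft_data X U.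
Hypothesis Ht : smooth_thin_invariant_tqft t.
Local Notation Z' := (Z_point t).
Local Notation Z := (Z_path t).

Lemma Z_point_id e i y : U i y -> Z' e i i y = 1.
Proof.
have [[[_ N1 _] coc _ _] _ _] := Ht => Ui.
have z0 := norm1_neq0 (N1 e i i y Ui Ui).
by apply: (mulfI z0); rewrite (coc e i i i) // mulr1.
Qed.

Lemma smooth_affine (O : set R) (k m : R) : open O -> smooth O (fun x => k * x + m).
Proof.
move=> oO; apply: smoothD => //; last exact: smooth_cst.
by apply: smoothM => //; [exact: smooth_cst|exact: smooth_id].
Qed.

Lemma increasing_affine (a b k m : R) : 0 < k ->
  increasing_diffeo a b (k * a + m) (k * b + m) (fun x => k * x + m).
Proof.
move=> k0; exists (fun y => k^-1 * y + (- (k^-1 * m))).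
have S (D : set R) (k' m' : R) : smooth_within D (fun x => k' * x + m').
  move=> x _; exists setT, (fun x => k' * x + m').
  by split=> //; [exact: openT|apply: smooth_affine; exact: openT].
split=> //.
- move=> x /andP[ax xb]; rewrite !lerD2r !ler_pM2l// ax xb; split=> //.
  by field; rewrite gt_eqF.
- move=> x /andP[ax xb].
  have E : k * (k^-1 * x + - (k^-1 * m)) + m = x by field; rewrite gt_eqF.
  split=> //; rewrite -(ler_pM2l k0) -(lerD2r m) E ax /=.
  by rewrite -(ler_pM2l k0) -(lerD2r m) E xb.
- by move=> x y _ xy _; rewrite ltrD2r ltr_pM2l.
Qed.

(** Axiom (ii) for the identity map. It does not relate the two partitions, so [Z] sees a partition
    only through its first and last labels. *)
Lemma Z_relabel (O O' : object X U) : start O = start O' -> stop O = stop O' ->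
  (forall x, start O <= x <= stop O -> O x = O' x) ->
  Z O' = Z' false (first_label O) (first_label O') (O (start O)) * Z O *
         Z' true (last_label O) (last_label O') (O (stop O)).
Proof.
have [[_ _ rep _] _ _] := Ht => sa sb e.
apply: (rep O O' (fun x => 1 * x + 0)).
  have := increasing_affine (start O) (stop O) (k := 1) 0 ltr01.
  by rewrite !mul1r !addr0 sa sb.
by move=> x xab; rewrite mul1r addr0 e.
Qed.

Lemma Z_affine (O O' : object X U) (k m : R) : 0 < k ->
  start O' = k * start O + m -> stop O' = k * stop O + m ->
  first_label O = first_label O' -> last_label O = last_label O' ->
  (forall x, start O <= x <= stop O -> O x = O' (k * x + m)) -> Z O = Z O'.
Proof.
have [[_ _ rep _] _ _] := Ht => k0 sa sb fl ll e.
have := rep O O' (fun x => k * x + m); rewrite sa sb -fl -ll => ->//.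
  by rewrite (Z_point_id _ (object_first O)) (Z_point_id _ (object_last O)) mul1r mulr1.
exact: increasing_affine.
Qed.

Lemma object_exists (N : set R) (p : R -> M) (psi : R -> R) (a b eps : R) i s :
  open N -> smooth_map X N p -> smooth setT psi -> (forall x, N (psi x)) -> 0 < eps ->
  (forall x, x < a + eps -> psi x = psi a) -> (forall x, b - eps < x -> psi x = psi b) ->
  all_segments (fun x y _ => x < y) a i s b ->
  all_segments (fun x y i => forall z, x <= z <= y -> U i (p (psi z))) a i s b ->
  exists O : object X U, [/\ forall x, O x = p (psi x), start O = a, stop O = b,
    first_label O = i & breaks O = s].
Proof.
move=> oN Sp Spsi Npsi e0 ha hb inc sub.
have SP : smooth_map X setT (fun x => p (psi x)).
  by apply: (smooth_map_comp (@coordinates_line R) openT oN) Sp.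
have sit : exists2 eps, 0 < eps & (forall x, x < a + eps -> p (psi x) = p (psi a)) /\
    (forall x, b - eps < x -> p (psi x) = p (psi b)).
  by exists eps => //; split=> x hx; [rewrite ha|rewrite hb].
by exists (Object SP sit inc sub).
Qed.

Definition is_segment i (q : R -> M) (O : object X U) : Prop :=
  [/\ forall x, O x = q (step x), start O = 0, stop O = 1, first_label O = i
    & breaks O = [::]].

(* [q] is reparametrised by [step] so that it sits at its end points; the value 1 is junk. *)
Definition transport i (q : R -> M) : R[i] :=
  if pselect (exists O, is_segment i q O) is left e then Z (sval (cid e)) else 1.

Lemma transportE i q O : is_segment i q O -> transport i q = Z O.
Proof.
move=> sO; rewrite /transport; case: pselect => [e|[]]; last by exists O.
case: (cid e) => O' sO' /=; case: sO sO' => [e1 a1 b1 l1 s1] [e2 a2 b2 l2 s2].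
apply: (@Z_affine _ _ 1 0); rewrite ?ltr01 ?a1 ?b1 ?a2 ?b2 ?mul1r ?addr0 ?l1 ?l2//.
  by rewrite /last_label /later_labels s1 s2 l1 l2.
by move=> x _; rewrite mul1r addr0 e1 e2.
Qed.

Lemma norm_transport i q : `|transport i q| = 1.
Proof.
have [[[_ _ N1] _ _ _] _ _] := Ht.
by rewrite /transport; case: pselect => [e|_]; rewrite ?normr1.
Qed.

Definition segment_in i (q : R -> M) : Prop := exists N,
  [/\ open N, smooth_map X N q & forall x, 0 <= x <= 1 -> N x /\ U i (q x)].

Lemma step01 (x : R) : 0 <= step x <= 1.
Proof. by rewrite step_ge0 step_le1. Qed.

Lemma segment_object i q : segment_in i q -> exists O, is_segment i q O.
Proof.
move=> [N [oN Sq Nq]].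
have [||||||Q [e1 a1 b1 l1 s1]] := @object_exists N q (@step R) 0 1 3^-1 i [::] oN Sq (@smooth_step R);
  last by exists Q; split.
- by move=> x; apply: (Nq _ (step01 x)).1.
- by [].
- by move=> x x3; rewrite !step0//; lra.
- by move=> x x3; rewrite !step1//; lra.
- exact: ltr01.
- by move=> z _; apply: (Nq _ (step01 z)).2.
Qed.

Lemma transport_ext i q q' : (forall x : R, 0 <= x <= 1 -> q x = q' x) -> transport i q = transport i q'.
Proof.
move=> e; have e' O : is_segment i q O <-> is_segment i q' O.
  by split=> -[e1 a1 b1 l1 s1]; split=> // x; rewrite e1 e// step01.
have [H|H] := pselect (exists O, is_segment i q O).
  by have [Q sQ] := H; rewrite (transportE sQ) (transportE ((e' Q).1 sQ)).
rewrite /transport; case: pselect => // _; case: pselect => // HQ.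
by case: H; have [Q sQ] := HQ; exists Q; apply: (e' Q).2.
Qed.

Lemma transport_label i j q : segment_in i q -> segment_in j q ->
  transport j q = Z' false i j (q 0) * transport i q * Z' true i j (q 1).
Proof.
move=> /segment_object[Q sQ] /segment_object[Q' sQ']; rewrite (transportE sQ) (transportE sQ').
case: sQ sQ' => [e1 a1 b1 l1 s1] [e2 a2 b2 l2 s2].
rewrite (@Z_relabel Q Q') ?a1 ?b1// => [|x _]; last by rewrite e1 e2.
by rewrite /last_label /later_labels s1 s2 l1 l2 !e1 step0 ?step1//=; lra.
Qed.

(** Multiplicativity, for [h] and [k] of any sign. Two segments run one after the other make a stop
    in the middle, unlike the single segment, and no diffeomorphism removes this stop; a thin
    homotopy does. *)
Lemma transport_concat i (p : R -> M) (N : set R) (c d x h k : R) :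
  open N -> smooth_map X N p -> (forall y, c <= y <= d -> N y /\ U i (p y)) ->
  c <= x <= d -> c <= x + h <= d -> c <= x + h + k <= d ->
  transport i (fun r => p (x + r * (h + k))) = transport i (fun r => p (x + r * h)) * transport i (fun r => p (x + h + r * k)).
Proof.
move=> oN Sp Np xcd hcd kcd.
have [[_ _ _ conc] thin _] := Ht.
have mid (u v r : R) : c <= u <= d -> c <= v <= d -> 0 <= r <= 1 -> c <= u + r * (v - u) <= d.
  by move=> /andP[? ?] /andP[? ?] /andP[? ?]; apply/andP; split; nra.
have m1 r : 0 <= r <= 1 -> c <= x + r * h <= d.
  by move=> r01; have := mid x (x + h) r xcd hcd r01; have -> : x + h - x = h by ring.
have m2 r : 0 <= r <= 1 -> c <= x + h + r * k <= d.
  by move=> r01; have := mid (x + h) (x + h + k) r hcd kcd r01; have -> : x + h + k - (x + h) = k by ring.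
have m3 r : 0 <= r <= 1 -> c <= x + r * (h + k) <= d.
  move=> r01; have := mid x (x + h + k) r xcd kcd r01.
  by have -> : x + h + k - x = h + k by ring.
have Sst (k' m' : R) : smooth setT (fun r => step (k' * r + m')).
  by apply: (smooth_comp (N := setT)) (@smooth_step R) => //; [exact: openT|exact: openT|apply: smooth_affine; exact: openT].
have Sm (w k' m' : R) : smooth setT (fun r => step (k' * r + m') * w).
  by apply: smoothM (smooth_cst _ _) => //; exact: openT.
(* [psi1] moves during [[0, 1]] and [psi2] during [[1, 2]]; [psi12] joins them with a stop at time
   1, and [psi3] covers the whole distance in one move over [[0, 2]]. *)
pose psi1 (s : R) := x + step (1 * s + 0) * h.
pose psi2 (s : R) := x + h + step (1 * s + - 1) * k.
pose psi12 (s : R) := x + step (1 * s + 0) * h + step (1 * s + - 1) * k.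
pose psi3 (s : R) := x + step (2^-1 * s + 0) * (h + k).
have S1 : smooth setT psi1 by apply: smoothD (smooth_cst _ _) _ => //; exact: openT.
have S2 : smooth setT psi2 by apply: smoothD (smooth_cst _ _) _ => //; exact: openT.
have S12 : smooth setT psi12 by apply: smoothD => //; exact: openT.
have S3 : smooth setT psi3 by apply: smoothD (smooth_cst _ _) _ => //; exact: openT.
have v1 s : c <= psi1 s <= d by apply: m1; exact: step01.
have v2 s : c <= psi2 s <= d by apply: m2; exact: step01.
have v3 s : c <= psi3 s <= d by apply: m3; exact: step01.
have e1 s : s <= 1 -> psi12 s = psi1 s.
  by move=> s1; rewrite /psi12 /psi1 (step0 (x := 1 * s + -1)) ?mul0r ?addr0//; lra.
have e2 s : 1 <= s -> psi12 s = psi2 s.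
  by move=> s1; rewrite /psi12 /psi2 (step1 (x := 1 * s + 0)) ?mul1r//; lra.
have v12 s : c <= psi12 s <= d.
  by have [s1|/ltW s1] := leP s 1; [rewrite e1|rewrite e2].
have [||||||O1 [p1 a1 b1 l1 s1]] := @object_exists N p psi1 0 1 3^-1 i [::] oN Sp S1.
- by move=> s; apply: (Np _ (v1 s)).1.
- by [].
- by move=> s hs; rewrite /psi1 !step0//; lra.
- by move=> s hs; rewrite /psi1 !step1//; lra.
- exact: ltr01.
- by move=> s _; apply: (Np _ (v1 s)).2.
have [||||||O2 [p2 a2 b2 l2 s2]] := @object_exists N p psi2 1 2 3^-1 i [::] oN Sp S2.
- by move=> s; apply: (Np _ (v2 s)).1.
- by [].
- by move=> s hs; rewrite /psi2 !step0//; lra.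
- by move=> s hs; rewrite /psi2 !step1//; lra.
- by rewrite /=; lra.
- by move=> s _; apply: (Np _ (v2 s)).2.
have [||||||O12 [p12 a12 b12 l12 s12]] := @object_exists N p psi12 0 2 3^-1 i [:: (1, i)] oN Sp S12.
- by move=> s; apply: (Np _ (v12 s)).1.
- by [].
- by move=> s hs; rewrite !e1 /psi1 ?step0//; lra.
- by move=> s hs; rewrite !e2 /psi2 ?step1//; lra.
- by rewrite /=; split; lra.
- by split=> s _; apply: (Np _ (v12 s)).2.
have [||||||O3 [p3 a3 b3 l3 s3]] := @object_exists N p psi12 0 2 3^-1 i [::] oN Sp S12.
- by move=> s; apply: (Np _ (v12 s)).1.
- by [].
- by move=> s hs; rewrite !e1 /psi1 ?step0//; lra.
- by move=> s hs; rewrite !e2 /psi2 ?step1//; lra.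
- by rewrite /=; lra.
- by move=> s _; apply: (Np _ (v12 s)).2.
have [||||||O4 [p4 a4 b4 l4 s4]] := @object_exists N p psi3 0 2 3^-1 i [::] oN Sp S3.
- by move=> s; apply: (Np _ (v3 s)).1.
- by [].
- by move=> s hs; rewrite /psi3 !step0//; lra.
- by move=> s hs; rewrite /psi3 !step1//; lra.
- by rewrite /=; lra.
- by move=> s _; apply: (Np _ (v3 s)).2.
have seg (w y : R) : (forall r, 0 <= r <= 1 -> c <= y + r * w <= d) -> segment_in i (fun r => p (y + r * w)).
  move=> H; pose V := [set r : R | N (y + r * w)].
  have S (D : set R) : open D -> smooth D (fun r : R => y + r * w).
    move=> oD; apply: smoothD (smooth_cst _ _) _ => //.
    by apply: smoothM (smooth_cst _ _) => //; exact: smooth_id.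
  have oV : open V.
    apply: open_comp oN => r _; apply: smooth_continuous (S setT openT) _; exact: I.
  exists V; split=> //; last by move=> r /H /Np.
  by apply: (smooth_map_comp (@coordinates_line R) oV oN (f := fun r : R => y + r * w)) Sp => // _; exact: S.
have [Y1 y1] := segment_object (seg _ _ m1).
have [Y2 y2] := segment_object (seg _ _ m2).
have [Y3 y3] := segment_object (seg _ _ m3).
rewrite (transportE y1) (transportE y2) (transportE y3).
have lab (O O' : object X U) i' : first_label O = i' -> first_label O' = i' -> breaks O = [::] ->
    breaks O' = [::] -> first_label O = first_label O' /\ last_label O = last_label O'.
  by rewrite /last_label /later_labels => -> -> -> ->.
case: y1 y2 y3 => [f1 A1 B1 L1 E1] [f2 A2 B2 L2 E2] [f3 A3 B3 L3 E3].
have -> : Z Y1 = Z O1.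
  apply: (@Z_affine _ _ 1 0); rewrite ?ltr01 ?A1 ?B1 ?mul1r ?addr0//.
  - exact: (lab _ _ _ L1 l1 E1 s1).1.
  - exact: (lab _ _ _ L1 l1 E1 s1).2.
  - by move=> r _; rewrite f1 p1 /psi1 !mul1r !addr0.
have -> : Z Y2 = Z O2.
  apply: (@Z_affine _ _ 1 1); rewrite ?ltr01 ?A2 ?B2 ?a2 ?b2 ?mul1r ?add0r//.
  - exact: (lab _ _ _ L2 l2 E2 s2).1.
  - exact: (lab _ _ _ L2 l2 E2 s2).2.
  - by move=> r _; rewrite f2 p2 /psi2 !mul1r addrK.
have -> : Z Y3 = Z O4.
  apply: (@Z_affine _ _ 2 0); rewrite ?A3 ?B3 ?a4 ?b4 ?mulr0 ?mulr1 ?addr0//.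
  - exact: (lab _ _ _ L3 l4 E3 s4).1.
  - exact: (lab _ _ _ L3 l4 E3 s4).2.
  - by move=> r _; rewrite f3 p4 /psi3 !addr0 mulrA mulVf ?mul1r// pnatr_eq0.
(* The only use of thin invariance here: [psi12] and [psi3] have the same end values on [[0, 2]],
   and interpolating between them remains in [[c, d]]. *)
have <- : Z O3 = Z O4.
  have [fl ll] := lab _ _ _ l3 l4 s3 s4.
  apply: thin => //; first by rewrite a3.
    by rewrite b3.
  apply: (@thin_homotopy_lines _ _ _ X _ U O3 O4 N p psi12 psi3) => //.
  - by rewrite a3.
  - by rewrite b3.
  - by rewrite s3.
  - by rewrite a3 /psi12 /psi3 !step0//; lra.
  - by rewrite b3 /psi12 /psi3 !step1//; lra.
  - by move=> s r _ r01; apply: (Np _ (mid _ _ _ (v12 s) (v3 s) r01)).1.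
  - by rewrite l3 s3 => s _ r r01; apply: (Np _ (mid _ _ _ (v12 s) (v3 s) r01)).2.
(* The same path, with a break at 1 inserted between two equal labels, so that axiom (iii)
   applies. *)
have -> : Z O3 = Z O12.
  apply: (@Z_affine _ _ 1 0); rewrite ?ltr01 ?a3 ?b3 ?mul1r ?addr0//.
  - by rewrite l3 l12.
  - by rewrite /last_label /later_labels s3 s12 l3.
  - by move=> r _; rewrite p3 p12 mul1r addr0.
have -> : Z O12 = Z O1 * Z' true (last_label O1) (first_label O2) (O1 (stop O1)) * Z O2.
  apply: conc; split; rewrite ?a1 ?a2 ?b1 ?b2 ?a12 ?b12 ?l1 ?l2 ?l12 ?s1 ?s2 ?s12//.
  - by rewrite p1 p2 -e1// e2.
  - by move=> s /andP[_ s1']; rewrite p1 p12 e1.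
  - by move=> s /andP[s1' _]; rewrite p2 p12 e2.
have [fl ll] := lab _ _ _ l1 l2 s1 s2.
by rewrite -fl /last_label /later_labels s1 /= Z_point_id ?mulr1// l1 p1; apply: (Np _ (v1 _)).2.
Qed.

Lemma Z_segment i q (O : object X U) : first_label O = i -> breaks O = [::] -> segment_in i q ->
  (forall x : R, 0 <= x <= 1 -> O ((stop O - start O) * x + start O) = q (step x)) -> Z O = transport i q.
Proof.
move=> lO sO /segment_object[Q sQ] e; rewrite (transportE sQ); case: sQ => [e1 a1 b1 l1 s1].
apply/esym/(@Z_affine _ _ (stop O - start O) (start O)).
- by rewrite subr_gt0; exact: object_lt.
- by rewrite a1 mulr0 add0r.
- by rewrite b1 mulr1 subrK.
- by rewrite lO l1.
- by rewrite /last_label /later_labels lO l1 sO s1.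
- by rewrite a1 b1 => x x01; rewrite e1 e.
Qed.

Lemma segment_in_cst i y : U i y -> segment_in i (fun=> y).
Proof.
by move=> Uy; exists setT; split=> //; [exact: openT|exact: smooth_map_cst].
Qed.

(** A constant segment followed by itself is itself, so its transport is an idempotent of modulus
    1. *)
Lemma transport_cst i y : U i y -> transport i (fun=> y) = 1.
Proof.
move=> Uy; have := @transport_concat i (fun=> y) setT 0 0 0 0 0 openT (smooth_map_cst X _ y).
rewrite !addr0 lexx => /(_ (fun _ _ => conj I Uy) isT isT isT) e.
by apply: (mulfI (norm1_neq0 (norm_transport i (fun=> y)))); rewrite mulr1 -e.
Qed.

(** Relabelling a constant segment, whose transport is 1 in both labels, forces the product of the
    two signs of [Z'] to be 1. *)
Lemma Z_point_false i j y : U i y -> U j y -> Z' false i j y = (Z' true i j y)^*.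
Proof.
have [[[_ N1 _] _ _ _] _ _] := Ht => Ui Uj.
have := transport_label (segment_in_cst Ui) (segment_in_cst Uj); rewrite !transport_cst// mulr1 => e.
apply: (mulIf (norm1_neq0 (N1 true i j y Ui Uj))).
by rewrite -e norm1_conj// N1.
Qed.

(** The segments reparametrised by [step] form a smooth family of objects with fixed interval, fixed
    label and no breaks, so the smoothness axiom applies. *)
Lemma smooth_transport i k (W : set 'rV[R]_k) (N : set ('rV[R]_k * R)%type) (Q : 'rV[R]_k * R -> M) :
  open W -> open N -> smooth_map X N Q ->
  (forall u x, W u -> 0 <= x <= 1 -> N (u, x) /\ U i (Q (u, x))) ->
  smoothC W (fun u => transport i (fun x => Q (u, x))).
Proof.
move=> oW oN SQ NQ; have [_ _ smo] := Ht.
have seg u : W u -> segment_in i (fun x => Q (u, x)).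
  move=> Wu; pose V := [set x : R | N (u, x)].
  have oV : open V.
    apply: (open_comp (f := fun x : R => (u, x))) oN => x _.
    by apply: continuous_rowpair; [exact: cvg_cst|exact: cvg_id].
  exists V; split=> //; last by move=> x x01; apply: NQ.
  apply: (smooth_map_rowpair_comp oV oN (u := fun=> u) (v := fun x : R => x)) => //.
    exact: smooth_cst.
  exact: smooth_id.
have [[w0 W0]|W0] := pselect (exists w, W w); last first.
  by split; apply: smooth_local => x Wx; case: W0; exists x.
(* The family must be defined for every [u]; outside [W] the object over [w0] serves as a
   default. *)
have : forall u, exists Q', W u -> is_segment i (fun x => Q (u, x)) Q'.
  move=> u; have [Wu|Wu] := pselect (W u).
    by have [Q' sQ'] := segment_object (seg u Wu); exists Q'.
  by have [Q' sQ'] := segment_object (seg w0 W0); exists Q'.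
move=> /choice[F HF].
apply: (@smoothC_ext _ _ W oW (fun u => Z (F u))) => [u Wu|]; first by rewrite (transportE (HF u Wu)).
apply: smo => //; split.
- by split; [apply: (smooth_eq_cst (a := 0 : R))|apply: (smooth_eq_cst (a := 1 : R))] => // u /HF [].
- by move=> u v /HF [_ _ _ -> bu] /HF [_ _ _ -> bv]; rewrite /later_labels bu bv.
- move=> m; apply: (smooth_eq_cst (a := 0 : R)) => //.
  by move=> u /HF [_ _ _ _ bu]; rewrite /points bu nth_nil.
- move=> [u x] [/= Wu _]; exists (fst @^-1` W), (fun z => Q (z.1, step z.2)).
  have oP : open (fst @^-1` W : set ('rV[R]_k * R)%type).
    by apply: open_comp oW => z _; apply: cvg_fst.
  split=> //; last by move=> z Wz _; have [-> _ _ _ _] := HF z.1 Wz.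
  apply: (smooth_map_rowpair_comp oP oN) SQ => [z Wz||].
  + exact: (NQ _ _ Wz (step01 _)).1.
  + by apply: (@smooth_linear _ ('rV[R]_k * R)%type 'rV[R]_k _ fst) => // z; apply: cvg_fst.
  + apply: (@smooth_comp _ _ _ setT (@step R)) => //; [exact: openT| |exact: smooth_step].
    by apply: (@smooth_linear _ ('rV[R]_k * R)%type R _ snd) => // z; apply: cvg_snd.
Qed.

(** [Z'] is itself a value of [Z]: on the constant path at [y] over [[0, 2]], with label [i] before
    1 and [j] after, both constant pieces contribute 1. The smoothness axiom then applies to these
    paths. *)
Lemma smooth_Z_point i j : smooth_functionC X (U i `&` U j) (Z' true i j).
Proof.
move=> c; set W := coord c @` _.
have oW : open W by apply: chart_image_open; apply: openI.
have [[_ _ _ conc] _ smo] := Ht.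
have [[w0 W0]|W0] := pselect (exists w, W w); last first.
  by split; apply: smooth_local => x Wx; case: W0; exists x.
have obj y a b k s : a < b -> all_segments (fun x y _ => x < y) a k s b ->
    all_segments (fun x z k => forall r, x <= r <= z -> U k y) a k s b ->
    exists Q : object X U, [/\ forall x, Q x = y, start Q = a, stop Q = b,
    first_label Q = k & breaks Q = s].
  move=> ab inc sub.
  apply: (@object_exists setT (fun=> y) (fun=> 0) a b 1 k s) => //;
    by [exact: openT|exact: smooth_map_cst|exact: smooth_cst].
have one y a b k : a < b -> U k y -> exists Q : object X U, [/\ [/\ forall x, Q x = y, start Q = a, stop Q = b,
    first_label Q = k & breaks Q = [::]] & Z Q = 1].
  move=> ab Uk; have [//|//|Q [e1 a1 b1 l1 s1]] := obj y a b k [::] ab.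
  exists Q; split=> //; rewrite (Z_segment l1 s1 (segment_in_cst Uk)) ?transport_cst//.
have two y : U i y -> U j y -> exists Q : object X U, [/\ [/\ forall x, Q x = y, start Q = 0, stop Q = 2,
    first_label Q = i & breaks Q = [:: (1, j)]] & Z Q = Z' true i j y].
  move=> Ui Uj; have [|||Q [e1 a1 b1 l1 s1]] := obj y 0 2 i [:: (1, j)].
  - by lra.
  - by split=> /=; lra.
  - by split.
  exists Q; split=> //.
  have [Q1 [[e2 a2 b2 l2 s2] z2]] := one y 0 1 i ltr01 Ui.
  have l12 : (1 : R) < 2 by lra.
  have [Q2 [[e3 a3 b3 l3 s3] z3]] := one y 1 2 j l12 Uj.
  have -> : Z Q = Z Q1 * Z' true (last_label Q1) (first_label Q2) (Q1 (stop Q1)) * Z Q2.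
    by apply: conc; split; rewrite ?a1 ?b1 ?l1 ?s1 ?a2 ?b2 ?l2 ?s2 ?a3 ?b3 ?l3 ?s3 ?e2 ?e3// => x _;
      rewrite e1 ?e2 ?e3.
  by rewrite z2 z3 mul1r mulr1 e2 l3 /last_label /later_labels s2 l2.
have : forall u, exists Q : object X U, W u -> [/\ [/\ forall x, Q x = param c u, start Q = 0, stop Q = 2,
    first_label Q = i & breaks Q = [:: (1, j)]] & Z Q = Z' true i j (param c u)].
  have H u : W u -> U i (param c u) /\ U j (param c u) by move=> /chart_imageP[[? ?] _ _].
  move=> u; have [Wu|Wu] := pselect (W u).
    by have [Q sQ] := two _ (H u Wu).1 (H u Wu).2; exists Q.
  by have [Q sQ] := two _ (H _ W0).1 (H _ W0).2; exists Q.
move=> /choice[F HF].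
apply: (@smoothC_ext _ _ W oW (fun u => Z (F u))) => [u Wu|]; first by have [_ ->] := HF u Wu.
apply: smo => //; split.
- by split; [apply: (smooth_eq_cst (a := 0 : R))|apply: (smooth_eq_cst (a := 2 : R))] => // u /HF [[]].
- by move=> u v /HF [[_ _ _ -> bu] _] /HF [[_ _ _ -> bv] _]; rewrite /later_labels bu bv.
- move=> m; apply: (smooth_eq_cst (a := nth (0 : R) [:: 1] m)) => //.
  by move=> u /HF [[_ _ _ _ bu] _]; rewrite /points bu.
- move=> [u x] [/= Wu _]; exists (fst @^-1` W), (fun z => param c z.1).
  have oP : open (fst @^-1` W : set ('rV[R]_n * R)%type).
    by apply: open_comp oW => z _; apply: cvg_fst.
  split=> //; last by move=> z Wz _; have [[-> _ _ _ _] _] := HF z.1 Wz.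
  apply: smooth_map_param => //; last by move=> z [y [_ dy] <-]; exists y.
  by apply: (@smooth_linear _ ('rV[R]_n * R)%type 'rV[R]_n _ fst) => // z; apply: cvg_fst.
Qed.

End Segments.

(** * The bundle of a TQFT *)

Section ComplexDerivative.
Variable R : realType.

Lemma Re_addc (u v : R[i]) : complex.Re (u + v) = complex.Re u + complex.Re v.
Proof. by case: u; case: v. Qed.

Lemma Im_addc (u v : R[i]) : complex.Im (u + v) = complex.Im u + complex.Im v.
Proof. by case: u; case: v. Qed.

Definition is_deriveC (x : R) (f : R -> R[i]) (l : R[i]) : Prop :=
  is_derive x 1 (fun r => complex.Re (f r)) (complex.Re l) /\
  is_derive x 1 (fun r => complex.Im (f r)) (complex.Im l).

Lemma is_deriveC_unique x f l m : is_deriveC x f l -> is_deriveC x f m -> l = m.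
Proof.
move=> [a b] [c d]; apply: complex_ext.
  by rewrite -(@derive_val _ _ _ _ _ _ _ a) -(@derive_val _ _ _ _ _ _ _ c).
by rewrite -(@derive_val _ _ _ _ _ _ _ b) -(@derive_val _ _ _ _ _ _ _ d).
Qed.

Lemma is_deriveC_mul x f g l m : is_deriveC x f l -> is_deriveC x g m ->
  is_deriveC x (fun r => f r * g r) (l * g x + f x * m).
Proof.
move=> [a b] [c d]; split.
  have h := is_deriveB (is_deriveM a c) (is_deriveM b d).
  rewrite (_ : (fun r => _) = (fun r => complex.Re (f r)) * (fun r => complex.Re (g r)) -
      (fun r => complex.Im (f r)) * (fun r => complex.Im (g r))); last first.
    by apply/funext => r; rewrite Re_mulc.
  apply: is_derive_eq h _.
  by rewrite Re_addc !Re_mulc /GRing.scale/=; ring.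
have h := is_deriveD (is_deriveM a d) (is_deriveM b c).
rewrite (_ : (fun r => _) = (fun r => complex.Re (f r)) * (fun r => complex.Im (g r)) +
    (fun r => complex.Im (f r)) * (fun r => complex.Re (g r))); last first.
  by apply/funext => r; rewrite Im_mulc.
apply: is_derive_eq h _.
by rewrite Im_addc !Im_mulc /GRing.scale/=; ring.
Qed.

Lemma is_deriveC_cst x (a : R[i]) : is_deriveC x (fun=> a) 0.
Proof. by split; apply: is_derive_cst. Qed.

Lemma is_deriveC_ext (N : set R) x f g l : open N -> N x -> (forall y, N y -> f y = g y) ->
  is_deriveC x f l -> is_deriveC x g l.
Proof.
move=> oN Nx e [a b]; split; [apply: is_derive_ext oN Nx _ a|apply: is_derive_ext oN Nx _ b].
  by move=> y /e ->.
by move=> y /e ->.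
Qed.

(** Differentiating [Re^2 + Im^2 = 1] at a point where [f] is 1 leaves [2 * l = 0]. A unit function
    leaves 1 in an imaginary direction. *)
Lemma Re_derive_unit x (f : R -> R[i]) (l m : R) : (forall r, `|f r| = 1) -> f x = 1 ->
  is_derive x 1 (fun r => complex.Re (f r)) l -> is_derive x 1 (fun r => complex.Im (f r)) m ->
  l = 0.
Proof.
move=> f1 fx a b.
have h := is_deriveD (is_deriveM a a) (is_deriveM b b).
have e : ((fun r => complex.Re (f r)) * (fun r => complex.Re (f r)) +
    (fun r => complex.Im (f r)) * (fun r => complex.Im (f r))) = (fun=> 1).
  by apply/funext => r; rewrite -(norm1_sqr (f1 r)) /= !expr2.
rewrite e in h; have := @derive_val _ _ _ _ _ _ _ h.
by rewrite (derive_cst) fx /= /GRing.scale/=; lra.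
Qed.

(** The factor [g x] is the integral over [s] in [[0, 1]] of the derivative of [f] at [s * x], a
    smooth parameter integral. *)
Lemma hadamard (f : R -> R) (d : R) : smooth (ball 0 d) f -> 0 < d ->
  exists2 g : R -> R, smooth (ball 0 d) g & forall x : R, ball 0 d x -> f x = f 0 + x * g x.
Proof.
move=> Sf d0.
have oB : open (ball (0 : R) d) by exact: ball_open.
have inB (x s : R) : ball 0 d x -> 0 <= s <= 1 -> ball 0 d (s * x).
  rewrite -ball_normE /ball_/= !sub0r !normrN normrM => xd /andP[s0 s1].
  by rewrite ger0_norm//; apply: le_lt_trans xd; rewrite ler_piMl.
have Sf' : smooth (ball 0 d) (fun x => 'D_1 f x) by exact: smooth_derive.
exists (fun x => \int[lebesgue_measure]_(s in `[0, 1]) 'D_1 f (s * x)).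
  apply: smooth_integral01 => // x s Bx s01.
  exists [set w : R * R | ball 0 d (w.2 * w.1)], (fun w => 'D_1 f (w.2 * w.1)).
  have Sm (D : set (R * R)) : open D -> smooth D (fun w : R * R => w.2 * w.1).
    move=> oD; apply: smoothM => //.
      by apply: (@smooth_linear _ (R * R)%type R _ snd) => // z; apply: cvg_snd.
    by apply: (@smooth_linear _ (R * R)%type R _ fst) => // z; apply: cvg_fst.
  have oN : open [set w : R * R | ball 0 d (w.2 * w.1)].
    apply: (open_comp (f := fun w : R * R => w.2 * w.1)) oB => w _.
    exact: smooth_continuous (Sm setT openT) _.
  split=> //; first exact: inB.
  by apply: (@smooth_comp _ _ _ (ball 0 d) ('D_1 f) (fun w : R * R => w.2 * w.1)) => //; exact: Sm.
move=> x Bx.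
have dl (s : R) : 0 <= s <= 1 -> is_derive s 1 (fun r : R => f (r * x)) (x * 'D_1 f (s * x)).
  move=> s01.
  have h1 := smooth_is_derive (1 : R) Sf (inB x s Bx s01).
  have h2 : is_derive s 1 (fun r : R => r * x) x.
    have h := is_deriveM (is_derive_id s (1 : R)) (is_derive_cst x s (1 : R)).
    by apply: is_derive_eq h _; rewrite scaler0 add0r /GRing.scale/= mulr1.
  have := is_derive1_comp (f := f) (g := fun r : R => r * x) h1 h2.
  by rewrite mulrC.
have [th pth _] : exists2 th, primitive (fun s => 'D_1 f (s * x)) 0 1 th & forall y, 0 <= y <= 1 ->
    \int[lebesgue_measure]_(t in `[0, y]) 'D_1 f (t * x) = th y - th 0.
  apply: primitive_exists => //; apply: seg_continuous_at => s s01.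
  have c1 : {for s * x, continuous (fun y => 'D_1 f y)} by apply: smooth_continuous Sf' _; exact: inB.
  apply: (continuous_comp (f := fun s : R => s * x) (g := fun y => 'D_1 f y)) => //.
  by apply: mulrr_continuous.
have p1 : primitive (fun s => x * 'D_1 f (s * x)) 0 1 (fun r : R => f (r * x)).
  split; first by apply: seg_continuous_at => s s01; exact: is_derive_continuous (dl s s01).
  by move=> s s0 s1; apply: dl; rewrite !ltW.
rewrite (integral_primitive _ _ pth)//; last first.
  apply: seg_continuous_at => s s01.
  have c1 : {for s * x, continuous (fun y => 'D_1 f y)} by apply: smooth_continuous Sf' _; exact: inB.
  apply: (continuous_comp (f := fun s : R => s * x) (g := fun y => 'D_1 f y)) => //.
  by apply: mulrr_continuous.
have := primitive_unique ler01 (primitiveZ x pth) p1.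
by rewrite mul1r mul0r mulrBr => ->; ring.
Qed.

End ComplexDerivative.

(** * The connection form of a TQFT *)

Section Connection.
Variables (R : realType) (n : nat) (M : topologicalType).
Variable X : smooth_atlas R n M.
Variables (J : Type) (U : J -> set M).
Hypothesis oU : forall i, open (U i).
Variable t : tqft_data X U.
Hypothesis Ht : smooth_thin_invariant_tqft t.
Local Notation Z' := (Z_point t).
Local Notation Z := (Z_path t).
Local Notation transport := (transport t).

Definition radial (c : chart X) (x w : 'rV[R]_n) (s : R) : M := param c (x + s *: w).

Lemma smooth_lsubmx (V : normedModType R) m p (O : set V) (f : V -> 'rV[R]_(m + p)) :
  open O -> smooth O f -> smooth O (fun x => lsubmx (f x)).
Proof.
move=> oO Sf; apply: smooth_row => // j.
apply: (smooth_ext oO _ (smooth_coord (lshift p j) oO Sf)) => x _.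
by rewrite mxE.
Qed.

Lemma smooth_rsubmx (V : normedModType R) m p (O : set V) (f : V -> 'rV[R]_(m + p)) :
  open O -> smooth O f -> smooth O (fun x => rsubmx (f x)).
Proof.
move=> oO Sf; apply: smooth_row => // j.
apply: (smooth_ext oO _ (smooth_coord (rshift m j) oO Sf)) => x _.
by rewrite mxE.
Qed.

Lemma smooth_row_mx (V : normedModType R) m p (O : set V) (f : V -> 'rV[R]_m) (g : V -> 'rV[R]_p) :
  open O -> smooth O f -> smooth O g -> smooth O (fun x => row_mx (f x) (g x)).
Proof.
move=> oO Sf Sg; apply: smooth_row => // j; case: (split_ordP j) => k ->.
  by apply: (smooth_ext oO _ (smooth_coord k oO Sf)) => x _; rewrite row_mxEl.
by apply: (smooth_ext oO _ (smooth_coord k oO Sg)) => x _; rewrite row_mxEr.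
Qed.

Lemma smooth_scale (V : normedModType R) m (O : set V) (k : V -> R) (g : V -> 'rV[R]_m) :
  open O -> smooth O k -> smooth O g -> smooth O (fun x => k x *: g x).
Proof.
move=> oO Sk Sg; apply: smooth_row => // j.
by apply: (smooth_ext oO _ (smoothM oO Sk (smooth_coord j oO Sg))) => x _; rewrite mxE.
Qed.

Lemma smooth_fst (V V' : normedModType R) (O : set (V * V')%type) : open O ->
  smooth O (fun z => z.1).
Proof.
move=> oO; apply: (@smooth_linear _ (V * V')%type V _ fst) => // z; exact: cvg_fst.
Qed.

Lemma smooth_snd (V V' : normedModType R) (O : set (V * V')%type) : open O ->
  smooth O (fun z => z.2).
Proof.
move=> oO; apply: (@smooth_linear _ (V * V')%type V' _ snd) => // z; exact: cvg_snd.
Qed.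

(** Joint smoothness in the base point and the direction. The two are packed into one row of length
    [n + n] because smooth families of objects are parametrised by row vectors. *)
Lemma smooth_radial j c x0 : chart_image c (U j) x0 -> exists2 r : R, 0 < r &
  let W := [set u : 'rV[R]_(n + n) | ball x0 r (lsubmx u) /\ ball 0 r (rsubmx u)] in
  open W /\ smoothC W (fun u => transport j (radial c (lsubmx u) (rsubmx u))).
Proof.
move=> Wx0.
have oW0 : open (chart_image c (U j)) by exact: chart_image_open.
have /nbhs_ballP[d /= d0 Hd] := open_nbhs_nbhs (conj oW0 Wx0).
(* Half for the base point and half for the direction, so that [x + s *: w] stays within distance
   [d] of [x0]. *)
exists (d / 2); first by lra.
set W := [set u | _].
have SI : smooth setT (fun u : 'rV[R]_(n + n) => u) by apply: smooth_id; exact: openT.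
have oW : open W.
  apply: openI.
    apply: (open_comp (f := fun u : 'rV[R]_(n + n) => lsubmx u)); last exact: ball_open.
    by move=> u _; apply: smooth_continuous (smooth_lsubmx openT SI) _.
  apply: (open_comp (f := fun u : 'rV[R]_(n + n) => rsubmx u)); last exact: ball_open.
  by move=> u _; apply: smooth_continuous (smooth_rsubmx openT SI) _.
split=> //.
have SF (O : set ('rV[R]_(n + n) * R)%type) : open O ->
    smooth O (fun z : 'rV[R]_(n + n) * R => lsubmx z.1 + z.2 *: rsubmx z.1).
  move=> oO; apply: smoothD => //; first by apply: smooth_lsubmx => //; exact: smooth_fst.
  by apply: smooth_scale => //; [exact: smooth_snd|apply: smooth_rsubmx => //; exact: smooth_fst].
pose N := [set z : 'rV[R]_(n + n) * R | chart_image c (U j) (lsubmx z.1 + z.2 *: rsubmx z.1)].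
have oN : open N.
  apply: (open_comp (f := fun z : 'rV[R]_(n + n) * R => lsubmx z.1 + z.2 *: rsubmx z.1)) => // z _.
  exact: smooth_continuous (SF setT openT) _.
rewrite /radial; apply: (smooth_transport Ht (N := N) (Q := fun z => param c (lsubmx z.1 + z.2 *: rsubmx z.1))) => //.
  apply: smooth_map_param => //; first exact: SF.
  by move=> z [y [_ dy] <-]; exists y.
move=> u s [ul ur] /andP[s0 s1].
have Nus : N (u, s).
  apply: Hd; rewrite -ball_normE /ball_/= opprD addrA.
  apply: le_lt_trans (ler_normB _ _) _.
  move: ul ur; rewrite -!ball_normE /ball_/= sub0r normrN => ul ur.
  rewrite normrZ (ger0_norm s0).
  have : s * `|rsubmx u| <= `|rsubmx u| by rewrite ler_piMl.
  by lra.
by split=> //; have [] := chart_imageP Nus.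
Qed.

Lemma smooth_radial_at j c x0 : chart_image c (U j) x0 -> exists2 r : R, 0 < r &
  smoothC (ball (0 : 'rV[R]_n) r) (fun w => transport j (radial c x0 w)).
Proof.
move=> /smooth_radial[r r0 [oW [S1 S2]]]; exists r => //.
have oB : open (ball (0 : 'rV[R]_n) r) by exact: ball_open.
have Srow : smooth (ball (0 : 'rV[R]_n) r) (fun w => row_mx x0 w).
  by apply: smooth_row_mx => //; [exact: smooth_cst|exact: smooth_id].
have Wrow w : ball (0 : 'rV[R]_n) r w -> ball x0 r (lsubmx (row_mx x0 w)) /\ ball 0 r (rsubmx (row_mx x0 w)).
  by rewrite row_mxKl row_mxKr => wr; split=> //; exact: ballxx.
split.
  apply: smooth_ext (smooth_comp_row oB oW Wrow Srow S1) => // w _.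
  by rewrite /= row_mxKl row_mxKr.
apply: smooth_ext (smooth_comp_row oB oW Wrow Srow S2) => // w _.
by rewrite /= row_mxKl row_mxKr.
Qed.

(* The derivative at 0 of the transport along the straight lines, in the chart [c], issuing
   from [y]. *)
Definition tqft_connection (j : J) (c : chart X) (y : M) : 'rV[R]_n :=
  if `[< U j y /\ dom c y >] then
    \row_l 'D_(delta_mx 0 l) (fun w : 'rV[R]_n => complex.Im (transport j (radial c (coord c y) w))) 0
  else 0.

Lemma tqft_connectionE j c y l : U j y -> dom c y -> tqft_connection j c y 0 l =
  'D_(delta_mx 0 l) (fun w : 'rV[R]_n => complex.Im (transport j (radial c (coord c y) w))) 0.
Proof. by move=> Uy cy; rewrite /tqft_connection asboolT// mxE. Qed.

Lemma radial0 j c y : U j y -> dom c y -> transport j (radial c (coord c y) 0) = 1.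
Proof.
move=> Uy cy; rewrite -(transport_cst Ht Uy); apply: transport_ext => // s _.
by rewrite /radial scaler0 addr0 coordK.
Qed.

(** Linearity in [v] is the chain rule at 0 for the function [w |-> transport] of the line in
    direction [w], smooth by [smooth_radial_at]. The real part vanishes since the transport has
    modulus 1 and is 1 at [h = 0]. *)
Lemma radial_derive j c y (v : 'rV[R]_n) : U j y -> dom c y ->
  is_deriveC 0 (fun h : R => transport j (radial c (coord c y) (h *: v)))
    (0 +i* (\sum_m tqft_connection j c y 0 m * v 0 m))%C.
Proof.
move=> Uy cy; have [r r0 [S1 S2]] := smooth_radial_at (chart_image_coord Uy cy).
have oB : open (ball (0 : 'rV[R]_n) r) by exact: ball_open.
have B0 : ball (0 : 'rV[R]_n) r ((0 : R) *: v) by rewrite scale0r; exact: ballxx.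
have dv i : is_derive (0 : R) 1 (fun h : R => (h *: v) 0 i) (v 0 i).
  have -> : (fun h : R => (h *: v) 0 i) = (fun h : R => h * v 0 i) by apply/funext => h; rewrite mxE.
  have h := is_deriveM (is_derive_id (0 : R) (1 : R)) (is_derive_cst (v 0 i) (0 : R) (1 : R)).
  by apply: is_derive_eq h _; rewrite scaler0 add0r /GRing.scale/= mulr1.
have d1 := is_derive_comp_coord (f := fun h : R => h *: v) (@coordinates_row R n) oB B0 (S1 1%N) dv.
have d2 := is_derive_comp_coord (f := fun h : R => h *: v) (@coordinates_row R n) oB B0 (S2 1%N) dv.
split=> /=.
  apply: is_derive_eq (d1) _; apply: (Re_derive_unit (f := fun h : R => transport j (radial c (coord c y) (h *: v))) _ _ d1 d2).
    by move=> s; apply: norm_transport.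
  by rewrite scale0r radial0.
apply: is_derive_eq d2 _; apply: eq_bigr => m _.
by rewrite scale0r tqft_connectionE// mulrC.
Qed.

(** The connection is a partial derivative, in the second block of variables and at [w = 0], of the
    jointly smooth function of [smooth_radial]. *)
Lemma smooth_tqft_connection j c : smooth (chart_image c (U j)) (fun x => tqft_connection j c (param c x)).
Proof.
apply: smooth_local => x0 Wx0; have [r r0 [oW [_ S2]]] := smooth_radial Wx0.
have oW0 : open (chart_image c (U j)) by exact: chart_image_open.
have oN : open (ball x0 r `&` chart_image c (U j)) by apply: openI => //; exact: ball_open.
exists (ball x0 r `&` chart_image c (U j)); first by split=> //; exact: ballxx.
apply: smooth_row => // l.
set W := [set u | _] in oW S2; set B := fun u : 'rV[R]_(n + n) => _ in S2.
have Srow : smooth (ball x0 r `&` chart_image c (U j)) (fun x => row_mx x (0 : 'rV[R]_n)).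
  by apply: smooth_row_mx => //; [exact: smooth_id|exact: smooth_cst].
have Wrow x : (ball x0 r `&` chart_image c (U j)) x -> W (row_mx x (0 : 'rV[R]_n)).
  by move=> [xr _]; rewrite /W/= row_mxKl row_mxKr; split=> //; exact: ballxx.
apply: smooth_ext (smooth_comp_row oN oW Wrow Srow (smooth_derive (row_mx 0 (delta_mx 0 l)) S2)) => // x.
move=> [xr Wx]; have [Ux cx cxE] := chart_imageP Wx; rewrite (tqft_connectionE l Ux cx) cxE.
have d1 := (is_derive_line0 _ _ _ _).1 (smooth_is_derive (row_mx 0 (delta_mx 0 l)) S2 (Wrow x (conj xr Wx))).
apply/esym/derive_val/(is_derive_line0 _ _ _ _).2.
apply: is_derive_ext openT I _ d1 => h _.
by rewrite /B scale_row_mx add_row_mx scaler0 addr0 add0r row_mxKl row_mxKr.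
Qed.

End Connection.

(** * The reconstructed bundle, and transport as an exponential *)

Section Reconstruction.
Variables (R : realType) (n : nat) (M : topologicalType).
Variable X : smooth_atlas R n M.
Variables (J : Type) (U : J -> set M).
Hypothesis oU : forall i, open (U i).
Variable t : tqft_data X U.
Hypothesis Ht : smooth_thin_invariant_tqft t.
Local Notation Z' := (Z_point t).
Local Notation Z := (Z_path t).
Local Notation transport := (transport t).
Local Notation tqft_connection := (tqft_connection t).

(* In the chart, Hadamard's lemma gives [q (x0 + k) = y0 + k * eta k]. The two-parameter family
   of curves [s |-> y0 + s * u0 * eta (s * u1)] is [q] on the diagonal, the tangent line of [q] on
   [u1 = 0] and constant on [u0 = 0], so both have the same derivative at 0. *)
Lemma transport_derive j c (q : R -> M) (N : set R) (x0 : R) :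
  open N -> smooth_map X N q -> N x0 -> U j (q x0) -> dom c (q x0) ->
  is_deriveC 0 (fun h : R => transport j (fun s => q (x0 + s * h)))
    (0 +i* (\sum_m tqft_connection j c (q x0) 0 m * ('D_1 (coord c \o q) x0) 0 m))%C.
Proof.
move=> oN Sq Nx0 Ux0 cx0.
set W := chart_image c (U j).
have oW : open W by exact: chart_image_open.
pose N1 := N `&` q @^-1` (U j `&` dom c).
have oN1 : open N1 by exact: smooth_map_open oN Sq (openI (oU j) (dom_open c)).
have N1x0 : N1 x0 by split.
have SN1 : smooth N1 (fun x => coord c (q x)).
  by apply: smooth_map_coord => //; [apply: smooth_map_sub Sq => x []|move=> x [_ []]].
have /nbhs_ballP[d /= d0 Hd] := open_nbhs_nbhs (conj oN1 N1x0).
have oB : open (ball (0 : R) d) by exact: ball_open.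
have sh x : ball (0 : R) d x -> N1 (x0 + x).
  by move=> xd; apply: Hd; move: xd; rewrite -!ball_normE /ball_/= opprD addNKr sub0r.
have Sxi : smooth (ball (0 : R) d) (fun x => coord c (q (x0 + x))).
  apply: smooth_row => // l.
  apply: (smooth_comp (N := N1) (g := fun x => coord c (q x) 0 l)) => //.
    by apply: smoothD => //; [exact: smooth_cst|exact: smooth_id].
  exact: smooth_coord.
have : forall l, exists g : R -> R, smooth (ball 0 d) g /\ forall x : R, ball 0 d x ->
    coord c (q (x0 + x)) 0 l = coord c (q (x0 + 0)) 0 l + x * g x.
  by move=> l; have [g Sg Eg] := hadamard (smooth_coord l oB Sxi) d0; exists g.
move=> /choice[eta0 H0].
pose eta (x : R) : 'rV[R]_n := \row_l eta0 l x.
have Seta : smooth (ball (0 : R) d) eta.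
  apply: smooth_row => // l; apply: smooth_ext (H0 l).1 => // x _.
  by rewrite mxE.
have Eeta x : ball (0 : R) d x -> coord c (q (x0 + x)) = coord c (q x0) + x *: eta x.
  by move=> xd; apply/rowP => l; rewrite !mxE (H0 l).2// addr0.
have B0 : ball (0 : R) d 0 by exact: ballxx.
have eta_0 : eta 0 = 'D_1 (coord c \o q) x0.
  apply/rowP => l.
  have e1 := (is_derive_rowP _ _ _ _).1 (is_derive_map_coord (1 : R) oN Sq Nx0 cx0) l.
  have e2 := (is_derive_line0 _ _ _ _).1 e1.
  have e3 := is_deriveM (is_derive_id (0 : R) (1 : R))
    (smooth_is_derive (1 : R) (smooth_coord l oB Seta) B0).
  have e4 := is_deriveD (is_derive_cst (coord c (q x0) 0 l) (0 : R) (1 : R)) e3.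
  have e5 : is_derive (0 : R) 1 (fun r : R => (coord c \o q) (x0 + r *: 1) 0 l) (eta 0 0 l).
    apply: is_derive_ext oB B0 _ (is_derive_eq e4 _) => [r rd|].
      have -> : (coord c \o q) (x0 + r *: 1) = coord c (q x0) + r *: eta r.
        by rewrite -Eeta// [r *: 1]mulr1.
      by rewrite [RHS]mxE [X in _ = _ + X]mxE.
    by rewrite /= scale0r !add0r /GRing.scale/= mulr1.
  by rewrite -(@derive_val _ _ _ _ _ _ _ e2) (@derive_val _ _ _ _ _ _ _ e5).
set y0 := coord c (q x0).
pose Psi0 (z : R * R) : 'rV[R]_n := y0 + z.1 *: eta z.2.
pose D1 := [set z : R * R | ball (0 : R) d z.2].
have oD1 : open D1.
  by apply: (open_comp (f := fun z : R * R => z.2)) oB => z _; exact: cvg_snd.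
have SPsi0 : smooth D1 Psi0.
  apply: smoothD => //; first exact: smooth_cst.
  apply: smooth_scale => //; first exact: smooth_fst.
  apply: smooth_row => // l.
  apply: (smooth_comp (N := ball (0 : R) d) (g := fun x => eta x 0 l)) => //; first exact: smooth_snd.
  exact: smooth_coord.
pose D2 := D1 `&` Psi0 @^-1` W.
have oD2 : open D2.
  apply: (open_preimage_in (f := Psi0) oD1 oW) => z D1z; exact: smooth_continuous SPsi0 D1z.
have D20 : D2 (0, 0).
  by split; rewrite /D1 /Psi0 /= ?scale0r ?addr0//; apply: chart_image_coord.
have SPsi : smooth_map X D2 (fun z => param c (Psi0 z)).
  apply: smooth_map_param => //; first by apply: smooth_sub SPsi0 => z [].
  by move=> z [_ [y [_ dy] <-]]; exists y.
have /nbhs_ballP[r /= r0 Hr] := open_nbhs_nbhs (conj oD2 D20).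
(* The two scale factors of the family are the entries of a row of length 2, again to match the
   parameters of smooth families. *)
pose W2 := [set u : 'rV[R]_2 | ball (0 : R) r (u 0 0) /\ ball (0 : R) r (u 0 1)].
have oBr : open (ball (0 : R) r) by exact: ball_open.
have SId (O : set 'rV[R]_2) k : open O -> smooth O (fun u : 'rV[R]_2 => u 0 k).
  by move=> oO; apply: smooth_coord => //; exact: smooth_id.
have oW2 : open W2.
  by apply: openI; [apply: (open_comp (f := fun u : 'rV[R]_2 => u 0 0)) oBr|
    apply: (open_comp (f := fun u : 'rV[R]_2 => u 0 1)) oBr] => u _;
    apply: smooth_continuous (SId setT _ openT) _.
pose N2 := [set z : 'rV[R]_2 * R | D2 (z.2 * z.1 0 0, z.2 * z.1 0 1)].
have SNk (O : set ('rV[R]_2 * R)%type) k : open O -> smooth O (fun z : 'rV[R]_2 * R => z.2 * z.1 0 k).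
  move=> oO; apply: smoothM => //; first exact: smooth_snd.
  by apply: smooth_coord => //; exact: smooth_fst.
have oN2 : open N2.
  apply: (open_pair (u := fun z : 'rV[R]_2 * R => z.2 * z.1 0 0) (v := fun z : 'rV[R]_2 * R => z.2 * z.1 0 1) oD2) => z;
  exact: smooth_continuous (SNk setT _ openT) _.
have SN2 : smooth_map X N2 (fun z => param c (Psi0 (z.2 * z.1 0 0, z.2 * z.1 0 1))).
  by apply: (smooth_map_pair_comp oN2 oD2 _ (SNk _ _ oN2) (SNk _ _ oN2) SPsi).
have in01 (s k : R) : 0 <= s <= 1 -> ball (0 : R) r k -> ball (0 : R) r (s * k).
  move=> /andP[s0 s1]; rewrite -!ball_normE /ball_/= !sub0r !normrN normrM ger0_norm// => kr.
  by apply: le_lt_trans kr; rewrite ler_piMl.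
have inD2 (a b : R) : ball (0 : R) r a -> ball (0 : R) r b -> D2 (a, b) by move=> ha hb; apply: Hr; split.
have S2 : smoothC W2 (fun u => transport j (fun s => param c (Psi0 (s * u 0 0, s * u 0 1)))).
  apply: (smooth_transport Ht oW2 oN2 SN2) => u s [u0 u1] s01.
  have D2s : D2 (s * u 0 0, s * u 0 1) by apply: inD2; apply: in01.
  by split=> //; have [_ /chart_imageP[]] := D2s.
set f := fun u : 'rV[R]_2 => _ in S2.
have f0 (k : R) : f (\row_l (if l == 0 then 0 else k)) = 1.
  rewrite -(transport_cst Ht Ux0); apply: transport_ext => // s _.
  by rewrite /Psi0 !mxE /= mulr0 scale0r addr0 coordK.
have f1 (k : R) : f (\row_l (if l == 0 then k else 0)) = transport j (radial c (coord c (q x0)) (k *: eta 0)).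
  by apply: transport_ext => // s _; rewrite /radial /Psi0 !mxE /= mulr0 scalerA.
have W20 : W2 0 by split; rewrite mxE; exact: ballxx.
have line (g : 'rV[R]_2 -> R) (a b : R) : smooth W2 g ->
    is_derive (0 : R) 1 (fun h : R => g (\row_l (if l == 0 then h * a else h * b)))
      (a * 'D_(delta_mx 0 0) g 0 + b * 'D_(delta_mx 0 1) g 0).
  move=> Sg.
  have E0 : \row_l (if l == 0 then 0 * a else 0 * b) = 0 :> 'rV[R]_2.
    by apply/rowP => l; rewrite !mxE !mul0r if_same.
  have Wf : W2 (\row_l (if l == 0 then 0 * a else 0 * b)) by rewrite E0.
  have dk (l : 'I_2) : is_derive (0 : R) 1 (fun h : R => (\row_l (if l == 0 then h * a else h * b) : 'rV[R]_2) 0 l)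
      (if l == 0 then a else b).
    have -> : (fun h : R => (\row_l (if l == 0 then h * a else h * b) : 'rV[R]_2) 0 l) =
        (fun h : R => h * (if l == 0 then a else b)) by apply/funext => h; rewrite mxE; case: ifP.
    have h := is_deriveM (is_derive_id (0 : R) (1 : R)) (is_derive_cst (if l == 0 then a else b) (0 : R) (1 : R)).
    by apply: is_derive_eq h _; rewrite scaler0 add0r /GRing.scale/= mulr1.
  have h := is_derive_comp_coord (f := fun h : R => \row_l (if l == 0 then h * a else h * b))
    (@coordinates_row R 2) oW2 Wf (Sg 1%N) dk.
  by apply: is_derive_eq h _; rewrite big_ord_recl big_ord1 E0.
have radq := radial_derive oU Ht (eta 0) Ux0 cx0.
have part (g : 'rV[R]_2 -> R) (P : R[i] -> R) l : smooth W2 g -> (forall u, g u = P (f u)) ->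
    is_derive (0 : R) 1 (fun h => P (transport j (radial c (coord c (q x0)) (h *: eta 0)))) l ->
    is_derive (0 : R) 1 (fun h => P (transport j (fun s => q (x0 + s * h)))) l.
  move=> Sg gP dl.
  have h0 := line g 0 1 Sg; have h1 := line g 1 0 Sg; have h2 := line g 1 1 Sg.
  have e0 : 'D_(delta_mx 0 1) g 0 = 0.
    have := @derive_val _ _ _ _ _ _ _ h0; rewrite mul0r add0r mul1r => <-.
    have -> : (fun h : R => g (\row_l (if l == 0 then h * 0 else h * 1))) = fun=> P 1.
      by apply/funext => h; rewrite mulr0 gP f0.
    by rewrite derive_cst.
  have e1 : 'D_(delta_mx 0 0) g 0 = l.
    have := @derive_val _ _ _ _ _ _ _ h1; rewrite mul0r addr0 mul1r => <-.
    have -> : (fun h : R => g (\row_l0 (if l0 == 0 then h * 1 else h * 0))) =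
        (fun h => P (transport j (radial c (coord c (q x0)) (h *: eta 0)))).
      by apply/funext => h; rewrite mulr1 mulr0 gP f1.
    exact: (@derive_val _ _ _ _ _ _ _ dl).
  move: h2; rewrite e0 e1 mulr0 mul1r addr0 => h2.
  have rd0 : 0 < Num.min r d by rewrite lt_min r0 d0.
  have oBm : open (ball (0 : R) (Num.min r d)) by exact: ball_open.
  have Bm : ball (0 : R) (Num.min r d) 0 by exact: ballxx.
  refine (is_derive_ext oBm Bm _ h2).
  move=> h; rewrite -ball_normE /ball_/= sub0r normrN lt_min => /andP[hr hd].
  rewrite gP; congr (P _); apply: transport_ext => // s s01.
  rewrite /Psi0 !mxE /= mulr1.
  have sd : ball (0 : R) d (s * h).
    move: s01 => /andP[s0 s1]; rewrite -!ball_normE /ball_/= !sub0r !normrN normrM ger0_norm//.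
    by apply: le_lt_trans hd; rewrite ler_piMl.
  rewrite -Eeta// coordK//; by have [_ []] := sh _ sd.
rewrite -eta_0; case: S2 radq => [Sr Si] [dr di].
by split; [apply: part Sr _ dr|apply: part Si _ di].
Qed.

Lemma smooth_line_param (c : chart X) (O : set M) (x v : 'rV[R]_n) : open O -> chart_image c O x ->
  exists N : set R, [/\ open N, N 0, smooth_map X N (fun s => param c (x + s *: v)) &
    forall s, N s -> chart_image c O (x + s *: v)].
Proof.
move=> oO Ox; exists [set s : R | chart_image c O (x + s *: v)].
have oW : open (chart_image c O) by exact: chart_image_open.
have Sl (D : set R) : open D -> smooth D (fun s : R => x + s *: v).
  move=> oD; apply: smoothD => //; first exact: smooth_cst.
  by apply: smooth_scale => //; [exact: smooth_id|exact: smooth_cst].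
have oN : open [set s : R | chart_image c O (x + s *: v)].
  apply: (open_comp (f := fun s : R => x + s *: v)) => // s _.
  exact: smooth_continuous (Sl setT openT) _.
split=> //; first by rewrite /= scale0r addr0.
apply: smooth_map_param => //; first exact: Sl.
by move=> s [y [_ cy] <-]; exists y.
Qed.

Lemma sum_delta (a : 'rV[R]_n) l : \sum_m a 0 m * (delta_mx 0 l : 'rV[R]_n) 0 m = a 0 l.
Proof.
rewrite (bigD1 l)//= mxE !eqxx mulr1 big1 ?addr0// => m ml.
by rewrite mxE eqxx (negbTE ml) mulr0.
Qed.

Lemma radial_line j (c : chart X) (x v : 'rV[R]_n) (h : R) :
  transport j (fun s => param c (x + (0 + s * h) *: v)) = transport j (radial c x (h *: v)).
Proof. by apply: transport_ext => // s _; rewrite /radial add0r scalerA. Qed.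

(** Covariance: the transport along a coordinate line of [c] is differentiated twice, as a straight
    line in [c] and as a curve in [c']. Uniqueness of the derivative gives the change of
    components. *)
Lemma tqft_connection_1form j : smooth_1form (U j) (tqft_connection j).
Proof.
split.
- by move=> c y nUy; rewrite /tqft_connection asboolF.
- move=> c c' y Uy cy c'y l.
  have [N [oN N0 Sq HN]] := smooth_line_param (delta_mx 0 l) (openI (oU j) (dom_open c'))
    (chart_image_coord (conj Uy c'y) cy).
  set q := fun s : R => _ in Sq.
  have q0 : q 0 = y by rewrite /q scale0r addr0 coordK.
  have Ux0 : U j (q 0) by rewrite q0.
  have cx0 : dom c' (q 0) by rewrite q0.
  have := transport_derive oN Sq N0 Ux0 cx0.
  have -> : (fun h : R => transport j (fun s => q (0 + s * h))) =
      fun h : R => transport j (radial c (coord c y) (h *: delta_mx 0 l)).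
    by apply/funext => h; rewrite -radial_line.
  move=> /is_deriveC_unique/(_ (radial_derive oU Ht (delta_mx 0 l) Uy cy)) [].
  rewrite q0 sum_delta => <-; apply: eq_bigr => m _; congr (_ * _ 0 m).
  have := derive_line (coord c' \o param c) (coord c y) (delta_mx 0 l) 0.
  by rewrite scale0r addr0 => e; rewrite /partial -e.
- by move=> c; apply: smooth_tqft_connection.
Qed.

Lemma is_derive_partial (f : M -> R) (c : chart X) (O : set M) y l : open O -> smooth_function X O f -> O y ->
  dom c y -> is_derive (0 : R) 1 (fun h : R => f (param c (coord c y + h *: delta_mx 0 l)))
    (partial c l f y).
Proof.
move=> oO Sf Oy cy.
have oW : open (chart_image c O) by exact: chart_image_open.
have h := smooth_is_derive (delta_mx 0 l) (Sf c) (chart_image_coord Oy cy).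
exact: (is_derive_line0 _ _ _ _).1 h.
Qed.

(** The derivative at [h = 0] of [transport_label] along the coordinate line: the left factor is
    constant, the transport in [j] contributes [A_j], and the transition function at the moving end
    contributes its logarithmic derivative. *)
Lemma tqft_connection_dlog j k c y l : U j y -> U k y -> dom c y ->
  (0 +i* (tqft_connection k c y 0 l - tqft_connection j c y 0 l))%C = dlog c l (Z' true j k) y.
Proof.
move=> Uj Uk cy; have [[[_ N1 _] _ _ _] _ _] := Ht.
have oO : open (U j `&` U k) by apply: openI.
have Sg := smooth_Z_point oU Ht j k.
have dg : is_deriveC 0 (fun h : R => Z' true j k (param c (coord c y + h *: delta_mx 0 l)))
    (partial c l (fun z => complex.Re (Z' true j k z)) y +i*
     partial c l (fun z => complex.Im (Z' true j k z)) y)%C.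
  split.
    apply: (@is_derive_partial (fun z => complex.Re (Z' true j k z)) c _ y l oO) => // c'.
    by have [] := Sg c'.
  apply: (@is_derive_partial (fun z => complex.Im (Z' true j k z)) c _ y l oO) => // c'.
  by have [] := Sg c'.
have dj := radial_derive oU Ht (delta_mx 0 l) Uj cy.
have dk := radial_derive oU Ht (delta_mx 0 l) Uk cy.
rewrite !sum_delta in dj dk.
have := is_deriveC_mul (is_deriveC_mul (is_deriveC_cst 0 (Z' false j k y)) dj) dg.
rewrite !mul0r add0r !scale0r addr0 (coordK cy) (radial0 Ht Uj cy) mulr1.
have [N [oN N0 Sq HN]] := smooth_line_param (delta_mx 0 l) oO (chart_image_coord (conj Uj Uk) cy).
have /nbhs_ballP[d /= d0 Hd] := open_nbhs_nbhs (conj oN N0).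
have oB : open (ball (0 : R) d) by exact: ball_open.
have B0 : ball (0 : R) d 0 by exact: ballxx.
move=> d1; have := is_deriveC_ext oB B0 _ d1.
move=> /(_ (fun h : R => transport k (radial c (coord c y) (h *: delta_mx 0 l)))) d2.
have /d2/is_deriveC_unique/(_ dk) e : forall h : R, ball 0 d h ->
    Z' false j k y * transport j (radial c (coord c y) (h *: delta_mx 0 l)) *
    Z' true j k (param c (coord c y + h *: delta_mx 0 l)) =
    transport k (radial c (coord c y) (h *: delta_mx 0 l)).
  move=> h hd.
  pose V := [set s : R | N (s * h)].
  have Sm (D : set R) : open D -> smooth D (fun s : R => s * h).
    by move=> oD; apply: smoothM => //; [exact: smooth_id|exact: smooth_cst].
  have oV : open V.
    by apply: (open_comp (f := fun s : R => s * h)) oN => s _; apply: smooth_continuous (Sm setT openT) _.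
  have SV : smooth_map X V (radial c (coord c y) (h *: delta_mx 0 l)).
    rewrite (_ : radial _ _ _ = fun s : R => param c (coord c y + (s * h) *: delta_mx 0 l)); last first.
      by apply/funext => s; rewrite /radial scalerA.
    by apply: (smooth_map_comp (@coordinates_line R) oV oN (f := fun s : R => s * h)) Sq => // _; exact: Sm.
  have NV s : 0 <= s <= 1 -> V s.
    move=> /andP[s0 s1]; apply: Hd; move: hd.
    rewrite -!ball_normE /ball_/= !sub0r !normrN normrM ger0_norm//.
    by apply: le_lt_trans; rewrite ler_piMl.
  have inU s : V s -> U j (radial c (coord c y) (h *: delta_mx 0 l) s) /\
      U k (radial c (coord c y) (h *: delta_mx 0 l) s).
    by rewrite /radial scalerA => /HN /chart_imageP[].
  have sj : segment_in X U j (radial c (coord c y) (h *: delta_mx 0 l)).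
    by exists V; split=> // s /NV Vs; split=> //; apply: (inU s Vs).1.
  have sk : segment_in X U k (radial c (coord c y) (h *: delta_mx 0 l)).
    by exists V; split=> // s /NV Vs; split=> //; apply: (inU s Vs).2.
  rewrite (transport_label Ht sj sk); congr (_ * _ * _).
    by rewrite /radial scale0r addr0 coordK.
  by rewrite /radial scale1r.
have z1 := N1 true j k y Uj Uk; have z0 := norm1_neq0 z1.
have zc : Z' false j k y * Z' true j k y = 1 by rewrite (Z_point_false Ht Uj Uk) norm1_conj.
rewrite /dlog; apply: (mulIf z0); rewrite divfK//.
move: e; set dgv := (partial _ _ _ _ +i* _)%C; set a := tqft_connection j c y 0 l; set b := tqft_connection k c y 0 l.
move=> e; have -> : dgv = Z' true j k y * (Z' false j k y * dgv).
  by rewrite mulrA (mulrC _ (Z' false _ _ _)) zc mul1r.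
have -> : Z' false j k y * dgv = (0 +i* b)%C - (0 +i* a)%C.
  by rewrite -e mulrAC zc mul1r addrAC subrr add0r.
rewrite mulrC; congr (_ * _).
by apply: complex_ext; rewrite /= ?subr0.
Qed.

Definition bundle_of : bundle_data X J := BundleData (Z' true) tqft_connection.

Lemma bundle_ofP : U1_bundle_with_connection U bundle_of.
Proof.
have [[[Z0 N1 _] coc _ _] _ _] := Ht; split.
- move=> i j; split; [exact: Z0|exact: N1|exact: smooth_Z_point].
- exact: tqft_connection_1form.
- by move=> i j k y; apply: coc.
- by move=> j k c y Uj Uk cy l; apply: tqft_connection_dlog.
Qed.

(** Let [G r] be the transport from [x0] to [r]. By [transport_concat], [G (r + h)] is [G r] times
    the transport from [r] to [r + h], whose derivative at [h = 0] is given by [transport_derive].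
    So [G' = i (p^* A) G], and [phase_ode] integrates this equation. *)
Lemma transport_expi i (p : R -> M) (x0 x1 : R) : smooth_map X setT p -> x0 < x1 ->
  (forall x, x0 <= x <= x1 -> U i (p x)) ->
  transport i (fun s => p (x0 + s * (x1 - x0))) =
  expi (\int[lebesgue_measure]_(x in `[x0, x1]) pullback (tqft_connection i) p x).
Proof.
move=> Sp x01 Up.
pose G (r : R) := transport i (fun s => p (x0 + s * (r - x0))).
have oV : open (p @^-1` U i).
  by have := smooth_map_open openT Sp (oU i); rewrite setTI.
(* The interval is slightly enlarged inside the preimage of [U i], so that two-sided derivatives of
   [G] exist at [x0] and [x1] as well. *)
have ends (x : R) : U i (p x) -> exists2 d : R, 0 < d & forall y, `|y - x| <= d -> U i (p y).
  move=> Ux; have /nbhs_ballP[d /= d0 Hd] := open_nbhs_nbhs (conj oV Ux).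
  exists (d / 2); first by lra.
  move=> y yd; apply: Hd; rewrite -ball_normE /ball_/= distrC.
  by lra.
have [d0 d00 H0] := ends x0 (Up x0 ltac:(by rewrite lexx ltW)).
have [d1 d10 H1] := ends x1 (Up x1 ltac:(by rewrite lexx ltW)).
have Ucd y : x0 - d0 <= y <= x1 + d1 -> U i (p y).
  move=> ycd; have [y0|y0] := ltP y x0.
    by apply: H0; rewrite ler_norml; apply/andP; split; lra.
  have [y1|y1] := ltP x1 y.
    by apply: H1; rewrite ler_norml; apply/andP; split; lra.
  by apply: Up; rewrite y0 y1.
have dG r : x0 <= r <= x1 ->
    is_deriveC r G ((0 +i* pullback (tqft_connection i) p r)%C * G r).
  move=> r01; have Ur := Up r r01.
  have k := transport_derive openT Sp (I : setT r) Ur (chart_atP X (p r)).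
  have m : is_deriveC 0 (fun h : R => G r * transport i (fun s => p (r + s * h)))
      (G r * (0 +i* pullback (tqft_connection i) p r)%C).
    have := is_deriveC_mul (is_deriveC_cst 0 (G r)) k.
    by rewrite mul0r add0r.
  have d2 : 0 < Num.min d0 d1 by rewrite lt_min d00 d10.
  have oB : open (ball (0 : R) (Num.min d0 d1)) by exact: ball_open.
  have B0 : ball (0 : R) (Num.min d0 d1) 0 by exact: ballxx.
  have : is_deriveC 0 (fun h : R => G (r + h *: 1)) (G r * (0 +i* pullback (tqft_connection i) p r)%C).
    apply: is_deriveC_ext oB B0 _ m => h; rewrite -ball_normE /ball_/= sub0r normrN lt_min => /andP[].
    rewrite !ltr_norml => /andP[h1 h2] /andP[h3 h4]; rewrite [h *: 1]mulr1 /G.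
    have := @transport_concat _ _ _ X _ _ _ Ht i p setT (x0 - d0) (x1 + d1) x0 (r - x0) h openT Sp.
    have -> : x0 + (r - x0) = r by ring.
    have -> : r + h - x0 = r - x0 + h by ring.
    move=> -> //; first by move=> y /Ucd.
    - by apply/andP; split; lra.
    - by move: r01 => /andP[? ?]; apply/andP; split; lra.
    - by move: r01 => /andP[? ?]; apply/andP; split; lra.
  move=> [e1 e2]; rewrite mulrC; split.
    exact: (is_derive_line0 _ _ _ _).2 e1.
  exact: (is_derive_line0 _ _ _ _).2 e2.
have seg (f : R -> R) (l : R -> R) : (forall r, x0 <= r <= x1 -> is_derive r 1 f (l r)) ->
    primitive l x0 x1 f.
  move=> H; split; first by apply: seg_continuous_at => r /H; apply: is_derive_continuous.
  by move=> r r0 r1; apply: H; rewrite !ltW.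
have cp : seg_continuous x0 x1 (pullback (tqft_connection i) p).
  apply: seg_continuous_at => r r01.
  exact: (@pullback_continuous _ _ _ _ _ _ oU bundle_of bundle_ofP p i r Sp (Up r r01)).
have [th pth Eth] := primitive_exists (ltW x01) cp.
have := @phase_ode R (fun r => complex.Re (G r)) (fun r => complex.Im (G r))
  (pullback (tqft_connection i) p) th x0 x1 (ltW x01).
have -> : (complex.Re (G x1) +i* complex.Im (G x1))%C = G x1 by case: (G x1).
have -> : (complex.Re (G x0) +i* complex.Im (G x0))%C = G x0 by case: (G x0).
have G0 : G x0 = 1.
  rewrite -(transport_cst Ht (Up x0 ltac:(by rewrite lexx ltW))).
  by apply: transport_ext => // s _; rewrite subrr mulr0 addr0.
rewrite G0 mul1r Eth ?lexx ?ltW// -/(G x1) => -> //.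
- apply: seg => r /dG [+ _]; rewrite Re_mulc /= mul0r sub0r.
  by rewrite mulNr.
- by apply: seg => r /dG [_]; rewrite Im_mulc /= mul0r add0r.
Qed.

End Reconstruction.

(** * The correspondence *)

Section Staircase.
Variables (R : realType) (J : Type).

Definition stair (a b z : R) : R := a + (b - a) * step ((z - a) / (b - a)).

Lemma stair_left a b z : a < b -> z <= a + (b - a) / 3 -> stair a b z = a.
Proof.
move=> ab za; rewrite /stair step0 ?mulr0 ?addr0// ler_pdivrMr ?subr_gt0//; lra.
Qed.

Lemma stair_right a b z : a < b -> b - (b - a) / 3 <= z -> stair a b z = b.
Proof.
move=> ab za; rewrite /stair step1 ?mulr1 ?subrKC// ler_pdivlMr ?subr_gt0//; lra.
Qed.

Lemma stair_in a b z : a < b -> a <= stair a b z <= b.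
Proof.
move=> ab; have s0 := step_ge0 ((z - a) / (b - a)); have s1 := step_le1 ((z - a) / (b - a)).
by rewrite /stair; apply/andP; split; nra.
Qed.

Lemma smooth_stair a b : smooth setT (stair a b).
Proof.
apply: smoothD (smooth_cst _ _) _; first exact: openT.
apply: smoothM (smooth_cst _ _) _; first exact: openT.
apply: (smooth_comp (N := setT)) (@smooth_step R) => //; [exact: openT|exact: openT|].
rewrite (_ : (fun z => _) = fun z => (b - a)^-1 * z + (- (a / (b - a)))); last first.
  by apply/funext => z; rewrite mulrBl mulrC.
by apply: smooth_affine; exact: openT.
Qed.

(* A path composed with this map sits at the partition points, so it can be cut there into
   objects. *)
Fixpoint staircase (a : R) (s : seq (R * J)) (b z : R) : R :=
  match s with
  | [::] => stair a b z
  | (x, _) :: s' => stair a x z + (staircase x s' b z - x)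
  end.

Lemma smooth_staircase a s b : smooth setT (staircase a s b).
Proof.
elim: s a => [|[x j] s IH] a /=; first exact: smooth_stair.
apply: smoothD (smooth_stair _ _) _; first exact: openT.
apply: smoothB (IH x) (smooth_cst _ _); exact: openT.
Qed.

Lemma staircase_ends a i s b : all_segments (fun x y (_ : J) => x < y) a i s b ->
  exists2 e : R, 0 < e & (forall z, z <= a + e -> staircase a s b z = a) /\
    (forall z, b - e <= z -> staircase a s b z = b).
Proof.
elim: s a i => [|[x j] s IH] a i /=.
  move=> ab; exists ((b - a) / 3); first by rewrite divr_gt0 ?subr_gt0.
  by split=> z; [apply: stair_left|apply: stair_right].
move=> [ax xs]; have xb := all_segments_lt xs; have [e e0 [el er]] := IH x j xs.
exists (Num.min e ((x - a) / 3)); first by rewrite lt_min e0 divr_gt0 ?subr_gt0.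
have m1 : Num.min e ((x - a) / 3) <= e by rewrite ge_min lexx.
have m2 : Num.min e ((x - a) / 3) <= (x - a) / 3 by rewrite ge_min lexx orbT.
have ax0 : 0 < (x - a) / 3 by rewrite divr_gt0 ?subr_gt0.
split=> z hz.
  by rewrite (stair_left ax) ?(el z) ?subrr ?addr0//; lra.
have [xz|zx] := leP (x - (x - a) / 3) z.
  by rewrite (stair_right ax)// (er z) ?subrKC//; lra.
(* An impossible case: [z] would be both near [b], where the tail takes the value [b], and left of
   [x], where it takes the value [x]. *)
have zb := er z ltac:(lra); have zx' := el z ltac:(lra).
by move: zb; rewrite zx' => xb'; move: xb; rewrite xb' ltxx.
Qed.

(** Each segment of the partition is mapped to itself, so composing a path with the staircase
    preserves the labels and the partition points. *)
Lemma staircase_segments a i s b : all_segments (fun x y (_ : J) => x < y) a i s b ->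
  all_segments (fun x y _ => forall z, x <= z <= y -> x <= staircase a s b z <= y) a i s b.
Proof.
elim: s a i => [|[x j] s IH] a i /=; first by move=> ab z _; exact: stair_in.
move=> [ax xs]; have [e e0 [el er]] := staircase_ends xs.
have ax0 : 0 < (x - a) / 3 by rewrite divr_gt0 ?subr_gt0.
split=> [z /andP[_ zx]|].
  by rewrite (el z) ?subrr ?addr0; [exact: stair_in|lra].
apply: all_segments_impl xs (IH x j xs) => y w k xy _ _ H z yz.
by rewrite (stair_right ax) ?subrKC; [exact: H|case/andP: yz; lra].
Qed.

Lemma all_segments_and P Q (a : R) i s b : all_segments (J := J) P a i s b ->
  all_segments Q a i s b -> all_segments (fun x y k => P x y k /\ Q x y k) a i s b.
Proof. by elim: s a i => [|[y j] s IH] a i //= [? ?] [? ?]; split=> //; apply: IH. Qed.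

End Staircase.

Section Correspondence.
Variables (R : realType) (n : nat) (M : topologicalType).
Variable X : smooth_atlas R n M.
Variables (J : Type) (U : J -> set M).
Hypothesis oU : forall i, open (U i).

Section Surjective.
Variable t : tqft_data X U.
Hypothesis Ht : smooth_thin_invariant_tqft t.
Local Notation Z' := (Z_point t).
Local Notation Z := (Z_path t).
Local Notation A := (tqft_connection t).

Lemma staircase_object (p : R -> M) a i s b : smooth_map X setT p ->
  all_segments (fun x y _ => x < y) a i s b ->
  all_segments (fun x y i => forall z, x <= z <= y -> U i (p z)) a i s b ->
  exists O : object X U, [/\ forall x, O x = p (staircase a s b x), start O = a, stop O = b,
    first_label O = i & breaks O = s].
Proof.
move=> Sp inc sub; have [e e0 [el er]] := staircase_ends inc.
apply: (object_exists (N := setT) (eps := e)) => //.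
- exact: openT.
- exact: smooth_staircase.
- by move=> x xe; rewrite !el//; lra.
- by move=> x xe; rewrite !er//; lra.
apply: all_segments_impl inc (all_segments_and (staircase_segments inc) sub) => x y k _ _ _ [h1 h2] z xzy.
by apply: h2; apply: h1.
Qed.

(** The staircase path sits at every partition point, so axiom (iii) cuts it into one-segment
    objects. Each has exponential value by [transport_expi], and the recursion is that of
    [holonomy]. *)
Lemma Z_staircase (p : R -> M) a i s b (O : object X U) : smooth_map X setT p ->
  all_segments (fun x y _ => x < y) a i s b ->
  all_segments (fun x y i => forall z, x <= z <= y -> U i (p z)) a i s b ->
  (forall x, O x = p (staircase a s b x)) -> start O = a -> stop O = b ->
  first_label O = i -> breaks O = s -> Z O = holonomy (bundle_of t) p a i s b.
Proof.
move=> Sp; have [[_ _ _ conc] _ _] := Ht.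
have base a' b' i' (Q : object X U) : a' < b' -> (forall z, a' <= z <= b' -> U i' (p z)) ->
    (forall x, Q x = p (stair a' b' x)) -> start Q = a' -> stop Q = b' -> first_label Q = i' ->
    breaks Q = [::] -> Z Q = expi (\int[lebesgue_measure]_(x in `[a', b']) pullback (A i') p x).
  move=> ab Up Qp Qa Qb Ql Qs; rewrite -(transport_expi oU Ht Sp ab Up).
  have ab0 : b' - a' != 0 by rewrite subr_eq0 gt_eqF.
  apply: Z_segment => //; last first.
    by move=> x _; rewrite Qp Qa Qb /stair addrK mulrAC divff// mul1r mulrC.
  exists setT; split=> //; first exact: openT.
    apply: (smooth_map_comp (@coordinates_line R) openT openT (f := fun s : R => a' + s * (b' - a'))) Sp => // _.
    rewrite (_ : (fun x : R => _) = fun x => (b' - a') * x + a'); last first.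
      by apply/funext => x; rewrite addrC mulrC.
    by apply: smooth_affine; exact: openT.
  by move=> x /andP[x0 x1]; split=> //; apply: Up; apply/andP; split; nra.
elim: s a i O => [|[x j] s IH] a i O /=.
  by move=> ab Up Op Oa Ob Ol Os; apply: base.
move=> [ax xs] [Ua Us] Op Oa Ob Ol Os.
have [e e0 [el er]] := staircase_ends xs.
have [Q1 [p1 a1 b1 l1 s1]] := @staircase_object p a i [::] x Sp ax Ua.
have [Q2 [p2 a2 b2 l2 s2]] := staircase_object Sp xs Us.
have ax0 : 0 < (x - a) / 3 by rewrite divr_gt0 ?subr_gt0.
have Q1x : Q1 x = p x by rewrite p1 /= stair_right//; lra.
have -> : Z O = Z Q1 * Z' true (last_label Q1) (first_label Q2) (Q1 (stop Q1)) * Z Q2.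
  apply: conc; split; rewrite ?a1 ?b1 ?a2 ?b2 ?Oa ?Ob ?l1 ?l2 ?Ol ?s1 ?s2 ?Os//.
  - by rewrite Q1x p2 el//; lra.
  - by move=> z /andP[_ zx]; rewrite Op p1 el ?subrr ?addr0//; lra.
  - by move=> z /andP[xz _]; rewrite Op p2 stair_right ?subrKC//; lra.
rewrite (IH _ _ _ xs Us p2 a2 b2 l2 s2) (base _ _ _ _ ax Ua p1 a1 b1 l1 s1).
by rewrite /last_label /later_labels s1 l1 l2 b1 Q1x.
Qed.

(** An arbitrary object need not sit at its partition points. It is thinly homotopic to its
    staircase version by interpolating between the identity and the staircase, which stays in each
    segment by convexity. *)
Lemma Z_holonomy (O : object X U) :
  Z O = holonomy (bundle_of t) O (start O) (first_label O) (breaks O) (stop O).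
Proof.
have [_ thin _] := Ht.
have inc := partition_increasing O; have sub := partition_subordinate O.
have [Q [Qp Qa Qb Ql Qs]] := staircase_object (path_smooth O) inc sub.
have [e e0 [el er]] := staircase_ends inc.
rewrite -(Z_staircase (path_smooth O) inc sub Qp Qa Qb Ql Qs).
apply: thin => //; rewrite /last_label /later_labels ?Ql ?Qs//.
apply: (@thin_homotopy_lines _ _ _ X _ U O Q setT O id (staircase (start O) (breaks O) (stop O))) => //.
- exact: openT.
- exact: path_smooth.
- by apply: smooth_id; exact: openT.
- exact: smooth_staircase.
- by rewrite el//; lra.
- by rewrite er//; lra.
apply: all_segments_impl inc (all_segments_and (staircase_segments inc) sub) => x y k _ _ _ [h1 h2] z xzy r r01.
have /andP[z0 z1] := xzy; have /andP[w0 w1] := h1 z xzy; have /andP[r0 r1] := r01.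
by apply: h2; apply/andP; split; nra.
Qed.

Lemma tqft_of_bundle_of : tqft_of_bundle U (bundle_of t) = t.
Proof.
have [[[Z0 _ _] _ _ _] _ _] := Ht; have EZ := Z_holonomy.
have EP : (fun e i j y => if e then Z' true i j y else (Z' true i j y)^*) = Z'.
  apply/funext => -[]//; apply/funext => i; apply/funext => j; apply/funext => y.
  have [[Ui Uj]|nU] := pselect (U i y /\ U j y); first by rewrite (Z_point_false Ht).
  by rewrite !Z0// conjC0.
rewrite /tqft_of_bundle /= EP; case: t EZ => P Q /= EZ; congr TqftData.
by apply/funext => O; rewrite EZ.
Qed.

End Surjective.

(** For the TQFT of [E], the transport along a coordinate line of length [h] is
    [expi (th h - th 0)], with [th] a primitive of the connection along that line. Its derivative at
    [h = 0] is the component of the connection. *)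
Lemma connection_of_transport (E : bundle_data X J) j c y l :
  U1_bundle_with_connection U E -> smooth_thin_invariant_tqft (tqft_of_bundle U E) ->
  U j y -> dom c y -> connection E j c y 0 l = tqft_connection (tqft_of_bundle U E) j c y 0 l.
Proof.
move=> HE Ht Uy cy; have [_ F1 _ _] := HE.
have [N [oN N0 Sq HN]] := smooth_line_param (delta_mx 0 l) (oU j) (chart_image_coord Uy cy).
set q := fun s : R => _ in Sq.
have q0 : q 0 = y by rewrite /q scale0r addr0 coordK.
have UN s : N s -> U j (q s) by move=> /HN /chart_imageP[].
have Spull : smooth N (pullback (connection E j) q).
  have S1 := smooth_pull (oU j) (F1 j) (1 : R) oN Sq UN.
  by apply: smooth_ext S1.
have /nbhs_ballP[d /= d0 Hd] := open_nbhs_nbhs (conj oN N0).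
have inN (s : R) : `|s| < d -> N s by move=> sd; apply: Hd; rewrite -ball_normE /ball_/= sub0r normrN.
have cq : seg_continuous (- (d / 2)) (d / 2) (pullback (connection E j) q).
  apply: seg_continuous_at => s /andP[s0 s1]; apply: smooth_continuous Spull _; apply: inN.
  by rewrite ltr_norml; apply/andP; split; lra.
have dd : - (d / 2) <= d / 2 by lra.
have [th [_ dth] _] := primitive_exists dd cq.
have dth0 := dth 0 ltac:(lra) ltac:(lra).
have value (h : R) : `|h| < d / 2 ->
    transport (tqft_of_bundle U E) j (radial c (coord c y) (h *: delta_mx 0 l)) = expi (th h - th 0).
  (* The path of the object behind [transport] is [q \o f]. By the chain rule [th \o f] is a
     primitive along it, so its shape between 0 and [h] drops out. *)
  move=> hd; pose f (r : R) := step r * h.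
  have fd r : `|f r| < d / 2.
    by rewrite normrM ger0_norm ?step_ge0//; apply: le_lt_trans hd; rewrite ler_piMl ?step_le1.
  have df (r : R) : is_derive r 1 f ('D_1 f r).
    apply: (@smooth_is_derive _ _ _ setT) => //.
    by apply: smoothM (smooth_cst _ _) => //; [exact: openT|exact: smooth_step].
  have seg : segment_in X U j (radial c (coord c y) (h *: delta_mx 0 l)).
    exists [set s : R | N (s * h)].
    have Sm (D : set R) : open D -> smooth D (fun s : R => s * h).
      by move=> oD; apply: smoothM => //; [exact: smooth_id|exact: smooth_cst].
    have oV : open [set s : R | N (s * h)].
      by apply: (open_comp (f := fun s : R => s * h)) oN => s _; apply: smooth_continuous (Sm setT openT) _.
    have e s : radial c (coord c y) (h *: delta_mx 0 l) s = q (s * h) by rewrite /radial scalerA.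
    split=> //.
      rewrite (_ : radial _ _ _ = fun s : R => q (s * h)); last by apply/funext.
      by apply: (smooth_map_comp (@coordinates_line R) oV oN (f := fun s : R => s * h)) Sq => // _; exact: Sm.
    move=> s /andP[s0 s1]; have Ns : N (s * h).
      apply: inN; rewrite normrM ger0_norm//; have : s * `|h| <= `|h| by rewrite ler_piMl.
      by have := normr_ge0 h; lra.
    by rewrite e; split=> //; apply: UN.
  have [Q sQ] := segment_object seg; rewrite (transportE Ht sQ).
  case: sQ => Qp Qa Qb Ql Qs.
  have EQ : path_of Q = q \o f by apply/funext => r; rewrite Qp /radial scalerA.
  rewrite /= Qa Qb Ql Qs /= (integral_primitive ler01 (th := th \o f)).
  - have f0 : f 0 = 0 by rewrite /f step0 ?mul0r//; lra.
    have f1 : f 1 = h by rewrite /f step1 ?mul1r//; lra.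
    by rewrite /= f0 f1.
  - apply: seg_continuous_at => r r01.
    apply: (@pullback_continuous _ _ _ _ _ _ oU E HE Q j r (path_smooth Q)).
    rewrite EQ /=; apply: UN; apply: inN; apply: lt_trans (fd r) _; lra.
  - have step1' (r : R) : is_derive r 1 (th \o f) (pullback (connection E j) Q r).
      have fr := fd r; move: fr; rewrite ltr_norml => /andP[fr1 fr2].
      have Nf : N (f r) by apply: inN; apply: lt_trans (fd r) _; lra.
      rewrite EQ (pullback_comp _ oN Sq Nf (df r)) mulrC.
      exact: is_derive1_comp (dth _ fr1 fr2) (df r).
    split; last by move=> r _ _; apply: step1'.
    by apply: seg_continuous_at => r _; apply: is_derive_continuous (step1' r).
have pq : pullback (connection E j) q 0 = connection E j c y 0 l.
  have cq0 : dom c (q 0) by rewrite q0.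
  have Uq0 : U j (q 0) by rewrite q0.
  rewrite [LHS](pull_chart (F1 j) (1 : R) oN Sq N0 Uq0 cq0) q0 -[RHS]sum_delta.
  apply: eq_bigr => m _; congr (_ * _ 0 m).
  rewrite (derive_ext (g := fun s : R => coord c y + s *: delta_mx 0 l) (1 : R) oN N0).
    by rewrite (derive_line id) derive_id.
  by move=> s /HN /chart_imageP[].
have d2 : 0 < d / 2 by lra.
have oB : open (ball (0 : R) (d / 2)) by exact: ball_open.
have B0 : ball (0 : R) (d / 2) 0 by exact: ballxx.
have dC : is_deriveC 0 (fun h : R => transport (tqft_of_bundle U E) j (radial c (coord c y) (h *: delta_mx 0 l)))
    (0 +i* connection E j c y 0 l)%C.
  apply: is_deriveC_ext oB B0 _ (_ : is_deriveC 0 (fun h => expi (th h - th 0)) _).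
    by move=> h; rewrite -ball_normE /ball_/= sub0r normrN => hd; rewrite value.
  have dB := is_deriveB dth0 (is_derive_cst (th 0) (0 : R) (1 : R)).
  have z0 : (th - cst (th 0)) 0 = 0 by exact: subrr.
  split=> /=.
    have := is_derive1_comp (is_derive_cos ((th - cst (th 0)) 0)) dB.
    by rewrite z0 sin0 oppr0 mul0r.
  have := is_derive1_comp (is_derive_sin ((th - cst (th 0)) 0)) dB.
  by rewrite z0 cos0 mul1r subr0 pq.
have := is_deriveC_unique dC (radial_derive oU Ht (delta_mx 0 l) Uy cy).
by rewrite sum_delta => -[].
Qed.

Lemma tqft_of_bundle_inj (E E' : bundle_data X J) :
  U1_bundle_with_connection U E -> U1_bundle_with_connection U E' ->
  smooth_thin_invariant_tqft (tqft_of_bundle U E) ->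
  tqft_of_bundle U E = tqft_of_bundle U E' -> E = E'.
Proof.
move=> HE HE' Ht e; have Ht' : smooth_thin_invariant_tqft (tqft_of_bundle U E') by rewrite -e.
have eg : transition E = transition E'.
  by have := congr1 (fun t => Z_point t true) e.
have eA : connection E = connection E'.
  apply/funext => j; apply/funext => c; apply/funext => y.
  have [[Uy cy]|nU] := pselect (U j y /\ dom c y).
    by apply/rowP => l; rewrite !connection_of_transport// e.
  (* Outside [U j] and the domain of [c], both connections take the default value 0. *)
  have [_ F _ _] := HE; have [_ F' _ _] := HE'.
  by have [-> // _ _] := F j; have [-> // _ _] := F' j.
by case: E E' {HE HE' Ht Ht' e} eg eA => g A [g' A'] /= -> ->.
Qed.

End Correspondence.

Theorem theorem3p8 (R : realType) (n : nat) (M : topologicalType)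
    (X : smooth_atlas R n M) (J : Type) (U : J -> set M)
    (M_hausdorff : hausdorff_space M)
    (M_second_countable : @second_countable M)
    (U_good : good_cover R U) :
  set_bij [set E : bundle_data X J | U1_bundle_with_connection U E]
          [set t : tqft_data X U | smooth_thin_invariant_tqft t]
          (@tqft_of_bundle R n M X J U).
Proof.
have [oU cU _] := U_good.
have coverU y : exists i, U i y.
  have : (\bigcup_i U i) y by rewrite cU.
  by move=> [i _ Ui]; exists i.
have fwd E : U1_bundle_with_connection U E -> smooth_thin_invariant_tqft (@tqft_of_bundle R n M X J U E).
  move=> HE; split; first exact: tqft_axioms.
    exact: thin_invariance.
  exact: smooth_tqft_of_bundle.
split.
- by move=> E; apply: fwd.
- move=> E E'; rewrite !inE => HE HE'; apply: tqft_of_bundle_inj => //.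
  exact: fwd.
- by move=> t Ht; exists (bundle_of t); [exact: bundle_ofP|exact: tqft_of_bundle_of].
Qed.
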